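(* Let $\Phi\in C_c^2(\mathbb R)$ be a positive function. For $k\in\{1,\tfrac12\}$ let $h_k(r)=\Lambda_k(-1-r^2)$, i.e. $\int_{\mathfrak S_2}K_k(Z,W)\rho(W)^{1+ir}dm(W)=h_k(r)\rho(Z)^{1+ir}$. (a) Set $P_1(v)=\int_v^\infty\frac{2\Phi(u)}{u+1}\sqrt{(v+1)(u-v)}\,du$ and $g_1(\eta)=P_1(v)$ with $v=\frac14(e^\eta+e^{-\eta}-2)$. Then $h_1(r)=2\pi\int_{-\infty}^\infty g_1(\eta)e^{ir\eta}d\eta$, $g_1(\eta)=\frac1{4\pi^2}\int_{-\infty}^\infty h_1(r)e^{-ir\eta}dr$, and $$\Phi(u)=\frac{u+1}{\pi}\int_u^\infty\frac{1}{\sqrt{v-u}}\,d\Big[\Big(\frac{P_1(v)}{\sqrt{v+1}}\Big)'\Big].$$ (b) Set $Q_0(v)=2\int_v^\infty\Phi(u)\sqrt{\frac{u-v}{u+1}}\,du$ and $g_{1/2}(\eta)=Q_0(v)$ with $v=\frac14(e^\eta+e^{-\eta}-2)$. Then $h_{1/2}(r)=2\pi\int_{-\infty}^\infty g_{1/2}(\eta)e^{ir\eta}d\eta$, $g_{1/2}(\eta)=\frac1{4\pi^2}\int_{-\infty}^\infty h_{1/2}(r)e^{-ir\eta}dr$, and $$\Phi(u)=\frac1\pi\sqrt{u+1}\int_u^\infty\frac{dQ_0'(v)}{\sqrt{v-u}}.$$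
   Context: $\mathfrak S_2=\{(z_1,z_2)\in\mathbb C^2: z_1+\bar z_1-z_2\bar z_2>0\}$. $\rho(Z,W)=\bar z_1+w_1-\bar z_2w_2$, $\rho(Z)=\rho(Z,Z)$, $u(Z,W)=\frac{|\rho(Z,W)|^2}{\rho(Z)\rho(W)}-1$, $K_k(Z,W)=\frac{\rho(Z,W)^{2k}}{|\rho(Z,W)|^{2k}}\Phi(u(Z,W))$, $dm(Z)=\rho(Z)^{-3}dz_1d\bar z_1dz_2d\bar z_2$. $\Lambda_k(\lambda)$ denotes the constant by which the integral operator $f\mapsto\int_{\mathfrak S_2}K_k(\cdot,W)f(W)dm(W)$ acts on $C^2$ eigenfunctions of $\Delta_k$ with eigenvalue $\lambda$, where $\Delta_k=(z_1+\bar z_1-z_2\bar z_2)[(z_1+\bar z_1)\partial_{z_1}\partial_{\bar z_1}+\partial_{z_2}\partial_{\bar z_2}+z_2\partial_{\bar z_1}\partial_{z_2}+\bar z_2\partial_{z_1}\partial_{\bar z_2}-k(\partial_{z_1}-\partial_{\bar z_1})]$; $\rho^s$ is an eigenfunction with eigenvalue $s(s-2)$. *)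

(* Defs.v *)
From HB Require Import structures.
From mathcomp Require Import all_boot all_order all_algebra.
From mathcomp Require Import all_classical all_reals all_analysis.
From mathcomp Require Import complex.
Import Order.TTheory GRing.Theory Num.Theory.
Import numFieldNormedType.Exports.

Set Implicit Arguments.
Unset Strict Implicit.
Unset Printing Implicit Defensive.

Local Open Scope ring_scope.
Local Open Scope classical_set_scope.
Local Open Scope complex_scope.

Section SiegelDefs.
Variable R : realType.
Local Notation C := R[i].

Definition cintegral d (T : measurableType d) (mu : {measure set T -> \bar R})
  (D : set T) (f : T -> C) : C :=
  (Rintegral mu D (fun x => complex.Re (f x))) +i* (Rintegral mu D (fun x => complex.Im (f x))).

(* Lebesgue measure on R^4 = C^2, coordinates (((x1, y1), x2), y2) *)
Definition leb4 :=
  ((((@lebesgue_measure R) \x (@lebesgue_measure R)) \x (@lebesgue_measure R))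
     \x (@lebesgue_measure R))%E.

Definition ofR4 (p : ((R * R) * R) * R) : C * C :=
  (p.1.1.1 +i* p.1.1.2, p.1.2 +i* p.2).

Definition rhoZW (Z W : C * C) : C := (Z.1)^* + W.1 - (Z.2)^* * W.2.

Definition Siegel2 : set (C * C) :=
  [set Z | 0 < Z.1 + (Z.1)^* - Z.2 * (Z.2)^*].

(* rho(Z) = rho(Z, Z), which is real *)
Definition rhoR (Z : C * C) : R := complex.Re (rhoZW Z Z).

Definition uZW (Z W : C * C) : R :=
  complex.Re (`|rhoZW Z W| ^+ 2) / (rhoR Z * rhoR W) - 1.

(* K_k(Z, W) with m = 2k : (rho(Z,W) / |rho(Z,W)|)^(2k) * Phi(u(Z,W)) *)
Definition Kker (m : nat) (Phi : R -> R) (Z W : C * C) : C :=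
  (rhoZW Z W / `|rhoZW Z W|) ^+ m * (Phi (uZW Z W))%:C.

Definition cpowR (x : R) (s : C) : C :=
  (expR (complex.Re s * ln x) * cos (complex.Im s * ln x)) +i*
  (expR (complex.Re s * ln x) * sin (complex.Im s * ln x)).

(* integral over S_2 against dm(W) = rho(W)^-3 dw1 dconj(w1) dw2 dconj(w2),
   where dw dconj(w) = 2 dx dy (Lebesgue) for w = x + i y *)
Definition int_dm (f : C * C -> C) : C :=
  cintegral leb4 [set p | Siegel2 (ofR4 p)]
    (fun p => (4 * (rhoR (ofR4 p)) ^- 3)%:C * f (ofR4 p)).

Definition expi (t : R) : C := cos t +i* sin t.

Definition cintR (f : R -> C) : C := cintegral (@lebesgue_measure R) setT f.

Definition v_of_eta (eta : R) : R := (expR eta + expR (- eta) - 2) / 4.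

Definition P1 (Phi : R -> R) (v : R) : R :=
  Rintegral (@lebesgue_measure R) `]v, +oo[
    (fun u => 2 * Phi u / (u + 1) * Num.sqrt ((v + 1) * (u - v))).

Definition Q0 (Phi : R -> R) (v : R) : R :=
  2 * Rintegral (@lebesgue_measure R) `]v, +oo[
    (fun u => Phi u * Num.sqrt ((u - v) / (u + 1))).

Definition C2c (Phi : R -> R) : Prop :=
  (forall x, derivable Phi x 1) /\
  (forall x, derivable Phi^`() x 1) /\
  continuous Phi^`()^`() /\
  compact (closure [set x | Phi x != 0]).

End SiegelDefs.

(* Main.v *)
Require Import Defs.
From HB Require Import structures.
From mathcomp Require Import all_boot all_order all_algebra.
From mathcomp Require Import all_classical all_reals all_analysis.
From mathcomp Require Import measurable_realfun.
From mathcomp Require Import complex.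
From mathcomp Require Import ring lra.
Import Order.TTheory GRing.Theory Num.Theory.
Import numFieldNormedType.Exports.

Set Implicit Arguments.
Unset Strict Implicit.
Unset Printing Implicit Defensive.

Local Open Scope ring_scope.
Local Open Scope classical_set_scope.

(** For [Z = (a1 + i b1, a2 + i b2)] and [W = (x1 + i y1, x2 + i y2)], put
    [t = rho(W)] and let [A] and [y] be the real and imaginary parts of
    [rho(Z, W)].  Then [A = (rho(Z) + t + |w2 - z2|^2) / 2 > 0], and [y] is [y1] up
    to a translation depending on [w2] only.  In the variables
    [t = rho(Z) e^eta], [w = y / A] and [u = u(Z, W)] (which replaces the radius
    [|w2 - z2|]) the region of integration becomes
    [(1 + w^2) (v(eta) + 1) < u + 1] and the integrand a constant times
    [rho(Z) Phi(u) (phase of 1 + i w)^(2k) e^(i r (ln rho(Z) + eta)) / (1 + w^2)].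
    Integrating in [w] is elementary and produces the weights of [P1] and [Q0],
    so the eigenvalue is [2 pi] times the Fourier transform of
    [g(eta) = P1(v(eta))] (resp. [Q0]).  The function [g] is even, [C^2] and
    compactly supported, hence Fourier inversion applies (by Abel summation against
    the Poisson kernel).  Finally [P1(v) / sqrt(v + 1)] and [Q0(v)] are equal to
    [2 int_0^oo psi(v + x) sqrt x dx] with [psi(u) = Phi(u) (u + 1)^p], [p = -1] resp.
    [p = -1/2]; differentiating twice under the integral and applying Abel's
    inversion [int_u^oo A[psi''](v) / sqrt(v - u) dv = pi/2 int_0^oo z psi''(u + z) dz
    = pi/2 psi(u)] recovers [Phi]. *)

(** Tonelli and the substitutions below are used for nonnegative integrands, while the kernel is
    complex. Its real and imaginary parts both have the form [A t * cw w + B t * sw w], bounded by 1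
    in absolute value. Adding the constant 1 makes them nonnegative; the same computation with
    [A = B = 0] gives the finite contribution of that 1, and subtraction yields the signed integral.
    The [sw] term is odd in [w] and drops out, so one real profile [g] suffices. Constants: the
    density [4 t^-3] times [|rho(W)^(1+ir)| = t] gives [4 / t^2]; the Jacobians are [t / 2] for [x1]
    and [A] for [y1]; since [A dA] is proportional to [du], the plane of [w2] contributes
    [pi rho t / (1 + w^2)]. The powers of [t] cancel and leave [2 pi rho / (1 + w^2)]. As
    [dw / (1 + w^2)] is the measure of the angle [theta = arctan w], the phases [cos theta] (k =
    1/2) and [cos (2 theta)] (k = 1) have the antiderivatives [sin theta] and [sin (2 theta) / 2],
    which become the two weights. On the inversion side, [psi] may be singular at -1, so all
    calculus there takes place on rays strictly to the right of -1. *)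

Section ge0_integral_image_measure.
Context {R : realType} {d d' : measure_display} {T : measurableType d} {U : measurableType d'}.
Variables (mu : {measure set T -> \bar R}) (nu : {measure set U -> \bar R}).
Variables (F : T -> U) (g : T -> R) (D : set T) (E : set U).
Hypothesis mD : measurable D.
Hypothesis mE : measurable E.
Hypothesis mF : measurable_fun D F.
Hypothesis mg : measurable_fun D g.
Hypothesis g0 : forall x, D x -> 0 <= g x.
Hypothesis FE : forall x, D x -> E (F x).
Local Open Scope ereal_scope.
Hypothesis nuE : forall A, measurable A ->
  nu (A `&` E) = \int[mu]_(x in D `&` F @^-1` A) (g x)%:E.

Import HBNNSimple.

(** [nuE] says that [nu] on [E] is the image under [F] of the measure with density [g]. This settles
    indicators; simple functions follow by additivity, and monotone convergence along
    [nnsfun_approx] does the rest. *)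
Lemma ge0_integral_image_measure (f : U -> \bar R) :
  measurable_fun E f -> (forall y, E y -> 0 <= f y) ->
  \int[nu]_(y in E) f y = \int[mu]_(x in D) (f (F x) * (g x)%:E).
Proof.
move=> mf f0.
pose f_ := nnsfun_approx mE mf.
have mfF n : measurable_fun D (EFin \o f_ n \o F).
  by apply/measurable_EFinP; apply: measurableT_comp.
have indicE' (A : set U) (mA : measurable A) :
    \int[nu]_(y in E) (\1_A y)%:E = \int[mu]_(x in D) (\1_A (F x) * g x)%:E.
  transitivity (nu (A `&` E)); first by rewrite integral_indic.
  rewrite nuE// integral_mkcondr.
  apply: eq_integral => x /set_mem Dx; rewrite patchE /= indicE.
  have -> : (x \in F @^-1` A) = (F x \in A) by apply/idP/idP; rewrite !inE.
  by case: ifPn => _; rewrite ?mul1r ?mul0r.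
have sfE n : \int[nu]_(y in E) (f_ n y)%:E =
             \int[mu]_(x in D) ((f_ n (F x)) * g x)%:E.
  under [LHS]eq_integral => y _.
    rewrite fimfunE.
    rewrite -fsumEFin//.
    over.
  rewrite ge0_integral_fsum//; last 2 first.
  - by move=> y; exact/measurable_EFinP/measurable_funM.
  - by move=> y x _; rewrite nnfun_muleindic_ge0.
  under [RHS]eq_integral => x _.
    rewrite fimfunE mulrC mulr_fsumr -fsumEFin//.
    over.
  rewrite ge0_integral_fsum//; last 2 first.
  - move=> y; apply/measurable_EFinP/measurable_funM => //.
    apply: measurable_funM => //.
    apply: measurableT_comp => //.
  - move=> y x Dx; rewrite EFinM mule_ge0 ?lee_fin ?g0//.
    by rewrite -lee_fin nnfun_muleindic_ge0.
  apply: eq_fsbigr => r _.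
  (* A negative value is not taken by a nonnegative simple function, so its preimage is empty and
     both sides are 0; the other values may be pulled out as nonnegative scalars. *)
  have [r0|r0] := ltP r 0%R.
    rewrite (@integral0_eq _ _ _ nu); last by move=> x _; rewrite preimage_nnfun0//= indic0 mulr0.
    by rewrite (@integral0_eq _ _ _ mu)// => x _; rewrite preimage_nnfun0//= indic0 !mulr0.
  under eq_integral do rewrite EFinM.
  rewrite ge0_integralZl_EFin//; last by apply/measurable_EFinP.
  rewrite indicE'//.
  rewrite -ge0_integralZl_EFin//; last first.
  - apply/measurable_EFinP; apply: measurable_funM => //; exact: measurableT_comp.
  - by move=> x Dx; rewrite lee_fin mulr_ge0 ?g0.
  by apply: eq_integral => x _; rewrite -EFinM mulrA mulrC.
transitivity (limn (fun n => \int[nu]_(y in E) (f_ n y)%:E)).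
  rewrite -monotone_convergence//.
  - apply: eq_integral => y /[!inE] yE; apply/esym/cvg_lim => //.
    exact: cvg_nnsfun_approx.
  - by move=> n; exact/measurable_EFinP/measurable_funTS.
  - by move=> n y _; rewrite lee_fin.
  - by move=> y _ m n mn; rewrite lee_fin; exact/lefP/nd_nnsfun_approx.
under eq_fun do rewrite sfE.
rewrite -monotone_convergence//.
- apply: eq_integral => x /[!inE] Dx; apply/cvg_lim => //.
  under eq_fun do rewrite EFinM.
  apply: cvgeZr => //.
  by apply: cvg_nnsfun_approx => //; exact: FE.
- by move=> n; apply/measurable_EFinP/measurable_funM => //; exact/measurable_EFinP/mfF.
- by move=> n x Dx; rewrite lee_fin mulr_ge0 ?g0.
- move=> x Dx m n mn; rewrite lee_fin ler_wpM2r ?g0//.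
  by exact/lefP/nd_nnsfun_approx.
Qed.

End ge0_integral_image_measure.

(** * Change of variables on the line, from the measures of intervals *)

Section change_of_variables.
Context {R : realType} {d : measure_display} {T : measurableType d}.
Variables (mu : {measure set T -> \bar R}) (F g : T -> R) (D : set T) (E : set R).
Hypothesis mD : measurable D.
Hypothesis mE : measurable E.
Hypothesis mF : measurable_fun D F.
Hypothesis mg : measurable_fun D g.
Hypothesis g0 : forall x, D x -> 0 <= g x.
Hypothesis FE : forall x, D x -> E (F x).
Hypothesis FgE : forall a b : R, a < b ->
  (\int[mu]_(x in D `&` F @^-1` `]a, b]%classic) (g x)%:E =
   lebesgue_measure (`]a, b]%classic `&` E))%E.
Local Notation leb := (@lebesgue_measure R).
Local Open Scope ereal_scope.

Let m1 (A : set (measurableTypeR R)) : \bar R :=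
  \int[mu]_(x in D `&` F @^-1` A) (g x)%:E.

Let m1_0 : m1 set0 = 0.
Proof. by rewrite /m1 preimage_set0 setI0 integral_set0. Qed.

Let m1_ge0 A : 0 <= m1 A.
Proof. by apply: integral_ge0 => x [Dx _]; rewrite lee_fin g0. Qed.

Let m1_sigma : semi_sigma_additive m1.
Proof.
move=> A mA tA mUA.
rewrite /m1 preimage_bigcup setI_bigcupr ge0_integral_bigcup.
- apply: is_cvg_nneseries => n _ _.
  by apply: integral_ge0 => x [Dx _]; rewrite lee_fin g0.
- by move=> k; apply: mF => //; exact: mA.
- apply/measurable_EFinP; apply: measurable_funS mg => //.
  by move=> x [k _ []].
- by move=> x [k _ [Dx _]]; rewrite lee_fin g0.
- apply/trivIsetP => i j _ _ ij; move/trivIsetP : tA => /(_ i j Logic.I Logic.I ij) Aij.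
  rewrite -subset0 => x [[_ Aix] [_ Ajx]].
  have : (A i `&` A j) (F x) by split.
  by rewrite Aij.
Qed.

Let m1_pack : {measure set (measurableTypeR R) -> \bar R} :=
  HB.pack m1 (isMeasure.Build _ _ _ m1 m1_0 m1_ge0 m1_sigma).

Let mEC : measurable (~` E : set (measurableTypeR R)).
Proof. exact: measurableC. Qed.

(** Uniqueness of Lebesgue measure compares measures on the whole line, whereas [m1] only sees [E].
    Adding Lebesgue measure restricted to the complement of [E] gives a measure with the right value
    on every []a, b]], hence equal to [leb]; intersecting with [E] removes the added part. *)
Let m1E (A : set R) : measurable A -> leb (A `&` E) = m1 A.
Proof.
move=> mA.
pose nu := measure_add m1_pack (mrestr leb mEC).
have nuDE B : nu B = m1 B + leb (B `&` ~` E).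
  exact: (measure_addE m1_pack (mrestr leb mEC)).
have nuE B : measurable B -> leb B = nu B.
  apply: lebesgue_measure_unique => _ [[a b] _ <-].
  rewrite [RHS]nuDE /=.
  have [ba|{}ab] := leP b a.
    by rewrite set_itv_ge ?bnd_simp -?leNgt// set0I m1_0 add0e.
  rewrite /m1 FgE// -measureU//.
  - by rewrite -setIUr setUv setIT.
  - exact: measurableI.
  - exact: measurableI.
  - by rewrite setIACA setICr setI0.
rewrite nuE; last exact: measurableI.
rewrite nuDE -setIA setICr setI0 measure0 adde0.
congr (integral mu _ _); rewrite preimage_setI setIA; apply/seteqP; split=> x.
  by move=> -[].
by move=> [Dx Ax]; split => //; exact: FE.
Qed.

Lemma ge0_change_of_variables (f : R -> \bar R) :
  measurable_fun E f -> (forall y, E y -> 0 <= f y) ->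
  \int[leb]_(y in E) f y = \int[mu]_(x in D) (f (F x) * (g x)%:E).
Proof. by move=> mf f0; apply: ge0_integral_image_measure. Qed.

End change_of_variables.

(** * Affine, exponential and quadratic substitutions *)

Section substitutions.
Context {R : realType}.
Implicit Types f : R -> \bar R.
Local Notation leb := (@lebesgue_measure R).

Lemma ge0_integral_affine f (a b : R) : a != 0 ->
  measurable_fun setT f -> (forall x, 0 <= f x)%E ->
  (\int[leb]_x f x = \int[leb]_x (f (a * x + b)%R * `|a|%:E))%E.
Proof.
move=> a0 mf f0.
apply: (@ge0_change_of_variables R _ _ leb (fun x => a * x + b) (cst `|a|)) => //.
- by apply: measurable_funD => //; exact: mulrl_measurable.
- move=> p q pq; rewrite setTI setIT.
  transitivity (`|a|%:E * leb ((fun x => a * x + b)%R @^-1` `]p, q]%classic))%E.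
    apply: (@integral_cst _ _ _ leb _ _ `|a|%:E); rewrite -[X in measurable X]setTI.
    by apply: measurable_funD => //; exact: mulrl_measurable.
  move: a0; rewrite neq_lt => /orP[a0|a0].
  - have -> : (fun x => a * x + b) @^-1` `]p, q]%classic =
        `[((q - b) / a), ((p - b) / a)[%classic.
      apply/seteqP; split => x /=; rewrite !in_itv/=.
      + by move=> /andP[? ?]; rewrite ler_ndivrMr// ltr_ndivlMr//; apply/andP; split; lra.
      + by rewrite ler_ndivrMr// ltr_ndivlMr// => /andP[? ?]; apply/andP; split; lra.
    rewrite !lebesgue_measure_itv/= !lte_fin pq ltr_ndivrMr// divfK ?lt_eqF//.
    rewrite ltrD2r pq -!EFinB -EFinM ltr0_norm//; congr EFin; field.
    by rewrite lt_eqF.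
  - have -> : (fun x => a * x + b) @^-1` `]p, q]%classic =
        `]((p - b) / a), ((q - b) / a)]%classic.
      apply/seteqP; split => x /=; rewrite !in_itv/=.
      + by move=> /andP[? ?]; rewrite ltr_pdivrMr// ler_pdivlMr//; apply/andP; split; lra.
      + by rewrite ltr_pdivrMr// ler_pdivlMr// => /andP[? ?]; apply/andP; split; lra.
    rewrite !lebesgue_measure_itv/= !lte_fin pq ltr_pdivrMr// divfK ?gt_eqF//.
    rewrite ltrD2r pq -!EFinB -EFinM gtr0_norm//; congr EFin; field.
    by rewrite gt_eqF.
Qed.

Let setI_oc_oy (a b : R) :
  `]a, b]%classic `&` `]0, +oo[%classic = `]Num.max a 0, b]%classic.
Proof.
apply/seteqP; split => x /=; rewrite !in_itv/= gt_max.
  by move=> [/andP[-> ->]]; rewrite andbT => ->.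
by move=> /andP[/andP[-> ->] ->].
Qed.

(** Serves the intervals []a, b]] with [a <= 0 < b] in the exponential substitution: their part in
    []0, +oo[] pulls back to a left ray. The reflection [x -> - x] turns it into an integral to
    [+oo]. *)
Lemma integral_Ny_expR (b : R) :
  (\int[leb]_(x in `]-oo, b]) (expR x)%:E = (expR b)%:E)%E.
Proof.
rewrite -(opprK b) ge0_integration_by_substitutionNy.
- rewrite (@ge0_continuous_FTC2y _ _ (fun x => - expR (- x)) _ 0).
  + by rewrite -EFinN -EFinD; congr EFin; ring.
  + by move=> x _; exact: expR_ge0.
  + apply: continuous_subspaceT => x.
    by apply: continuous_comp; [exact: continuousN|exact: continuous_expR].
  + rewrite -oppr0; apply: cvgN; exact: cvgr_expR.
  + by move=> x _; apply: derivableN.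
  + apply: cvg_at_right_filter; apply: cvgN.
    by apply: continuous_comp; [exact: continuousN|exact: continuous_expR].
  + by move=> x _; rewrite derive1E derive_val/=; ring.
- by apply: continuous_subspaceT => x; exact: continuous_expR.
- by move=> x _; exact: expR_ge0.
Qed.

Lemma integral_expR (a b : R) : a < b ->
  (\int[leb]_(x in `]a, b]) (expR x)%:E = (expR b - expR a)%:E)%E.
Proof.
move=> ab; rewrite integral_itv_obnd_cbnd; last first.
  by apply/measurable_EFinP/measurable_funTS.
rewrite (@continuous_FTC2 _ _ expR)//.
- by apply: continuous_subspaceT => x; exact: continuous_expR.
- split => //.
  + by apply: cvg_at_right_filter; exact: continuous_expR.
  + by apply: cvg_at_left_filter; exact: continuous_expR.
- by move=> x _; rewrite derive1E derive_val.
Qed.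

Lemma ge0_integral_exp f :
  measurable_fun (`]0, +oo[%classic : set R) f -> (forall x, (0 < x)%R -> 0 <= f x)%E ->
  (\int[leb]_(x in `]0%R, +oo[) f x = \int[leb]_x (f (expR x) * (expR x)%:E))%E.
Proof.
move=> mf f0.
apply: (@ge0_change_of_variables R _ _ leb expR expR) => //.
- by move=> x _; rewrite /= in_itv/= expR_gt0.
- move=> a b ab; rewrite setTI setI_oc_oy.
  have [b0|b0] := leP b 0.
    rewrite [X in leb X]set_itv_ge ?measure0; last first.
      by rewrite bnd_simp -leNgt le_max b0 orbT.
    rewrite (_ : _ @^-1` _ = set0) ?integral_set0// -subset0 => x /=.
    by rewrite in_itv/= => /andP[_]; rewrite leNgt (le_lt_trans b0)// expR_gt0.
  have eb x : (expR x <= b) = (x <= ln b) by rewrite -{1}(lnK b0) ler_expR.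
  have [a0|a0] := leP a 0.
    rewrite (_ : _ @^-1` _ = `]-oo, ln b]%classic).
      rewrite integral_Ny_expR lnK//.
      by rewrite lebesgue_measure_itv/= lte_fin b0 sube0.
    apply/seteqP; split => x /=; rewrite !in_itv/= eb.
      by move=> /andP[].
    by move=> ->; rewrite (le_lt_trans a0)// expR_gt0.
  rewrite (_ : _ @^-1` _ = `]ln a, ln b]%classic).
    rewrite integral_expR ?ltr_ln// !lnK//.
    by rewrite lebesgue_measure_itv/= lte_fin ab -EFinB.
  have ea x : (a < expR x) = (ln a < x) by rewrite -{1}(lnK a0) ltr_expR.
  by apply/seteqP; split => x /=; rewrite !in_itv/= eb ea.
- by move=> x /=; rewrite in_itv/= andbT => /f0.
Qed.

Lemma ge0_integral_sqr f :
  measurable_fun (`]0, +oo[%classic : set R) f -> (forall x, (0 < x)%R -> 0 <= f x)%E ->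
  (\int[leb]_(x in `]0%R, +oo[) f x =
   \int[leb]_(x in `]0%R, +oo[) (f (x ^+ 2)%R * (2 * x)%R%:E))%E.
Proof.
move=> mf f0.
apply: (@ge0_change_of_variables R _ _ leb (fun x => x ^+ 2) (fun x => 2 * x)) => //.
- by apply: measurable_funTS; exact: mulrl_measurable.
- by move=> x /=; rewrite in_itv/= andbT => x0; rewrite mulr_ge0// ltW.
- by move=> x /=; rewrite !in_itv/= !andbT => x0; rewrite exprn_gt0.
- move=> a b ab; rewrite setI_oc_oy.
  have [b0|b0] := leP b 0.
    rewrite [X in leb X]set_itv_ge ?measure0; last first.
      by rewrite bnd_simp -leNgt le_max b0 orbT.
    rewrite (_ : _ `&` _ = set0) ?integral_set0// -subset0 => x /= [].
    rewrite !in_itv/= andbT => x0 /andP[_].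
    by rewrite leNgt (le_lt_trans b0)// exprn_gt0.
  (* Only the part of []a, b]] to the right of 0 is reached by squares of positive numbers, so the
     preimage starts at [sqrt (max a 0)]. *)
  set m := Num.max a 0.
  have m0 : 0 <= m by rewrite le_max lexx orbT.
  have mb : m < b by rewrite gt_max ab.
  have s0 := sqrtr_ge0 m; have q0 := sqrtr_ge0 b.
  have s2 := sqr_sqrtr m0; have q2 := sqr_sqrtr (ltW b0).
  have sq : Num.sqrt m < Num.sqrt b by rewrite ltr_sqrt.
  rewrite (_ : _ `&` _ = `]Num.sqrt m, Num.sqrt b]%classic).
    rewrite integral_itv_obnd_cbnd; last first.
      by apply/measurable_EFinP/measurable_funTS; exact: mulrl_measurable.
    rewrite (@continuous_FTC2 _ _ (fun x => x ^+ 2))//.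
    + by rewrite s2 q2 lebesgue_measure_itv/= lte_fin mb.
    + apply: continuous_subspaceT => x; apply: cvgM; first exact: cvg_cst.
      exact: cvg_id.
    + split.
      * by move=> x _; exact: exprn_derivable.
      * by apply: cvg_at_right_filter; exact: exprn_continuous.
      * by apply: cvg_at_left_filter; exact: exprn_continuous.
    + by move=> x _; rewrite derive1E derive_val /GRing.scale/=; ring.
  apply/seteqP; split => x /=; rewrite !in_itv/= ?andbT.
    move=> [x0 /andP[ax xb]].
    have mx : m < x ^+ 2 by rewrite gt_max ax exprn_gt0.
    by apply/andP; split; rewrite ?ltNge ?leNgt; apply/negP => ?; nra.
  move=> /andP[sx xq]; have x0 : 0 < x by lra.
  split => //; apply/andP; split; last by nra.
  by apply: le_lt_trans (_ : a <= m) _; [rewrite le_max lexx|nra].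
- by move=> x /=; rewrite in_itv/= andbT => /f0.
Qed.

End substitutions.

(** * Measurability of the elementary functions *)

Section measurability.
Context {R : realType}.

(** The inverse is totalized by [0^-1 = 0] and is discontinuous there, so the point 0 is treated
    apart from its open complement, where continuity applies. *)
Lemma measurable_invr : measurable_fun setT (@GRing.inv R).
Proof.
rewrite -(setUv [set 0 : R]); apply/measurable_funU => //.
  exact: measurableC.
split; first exact: measurable_fun_set1.
apply: open_continuous_measurable_fun.
  by apply: closed_openC; exact: closed_eq.
by move=> x /set_mem /= /eqP x0; exact: inv_continuous.
Qed.

Lemma measurable_sqrtr : measurable_fun setT (@Num.sqrt R).
Proof. by apply: continuous_measurable_fun; exact: sqrt_continuous. Qed.

Lemma measurable_expRT : measurable_fun setT (@expR R).
Proof. exact: measurable_expR. Qed.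

Lemma measurable_lnT : measurable_fun setT (@ln R).
Proof. exact: measurable_ln. Qed.

Lemma measurable_cos : measurable_fun setT (@cos R).
Proof. by apply: continuous_measurable_fun; exact: continuous_cos. Qed.

Lemma measurable_sin : measurable_fun setT (@sin R).
Proof. by apply: continuous_measurable_fun; exact: continuous_sin. Qed.

(** Domains of integration are encoded as factors [(f x < g x)%R%:R], so that integrals run over the
    whole line and can be exchanged even when the domain couples the variables. *)
Lemma measurable_ltr_natr d (T : measurableType d) (D : set T) (f g : T -> R) :
  measurable_fun D f -> measurable_fun D g ->
  measurable_fun D (fun x => (f x < g x)%R%:R : R).
Proof.
move=> mf mg.
apply: (@measurableT_comp _ _ _ _ _ _ (fun b : bool => b%:R : R)) => //.
exact: measurable_fun_ltr.
Qed.

End measurability.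

(* decomposes a goal [measurable_fun D f] along the syntax of [f] *)
Ltac mfun :=
  cbv beta;
  lazymatch goal with
  | |- measurable_fun _ ?f =>
    lazymatch f with
    | (fun x => x) => exact: measurable_id
    | (fun x => @GRing.add _ (@?a x) (@?b x)) => apply: measurable_funD; mfun
    | (fun x => @GRing.mul _ (@?a x) (@?b x)) => apply: measurable_funM; mfun
    | @GRing.add _ _ => apply: measurable_funD; mfun
    | @GRing.mul _ _ => apply: measurable_funM; mfun
    | (fun x => @GRing.opp _ (@?a x)) => apply: measurable_funN; mfun
    | (fun x => @GRing.inv _ (@?a x)) => apply: (measurableT_comp measurable_invr); mfun
    | (fun x => @GRing.exp _ (@?a x) ?n) => apply: measurable_funX; mfun
    | (fun x => @GRing.natmul _ _ (nat_of_bool (@Order.lt _ _ (@?a x) (@?b x)))) =>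
        apply: measurable_ltr_natr; mfun
    | (fun x => @Num.sqrt _ (@?a x)) => apply: (measurableT_comp measurable_sqrtr); mfun
    | (fun x => @Num.norm _ _ (@?a x)) => apply: (measurableT_comp (@normr_measurable _ setT)); mfun
    | (fun x => expR (@?a x)) => apply: (measurableT_comp measurable_expRT); mfun
    | (fun x => ln (@?a x)) => apply: (measurableT_comp measurable_lnT); mfun
    | (fun x => cos (@?a x)) => apply: (measurableT_comp measurable_cos); mfun
    | (fun x => sin (@?a x)) => apply: (measurableT_comp measurable_sin); mfun
    | (fun x => fst x) => exact: measurable_fst
    | (fun x => snd x) => exact: measurable_snd
    | (fun x => fst (@?a x)) => apply: (measurableT_comp measurable_fst); mfun
    | (fun x => snd (@?a x)) => apply: (measurableT_comp measurable_snd); mfun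
    | (fun x => (@?a x, @?b x)) => apply: measurable_fun_pair; mfun
    | _ => first [assumption | exact: measurable_cst | exact: measurable_fst
                 | exact: measurable_snd | exact: measurable_id | exact: measurable_sqrtr
                 | exact: measurable_invr | exact: measurable_expRT | exact: measurable_lnT
                 | exact: measurable_cos | exact: measurable_sin | idtac]
    end
  | _ => idtac
  end.

(** * Exchange of integrals and radial integrals in the plane *)

Section tonelli.
Context {R : realType}.
Local Notation leb := (@lebesgue_measure R).
Local Open Scope ereal_scope.

Lemma tonelli_lebesgue (f : R -> R -> \bar R) :
  measurable_fun setT (fun p : R * R => f p.1 p.2) ->
  (forall x y, 0 <= f x y) ->
  \int[leb]_x \int[leb]_y f x y = \int[leb]_y \int[leb]_x f x y.
Proof.
move=> mf f0.
exact: (@fubini_tonelli _ _ _ _ _ leb leb (fun p : R * R => f p.1 p.2)).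
Qed.

Lemma measurable_integral_lebesgue d (T : measurableType d)
    (f : T -> R -> \bar R) :
  measurable_fun setT (fun p : T * R => f p.1 p.2) ->
  (forall x y, 0 <= f x y) ->
  measurable_fun setT (fun x => \int[leb]_y f x y).
Proof.
move=> mf f0.
exact: (@measurable_fun_fubini_tonelli_F _ _ _ _ _ leb (fun p : T * R => f p.1 p.2)).
Qed.

Lemma integral_gt (f : R -> \bar R) (a : R) :
  \int[leb]_(x in `]a, +oo[) f x = \int[leb]_x ((a < x)%R%:R%:E * f x).
Proof.
rewrite integral_mkcond; apply: eq_integral => x _.
rewrite patchE; have [ax|xa] := ltP a x.
  by rewrite mem_set ?mul1e//= in_itv/= ax.
rewrite memNset ?mul0e//= in_itv/= andbT; apply/negP; by rewrite -leNgt.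
Qed.

Lemma integral_oneDsqrT :
  \int[leb]_x ((1 + x ^+ 2)%R^-1)%:E = pi%:E.
Proof.
rewrite ge0_symfun_integralT.
- rewrite -set_itvcy integral0y_oneDsqr -EFinM.
  by congr EFin; field.
- by move=> x; rewrite invr_ge0 addr_ge0// sqr_ge0.
- exact: continuous_oneDsqrV.
- by move=> x /=; rewrite sqrrN.
Qed.

Lemma ge0_integral_even (f : R -> \bar R) :
  measurable_fun setT f -> (forall x, 0 <= f x) -> (forall x, f (- x)%R = f x) ->
  \int[leb]_x f x = 2%:E * \int[leb]_(x in `]0%R, +oo[) f x.
Proof.
move=> mf f0 fN.
have mpos : measurable [set x : R | 0 <= x]%R by rewrite -set_itvcy.
rewrite -(setUv [set x : R | 0 <= x]%R) ge0_integral_setU//=; last 3 first.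
- exact: measurableC.
- by rewrite setUv.
- exact/disj_setPCl.
rewrite mule_natl mule2n -set_itvcy setCitvr.
rewrite integral_itv_bndo_bndc; last exact: measurable_funTS.
rewrite integral_itv_obnd_cbnd; last exact: measurable_funTS.
congr +%E; rewrite ge0_integration_by_substitution0//.
by apply: eq_integral => x _; rewrite fN.
Qed.

(** Meant for [y = x w], a legitimate substitution in [y] for every [x] except 0: one point is a
    null set. *)
Lemma eq_integral_neq (a : R) (f g : R -> \bar R) :
  measurable_fun setT f -> measurable_fun setT g ->
  (forall x, x != a -> f x = g x) -> \int[leb]_x f x = \int[leb]_x g x.
Proof.
move=> mf mg fg; have mD : measurable (setT `\ a) by exact: measurableD.
rewrite -(integral_setD1 mD); last exact: measurable_funTS.
rewrite -[RHS](integral_setD1 mD); last exact: measurable_funTS.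
by apply: eq_integral => x /set_mem [_ /= /eqP/fg].
Qed.

(* polar coordinates without angles: [y = x w] and then [s = x^2 (1 + w^2)] *)
Lemma integral_radial (f : R -> \bar R) :
  measurable_fun setT f -> (forall x, 0 <= f x) ->
  \int[leb]_y \int[leb]_x f (x ^+ 2 + y ^+ 2)%R =
  pi%:E * \int[leb]_(s in `]0%R, +oo[) f s.
Proof.
move=> mf f0.
pose I := \int[leb]_(s in `]0%R, +oo[) f s.
pose g x w := f (x ^+ 2 * (1 + w ^+ 2))%R * `|x|%:E.
have g0 x w : 0 <= g x w by rewrite mule_ge0 ?lee_fin.
have mg : measurable_fun setT (fun p : R * R => g p.1 p.2).
  apply: emeasurable_funM.
    by apply: (measurableT_comp mf); mfun.
  by apply/measurable_EFinP; apply: measurableT_comp => //; mfun.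
have mf2 : measurable_fun setT (fun p : R * R => f (p.1 ^+ 2 + p.2 ^+ 2)%R).
  by apply: (measurableT_comp mf); mfun.
have I0 : 0 <= I by apply: integral_ge0.
transitivity (\int[leb]_w \int[leb]_x g x w).
  transitivity (\int[leb]_x \int[leb]_y f (x ^+ 2 + y ^+ 2)%R).
    by apply/esym; apply: (tonelli_lebesgue mf2) => *; exact: f0.
  transitivity (\int[leb]_x \int[leb]_w g x w); last first.
    exact: (tonelli_lebesgue mg).
  apply: (@eq_integral_neq 0%R).
  - by apply: (measurable_integral_lebesgue mf2) => *; exact: f0.
  - exact: (measurable_integral_lebesgue mg).
  move=> x x0.
  rewrite (@ge0_integral_affine _ _ x 0%R)//; last first.
    by apply: (measurableT_comp mf); mfun.
  apply: eq_integral => w _; rewrite /g; congr (f _ * _).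
  by ring.
(* Evenness in [x] gives a factor 2, which joins [|x|] to form the [2 x dx] of the squaring
   substitution. Scaling by [1 + w^2] then leaves the density [1 / (1 + w^2)], whose total mass is
   [pi]. *)
transitivity (\int[leb]_w (((1 + w ^+ 2)%R^-1)%:E * I)).
  apply: eq_integral => w _.
  have w0 : (0 < 1 + w ^+ 2)%R by rewrite ltr_pwDl// sqr_ge0.
  rewrite ge0_integral_even//; last 2 first.
  - exact: (measurableT_comp mg (pair2_measurable w)).
  - by move=> x; rewrite /g sqrrN normrN.
  transitivity (\int[leb]_(x in `]0%R, +oo[) f (x * (1 + w ^+ 2))%R).
    rewrite [RHS]ge0_integral_sqr//; last first.
      by apply: measurable_funTS; apply: (measurableT_comp mf); mfun.
    rewrite -ge0_integralZl//; last first.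
      by apply: measurable_funTS; exact: (measurableT_comp mg (pair2_measurable w)).
    apply: eq_integral => x /set_mem /=; rewrite in_itv/= andbT => x0.
    by rewrite /g gtr0_norm// muleCA EFinM.
  rewrite integral_gt /I integral_gt [in RHS](@ge0_integral_affine _ _ (1 + w ^+ 2)%R 0%R).
  - rewrite -ge0_integralZl//; last 3 first.
    + apply: emeasurable_funM; last by [].
      apply: emeasurable_funM; last by apply: (measurableT_comp mf); mfun.
      by apply/measurable_EFinP; mfun.
    + by move=> x _; rewrite !mule_ge0 ?lee_fin.
    + by rewrite lee_fin invr_ge0 ltW.
    apply: eq_integral => x _; rewrite addr0 pmulr_rgt0// [in LHS]mulrC gtr0_norm//.
    by rewrite [RHS]muleC -muleA -EFinM divff ?mule1// gt_eqF.
  - by rewrite gt_eqF.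
  - apply: emeasurable_funM => //.
    by apply/measurable_EFinP; mfun.
  - by move=> x; rewrite mule_ge0 ?lee_fin.
rewrite ge0_integralZr//; last 2 first.
- by apply/measurable_EFinP; mfun.
- by move=> x _; rewrite lee_fin invr_ge0 addr_ge0// sqr_ge0.
by rewrite integral_oneDsqrT.
Qed.

End tonelli.

(** * Sigma-finiteness of products, for the fourfold Lebesgue measure *)

Section product_sigma_finite.
Context {R : realType} {d d' : measure_display}.
Context {T : measurableType d} {T' : measurableType d'}.
Variables (m : {sigma_finite_measure set T -> \bar R}).
Variables (m' : {sigma_finite_measure set T' -> \bar R}).
Local Open Scope ereal_scope.

(** Increasing exhaustions are chosen because the two coordinates of a point enter at different
    stages [i] and [j]; monotonicity puts both in stage [maxn i j]. *)
Lemma sigma_finite_product : sigma_finite setT (m \x m').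
Proof.
have /sigma_finiteP[F [TF ndF Foo]] := sigma_finiteT m.
have /sigma_finiteP[G [TG ndG Goo]] := sigma_finiteT m'.
exists (fun n => F n `*` G n) => [|n]; last first.
  have [mFn Fnoo] := Foo n; have [mGn Gnoo] := Goo n.
  split; first exact: measurableX.
  by rewrite product_measure1E// lte_mul_pinfty// ge0_fin_numE.
apply/esym; rewrite -subTset => -[x y] _.
have [i _ Fix] : (\bigcup_k F k) x by rewrite -TF.
have [j _ Gjy] : (\bigcup_k G k) y by rewrite -TG.
exists (maxn i j) => //; split => /=.
- exact: (subsetPset _ _ (ndF _ _ (leq_maxl i j))).
- exact: (subsetPset _ _ (ndG _ _ (leq_maxr i j))).
Qed.

(* [m \x m'] is packed by hand: canonical structure inference only finds the
   instance for subprobability measures *)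
Definition sigma_finite_prod : {sigma_finite_measure set (T * T')%type -> \bar R} :=
  HB.pack (m \x m') (Measure_isSigmaFinite.Build _ _ _ (m \x m') sigma_finite_product).

End product_sigma_finite.

(** * The Siegel integral of a nonnegative integrand in the variables [eta], [u], [w] *)

Section siegel_integral.
Context {R : realType}.
Local Notation leb := (@lebesgue_measure R).
Local Open Scope ereal_scope.

(** Here [x] is Re w1, [s] is [|w2|^2], and [t = 2 x - s = rho * e^eta]: the affine step costs
    [1 / 2], the exponential costs [t], and [rho] enters as a translation by [ln rho]. *)
Lemma integral_half_expR (H : R -> \bar R) (rho s : R) : (0 < rho)%R ->
  measurable_fun setT H -> (forall t, 0 <= H t) ->
  \int[leb]_x ((0 < 2 * x - s)%R%:R%:E * H (2 * x - s)%R) =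
  \int[leb]_e (H (rho * expR e)%R * (rho * expR e / 2)%R%:E).
Proof.
move=> rho0 mH H0.
rewrite (@ge0_integral_affine _ _ (2^-1) (s / 2))//; last 2 first.
- apply: emeasurable_funM; first by apply/measurable_EFinP; mfun.
  by apply: (measurableT_comp mH); mfun.
- by move=> x; rewrite mule_ge0 ?lee_fin.
transitivity (\int[leb]_(t in `]0%R, +oo[) (H t * (2^-1)%:E)).
  rewrite integral_gt; apply: eq_integral => t _.
  have -> : (2 * (2^-1 * t + s / 2) - s = t)%R by field.
  by rewrite muleA gtr0_norm.
rewrite ge0_integral_exp; last 2 first.
- by apply: measurable_funTS; apply: emeasurable_funM.
- by move=> x _; rewrite mule_ge0 ?lee_fin.
rewrite (@ge0_integral_affine _ _ 1 (ln rho))//; last 2 first.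
- apply: emeasurable_funM; last by apply/measurable_EFinP; mfun.
  by apply: emeasurable_funM => //; apply: (measurableT_comp mH); mfun.
- by move=> x; rewrite !mule_ge0 ?lee_fin ?expR_ge0.
apply: eq_integral => e _; rewrite mul1r addrC expRD lnK// normr1 mule1.
by rewrite -muleA -EFinM [(2^-1 * _)%R]mulrC.
Qed.

Lemma integral_shift_scale (Q : R -> \bar R) (A b : R) : (0 < A)%R ->
  measurable_fun setT Q -> (forall t, 0 <= Q t) ->
  \int[leb]_y Q (y - b)%R = \int[leb]_w (Q (A * w)%R * A%:E).
Proof.
move=> A0 mQ Q0.
rewrite (@ge0_integral_affine _ _ A b) ?gt_eqF//; last first.
  by apply: (measurableT_comp mQ); mfun.
by apply: eq_integral => w _; rewrite addrK gtr0_norm.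
Qed.

Lemma integral_shift (Q : R -> \bar R) (b : R) :
  measurable_fun setT Q -> (forall t, 0 <= Q t) ->
  \int[leb]_y Q (y - b)%R = \int[leb]_w Q w.
Proof.
move=> mQ Q0; rewrite (@integral_shift_scale _ 1)//.
by apply: eq_integral => w _; rewrite mul1r mule1.
Qed.

(** With [a = A0 + s / 2], the factor [a] is the Jacobian of [y = A w]; together with [ds = 2 da] it
    becomes [d(a^2)], so the integral is linear in [u = kappa a^2 - 1]. The absolute value keeps the
    integrand nonnegative for negative [s] as well. *)
Lemma integral_quadratic_gt0 (Phi : R -> R) (A0 kappa : R) :
  measurable_fun setT Phi -> (forall x, 0 <= Phi x)%R -> (0 < A0)%R -> (0 < kappa)%R ->
  \int[leb]_(s in `]0%R, +oo[)
     (`|A0 + s / 2| * Phi (kappa * (A0 + s / 2) ^+ 2 - 1))%R%:E =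
  \int[leb]_u ((kappa * A0 ^+ 2 < u + 1)%R%:R * (Phi u / kappa))%R%:E.
Proof.
move=> mPhi Phi0 A00 kappa0.
rewrite integral_gt (@ge0_integral_affine _ _ 2 (- (2 * A0))%R)//; last 2 first.
- apply: emeasurable_funM; apply/measurable_EFinP; mfun.
  by apply: (measurableT_comp mPhi); mfun.
- by move=> x; rewrite mule_ge0 ?lee_fin ?mulr_ge0.
transitivity (\int[leb]_(a in `]0%R, +oo[)
   (((A0 ^+ 2 < a ^+ 2)%R%:R * Phi (kappa * a ^+ 2 - 1))%R%:E * (2 * a)%R%:E)).
  rewrite integral_gt; apply: eq_integral => a _.
  have -> : (A0 + (2 * a + - (2 * A0)) / 2 = a)%R by field.
  rewrite -!EFinM; congr EFin.
  have [a0|a0] := ltP 0%R a.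
    have -> : (0 < 2 * a + - (2 * A0))%R = (A0 ^+ 2 < a ^+ 2)%R.
      by apply/idP/idP => ?; nra.
    by rewrite mul1r (gtr0_norm a0) (@gtr0_norm _ 2)//; ring.
  have -> : (0 < 2 * a + - (2 * A0))%R = false by apply/negbTE; rewrite -leNgt; lra.
  by rewrite !mul0r.
rewrite -(@ge0_integral_sqr _ (fun a => ((A0 ^+ 2 < a)%R%:R * Phi (kappa * a - 1))%R%:E)); last 2 first.
- apply: measurable_funTS; apply/measurable_EFinP; mfun.
  by apply: (measurableT_comp mPhi); mfun.
- by move=> x _; rewrite lee_fin mulr_ge0.
transitivity (\int[leb]_z ((A0 ^+ 2 < z)%R%:R * Phi (kappa * z - 1))%R%:E).
  rewrite integral_gt; apply: eq_integral => z _; rewrite -EFinM; congr EFin.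
  have [z0|z0] := ltP 0%R z; first by rewrite mul1r.
  have -> : (A0 ^+ 2 < z)%R = false by apply/negbTE; rewrite -leNgt; nra.
  by rewrite !mul0r.
rewrite (@ge0_integral_affine _ _ kappa^-1 kappa^-1)//; last 3 first.
- by rewrite invr_eq0 gt_eqF.
- apply/measurable_EFinP; mfun.
  by apply: (measurableT_comp mPhi); mfun.
- by move=> x; rewrite lee_fin mulr_ge0.
apply: eq_integral => u _; rewrite -EFinM; congr EFin.
have k0 : kappa != 0%R by rewrite gt_eqF.
have -> : (kappa * (kappa^-1 * u + kappa^-1) - 1 = u)%R by field.
have -> : (A0 ^+ 2 < kappa^-1 * u + kappa^-1)%R = (kappa * A0 ^+ 2 < u + 1)%R.
  have -> : (kappa^-1 * u + kappa^-1 = (u + 1) / kappa)%R by field.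
  by rewrite ltr_pdivlMr// mulrC.
by rewrite gtr0_norm ?invr_gt0// mulrA.
Qed.

Lemma integral_plane_quadratic (Phi : R -> R) (A0 kappa a b : R) :
  measurable_fun setT Phi -> (forall x, 0 <= Phi x)%R -> (0 < A0)%R -> (0 < kappa)%R ->
  \int[leb]_y \int[leb]_x
     ((A0 + ((x - a) ^+ 2 + (y - b) ^+ 2) / 2) *
      Phi (kappa * (A0 + ((x - a) ^+ 2 + (y - b) ^+ 2) / 2) ^+ 2 - 1))%R%:E =
  pi%:E * \int[leb]_u ((kappa * A0 ^+ 2 < u + 1)%R%:R * (Phi u / kappa))%R%:E.
Proof.
move=> mPhi Phi0 A00 kappa0.
pose f s := (`|A0 + s / 2| * Phi (kappa * (A0 + s / 2) ^+ 2 - 1))%R%:E.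
have mf : measurable_fun setT f.
  apply/measurable_EFinP; mfun.
  by apply: (measurableT_comp mPhi); mfun.
have f0 s : 0 <= f s by rewrite lee_fin mulr_ge0.
rewrite -integral_quadratic_gt0// -(integral_radial mf f0).
transitivity (\int[leb]_y \int[leb]_x f ((x - a) ^+ 2 + (y - b) ^+ 2)%R).
  apply: eq_integral => y _; apply: eq_integral => x _; rewrite /f ger0_norm//.
  apply: addr_ge0; first exact: ltW.
  by apply: divr_ge0 => //; apply: addr_ge0; exact: sqr_ge0.
transitivity (\int[leb]_y \int[leb]_x f (x ^+ 2 + (y - b) ^+ 2)%R).
  apply: eq_integral => y _.
  rewrite (@integral_shift (fun x => f (x ^+ 2 + (y - b) ^+ 2)%R))//.
  by apply: (measurableT_comp mf); mfun.
rewrite (@integral_shift (fun y => \int[leb]_x f (x ^+ 2 + y ^+ 2)%R))//; last first.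
  by move=> y; exact: integral_ge0.
apply: (@measurable_integral_lebesgue _ _ R (fun y x => f (x ^+ 2 + y ^+ 2)%R)) => //.
by apply: (measurableT_comp mf); mfun.
Qed.

Section coordinates.
Variables (Phi : R -> R) (k c : R -> R -> R) (rho a b : R).
Hypothesis mPhi : measurable_fun setT Phi.
Hypothesis Phi0 : forall x, (0 <= Phi x)%R.
Hypothesis mk : measurable_fun setT (fun p : R * R => k p.1 p.2).
Hypothesis k0 : forall t w, (0 <= k t w)%R.
Hypothesis mc : measurable_fun setT (fun p : R * R => c p.1 p.2).
Hypothesis rho0 : (0 < rho)%R.

Definition sgA (t x2 y2 : R) : R := ((rho + t) / 2 + ((x2 - a) ^+ 2 + (y2 - b) ^+ 2) / 2)%R.
Definition sgT (e : R) : R := (rho * expR e)%R.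
(** [4 / t ^+ 2] is the density [4 t^-3] of dm multiplied by the modulus [t] of [rho(W)^(1+ir)]. The
    remaining phases go into [k], which sees [y] only through [w = y / A]. *)
Definition sgH (t y x2 y2 : R) : R :=
  (4 / t ^+ 2 * Phi ((sgA t x2 y2 ^+ 2 + y ^+ 2) / (rho * t) - 1) *
   k t (y / sgA t x2 y2))%R.
(** [sgH] in the coordinates [e], [w], with the Jacobians [t / 2] of [x1] and [A] of [y1]. *)
Definition sgJ (e w x2 y2 : R) : R :=
  (sgH (sgT e) (sgA (sgT e) x2 y2 * w) x2 y2 * (sgT e / 2) * sgA (sgT e) x2 y2)%R.

(** The boolean factor is the domain S_2, and [c] is the translation of [y1] that depends on [w2]
    only. *)
Definition siegel_integrand (x1 y1 x2 y2 : R) : R :=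
  ((0 < 2 * x1 - (x2 ^+ 2 + y2 ^+ 2))%R%:R *
   sgH (2 * x1 - (x2 ^+ 2 + y2 ^+ 2)) (y1 - c x2 y2) x2 y2)%R.

Lemma sgT_gt0 e : (0 < sgT e)%R. Proof. by rewrite mulr_gt0// expR_gt0. Qed.

Lemma sgA_gt0 t x2 y2 : (0 < t)%R -> (0 < sgA t x2 y2)%R.
Proof.
move=> t0; apply: ltr_wpDr; last by rewrite divr_gt0// addr_gt0.
by apply: divr_ge0 => //; apply: addr_ge0; exact: sqr_ge0.
Qed.

Lemma sgH_ge0 t y x2 y2 : (0 <= sgH t y x2 y2)%R.
Proof. by rewrite !mulr_ge0// invr_ge0 sqr_ge0. Qed.

Lemma sgJ_ge0 e w x2 y2 : (0 <= sgJ e w x2 y2)%R.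
Proof.
have T0 := sgT_gt0 e.
apply: mulr_ge0; last exact/ltW/sgA_gt0.
by apply: mulr_ge0; [exact: sgH_ge0|apply: divr_ge0 => //; exact: ltW].
Qed.

Lemma measurable_sgA d (T : measurableType d) (f1 f2 f3 : T -> R) :
  measurable_fun setT f1 -> measurable_fun setT f2 -> measurable_fun setT f3 ->
  measurable_fun setT (fun p => sgA (f1 p) (f2 p) (f3 p)).
Proof. by move=> m1 m2 m3; rewrite /sgA; mfun. Qed.

Lemma measurable_sgH d (T : measurableType d) (f1 f2 f3 f4 : T -> R) :
  measurable_fun setT f1 -> measurable_fun setT f2 -> measurable_fun setT f3 ->
  measurable_fun setT f4 ->
  measurable_fun setT (fun p => sgH (f1 p) (f2 p) (f3 p) (f4 p)).
Proof.
move=> m1 m2 m3 m4; have mA' := measurable_sgA m1 m3 m4; rewrite /sgH.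
apply: measurable_funM.
  apply: measurable_funM; first by mfun.
  by apply: (measurableT_comp mPhi); mfun.
apply: (measurableT_comp mk (g := fun p => (f1 p, f2 p / sgA (f1 p) (f3 p) (f4 p))%R)).
by mfun.
Qed.

Lemma measurable_sgT d (T : measurableType d) (f1 : T -> R) :
  measurable_fun setT f1 -> measurable_fun setT (fun p => sgT (f1 p)).
Proof. by move=> m1; rewrite /sgT; mfun. Qed.

Lemma measurable_sgJ d (T : measurableType d) (f1 f2 f3 f4 : T -> R) :
  measurable_fun setT f1 -> measurable_fun setT f2 -> measurable_fun setT f3 ->
  measurable_fun setT f4 ->
  measurable_fun setT (fun p => sgJ (f1 p) (f2 p) (f3 p) (f4 p)).
Proof.
move=> m1 m2 m3 m4; have mT1 := measurable_sgT m1; have mA1 := measurable_sgA mT1 m3 m4.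
rewrite /sgJ; apply: measurable_funM => //; apply: measurable_funM; last by mfun.
by apply: measurable_sgH => //; mfun.
Qed.

Lemma measurable_twist d (T : measurableType d) (f1 f2 : T -> R) :
  measurable_fun setT f1 -> measurable_fun setT f2 ->
  measurable_fun setT (fun p => c (f1 p) (f2 p)).
Proof.
by move=> m1 m2; apply: (measurableT_comp mc (g := fun p => (f1 p, f2 p))); mfun.
Qed.

Lemma siegel_integrand_ge0 x1 y1 x2 y2 : (0 <= siegel_integrand x1 y1 x2 y2)%R.
Proof. by apply: mulr_ge0; [exact: ler0n|exact: sgH_ge0]. Qed.

Lemma measurable_siegel_integrand :
  measurable_fun setT (fun p : R * R * R * R =>
    siegel_integrand p.1.1.1 p.1.1.2 p.1.2 p.2).
Proof.
have m1 : measurable_fun setT (fun p : R * R * R * R => p.1.1.1) by mfun.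
have m2 : measurable_fun setT (fun p : R * R * R * R => p.1.1.2) by mfun.
have m3 : measurable_fun setT (fun p : R * R * R * R => p.1.2) by mfun.
have m4 : measurable_fun setT (fun p : R * R * R * R => p.2) by mfun.
have mc4 := measurable_twist m3 m4.
by rewrite /siegel_integrand; apply: measurable_funM; [|apply: measurable_sgH]; mfun.
Qed.

Lemma measurable_siegel_slice (x2 y2 : R) :
  measurable_fun setT (fun p : R * R => (siegel_integrand p.1 p.2 x2 y2)%:E).
Proof.
by apply/measurable_EFinP; apply: measurable_funM; [|apply: measurable_sgH]; mfun.
Qed.

(** The scale [A] in [y1 = c + A w] depends on [t]. Hence [x1] is replaced by [e] first, the two
    integrals are exchanged, and [y1] is rescaled with [e] fixed. *)
Lemma siegel_inner_integral (x2 y2 : R) :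
  \int[leb]_y1 \int[leb]_x1 (siegel_integrand x1 y1 x2 y2)%:E =
  \int[leb]_e \int[leb]_w (sgJ e w x2 y2)%:E.
Proof.
pose G e y := (sgH (sgT e) y x2 y2 * (sgT e / 2))%R%:E.
have G0 e y : 0 <= G e y.
  rewrite lee_fin; apply: mulr_ge0; first exact: sgH_ge0.
  by apply: divr_ge0 => //; exact/ltW/sgT_gt0.
transitivity (\int[leb]_y1 \int[leb]_e G e (y1 - c x2 y2)%R).
  apply: eq_integral => y1 _.
  pose H1 t := (sgH t (y1 - c x2 y2) x2 y2)%:E.
  rewrite -(@integral_half_expR H1 rho (x2 ^+ 2 + y2 ^+ 2))//.
  - by apply/measurable_EFinP; apply: measurable_sgH; mfun.
  - by move=> t; rewrite lee_fin; exact: sgH_ge0.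
transitivity (\int[leb]_e \int[leb]_y1 G e (y1 - c x2 y2)%R).
  apply: (@tonelli_lebesgue _ (fun y1 e => G e (y1 - c x2 y2)%R)) => //.
  have mT2 : measurable_fun setT (fun p : R * R => sgT p.2) by apply: measurable_sgT; mfun.
  apply/measurable_EFinP; apply: measurable_funM; last by mfun.
  by apply: measurable_sgH; mfun.
apply: eq_integral => e _.
rewrite (@integral_shift_scale (G e) (sgA (sgT e) x2 y2))//; first exact/sgA_gt0/sgT_gt0.
apply/measurable_EFinP; apply: measurable_funM; last by mfun.
by apply: measurable_sgH; mfun.
Qed.

(** Moves the plane of [w2] innermost: for fixed [e] and [w] the integrand depends on [w2] only
    through its distance to [z2]. *)
Lemma siegel_swap_integrals :
  \int[leb]_y2 \int[leb]_x2 \int[leb]_e \int[leb]_w (sgJ e w x2 y2)%:E =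
  \int[leb]_e \int[leb]_w \int[leb]_y2 \int[leb]_x2 (sgJ e w x2 y2)%:E.
Proof.
have S1 y2 : \int[leb]_x2 \int[leb]_e \int[leb]_w (sgJ e w x2 y2)%:E =
    \int[leb]_e \int[leb]_w \int[leb]_x2 (sgJ e w x2 y2)%:E.
  transitivity (\int[leb]_e \int[leb]_x2 \int[leb]_w (sgJ e w x2 y2)%:E).
    apply: (@tonelli_lebesgue _ (fun x2 e => \int[leb]_w (sgJ e w x2 y2)%:E)).
      apply: (@measurable_integral_lebesgue _ _ _ (fun (p : R * R) w => (sgJ p.2 w p.1 y2)%:E)).
        by apply/measurable_EFinP; apply: measurable_sgJ; mfun.
      by move=> *; rewrite lee_fin; exact: sgJ_ge0.
    by move=> *; apply: integral_ge0 => *; rewrite lee_fin; exact: sgJ_ge0.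
  apply: eq_integral => e _.
  apply: (@tonelli_lebesgue _ (fun x2 w => (sgJ e w x2 y2)%:E)).
    by apply/measurable_EFinP; apply: measurable_sgJ; mfun.
  by move=> *; rewrite lee_fin; exact: sgJ_ge0.
transitivity (\int[leb]_y2 \int[leb]_e \int[leb]_w \int[leb]_x2 (sgJ e w x2 y2)%:E).
  by apply: eq_integral => y2 _; exact: S1.
transitivity (\int[leb]_e \int[leb]_y2 \int[leb]_w \int[leb]_x2 (sgJ e w x2 y2)%:E).
  apply: (@tonelli_lebesgue _ (fun y2 e => \int[leb]_w \int[leb]_x2 (sgJ e w x2 y2)%:E)).
    apply: (@measurable_integral_lebesgue _ _ _
      (fun (p : R * R) w => \int[leb]_x2 (sgJ p.2 w x2 p.1)%:E)).
      apply: (@measurable_integral_lebesgue _ _ _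
        (fun (p : R * R * R) x2 => (sgJ p.1.2 p.2 x2 p.1.1)%:E)).
        by apply/measurable_EFinP; apply: measurable_sgJ; mfun.
      by move=> *; rewrite lee_fin; exact: sgJ_ge0.
    by move=> *; apply: integral_ge0 => *; rewrite lee_fin; exact: sgJ_ge0.
  by move=> *; apply: integral_ge0 => *; apply: integral_ge0 => *; rewrite lee_fin; exact: sgJ_ge0.
apply: eq_integral => e _.
apply: (@tonelli_lebesgue _ (fun y2 w => \int[leb]_x2 (sgJ e w x2 y2)%:E)).
  apply: (@measurable_integral_lebesgue _ _ _
      (fun (p : R * R) x2 => (sgJ e p.2 x2 p.1)%:E)).
    by apply/measurable_EFinP; apply: measurable_sgJ; mfun.
  by move=> *; rewrite lee_fin; exact: sgJ_ge0.
by move=> *; apply: integral_ge0 => *; rewrite lee_fin; exact: sgJ_ge0.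
Qed.

(** The inequality is [kappa * A0^2 < u + 1] with [A0 = (rho + t) / 2], the least value of [A], and
    [kappa = (1 + w^2) / (rho t)]; indeed [(rho + t)^2 / (4 rho t) = v + 1]. *)
Definition siegel_kernel (e u w : R) : R :=
  (((1 + w ^+ 2) * (v_of_eta e + 1) < u + 1)%R%:R *
   (2 * pi * rho * Phi u * (k (rho * expR e) w / (1 + w ^+ 2))))%R.

Lemma siegel_kernel_ge0 e u w : (0 <= siegel_kernel e u w)%R.
Proof.
apply: mulr_ge0; first exact: ler0n.
apply: mulr_ge0; last first.
  by apply: divr_ge0; [exact: k0|apply: addr_ge0; [exact: ler01|exact: sqr_ge0]].
apply: mulr_ge0; last exact: Phi0.
by apply: mulr_ge0; [apply: mulr_ge0; [exact: ler0n|exact: pi_ge0]|exact: ltW].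
Qed.

Lemma measurable_siegel_kernel :
  measurable_fun setT (fun p : R * R * R => siegel_kernel p.1.1 p.1.2 p.2).
Proof.
rewrite /siegel_kernel /v_of_eta; apply: measurable_funM; first by mfun.
apply: measurable_funM; first by mfun; apply: (measurableT_comp mPhi); mfun.
apply: measurable_funM; last by mfun.
by apply: (measurableT_comp mk (g := fun p : R * R * R => (rho * expR p.1.1, p.2)%R)); mfun.
Qed.

Lemma siegel_plane_integral e w :
  \int[leb]_y2 \int[leb]_x2 (sgJ e w x2 y2)%:E = \int[leb]_u (siegel_kernel e u w)%:E.
Proof.
pose C := (4 / sgT e ^+ 2 * k (sgT e) w * (sgT e / 2))%R.
pose kappa := ((1 + w ^+ 2) / (rho * sgT e))%R.
have w0 : (0 < 1 + w ^+ 2)%R by rewrite ltr_pwDl// sqr_ge0.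
have T0 := sgT_gt0 e.
have kappa0 : (0 < kappa)%R by rewrite divr_gt0// mulr_gt0.
have C0 : (0 <= C)%R.
  apply: mulr_ge0; last by apply: divr_ge0; [exact: ltW|exact: ler0n].
  by apply: mulr_ge0; [apply: divr_ge0; [exact: ler0n|exact: sqr_ge0]|exact: k0].
have AT0 : (0 < (rho + sgT e) / 2)%R by rewrite divr_gt0// addr_gt0.
pose B x y := (sgA (sgT e) x y * Phi (kappa * sgA (sgT e) x y ^+ 2 - 1))%R.
have B0 x y : (0 <= B x y)%R by apply: mulr_ge0; [exact/ltW/sgA_gt0|].
have JE x2 y2 : (sgJ e w x2 y2)%:E = C%:E * (B x2 y2)%:E.
  rewrite -EFinM; congr EFin; rewrite /sgJ /sgH /B /C.
  have Ane : sgA (sgT e) x2 y2 != 0%R by rewrite gt_eqF// sgA_gt0.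
  have -> : (sgA (sgT e) x2 y2 * w / sgA (sgT e) x2 y2 = w)%R by field.
  have -> : ((sgA (sgT e) x2 y2 ^+ 2 + (sgA (sgT e) x2 y2 * w) ^+ 2) / (rho * sgT e) - 1 =
     kappa * sgA (sgT e) x2 y2 ^+ 2 - 1)%R by rewrite /kappa; field; rewrite !gt_eqF// mulr_gt0.
  by ring.
have mB d (T : measurableType d) (f1 f2 : T -> R) : measurable_fun setT f1 ->
    measurable_fun setT f2 -> measurable_fun setT (fun p => B (f1 p) (f2 p)).
  move=> m1 m2; have mA1 := measurable_sgA (measurable_cst (sgT e)) m1 m2; rewrite /B.
  by apply: measurable_funM => //; apply: (measurableT_comp mPhi); mfun.
transitivity (C%:E * \int[leb]_y2 \int[leb]_x2 (B x2 y2)%:E).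
  rewrite -ge0_integralZl//; last 2 first.
  - apply: (@measurable_integral_lebesgue _ _ R (fun y x => (B x y)%:E)).
      by apply/measurable_EFinP; apply: mB; mfun.
    by move=> *; rewrite lee_fin; exact: B0.
  - by move=> *; apply: integral_ge0 => *; rewrite lee_fin; exact: B0.
  apply: eq_integral => y2 _.
  rewrite -ge0_integralZl//; last 2 first.
  - by apply/measurable_EFinP; apply: mB; mfun.
  - by move=> *; rewrite lee_fin; exact: B0.
  by apply: eq_integral => x2 _; rewrite JE.
rewrite integral_plane_quadratic// muleA -EFinM -ge0_integralZl//; last 3 first.
- by apply/measurable_EFinP; mfun.
- move=> u _; rewrite lee_fin; apply: mulr_ge0; first exact: ler0n.
  by apply: divr_ge0; [exact: Phi0|exact: ltW].
- by rewrite lee_fin; apply: mulr_ge0 => //; exact: pi_ge0.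
apply: eq_integral => u _; rewrite -EFinM; congr EFin; rewrite /siegel_kernel /v_of_eta.
have e0 : expR e != 0%R by rewrite gt_eqF// expR_gt0.
have -> : (kappa * ((rho + sgT e) / 2) ^+ 2 =
   (1 + w ^+ 2) * ((expR e + expR (- e) - 2) / 4 + 1))%R.
  by rewrite /kappa /sgT expRN; field; rewrite e0 gt_eqF.
rewrite mulrCA; congr (_ * _)%R; rewrite /C /kappa -/(sgT e).
by field; rewrite !gt_eqF.
Qed.

Lemma siegel_integral_ge0 :
  \int[(leb \x leb) \x leb \x leb]_p
     (siegel_integrand p.1.1.1 p.1.1.2 p.1.2 p.2)%:E =
  \int[leb]_e \int[leb]_u \int[leb]_w (siegel_kernel e u w)%:E.
Proof.
transitivity (\int[leb]_y2 \int[leb]_x2 \int[leb]_y1 \int[leb]_x1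
    (siegel_integrand x1 y1 x2 y2)%:E).
  have m4 : measurable_fun setT (fun p : R * R * R * R =>
      (siegel_integrand p.1.1.1 p.1.1.2 p.1.2 p.2)%:E).
    by apply/measurable_EFinP; exact: measurable_siegel_integrand.
  have m3 y2 : measurable_fun setT (fun p : R * R * R =>
      (siegel_integrand p.1.1 p.1.2 p.2 y2)%:E).
    by apply: (measurableT_comp m4 (g := fun p : R * R * R => (p, y2))); mfun.
  have si0 x1 y1 x2 y2 : 0 <= (siegel_integrand x1 y1 x2 y2)%:E.
    by rewrite lee_fin; exact: siegel_integrand_ge0.
  (* The product is nested to the left, so each use of Tonelli peels off the last coordinate;
     [sigma_finite_prod] provides the structure required of the first factor. *)
  have E1 := fubini_tonelli2
    (m1 := sigma_finite_prod (sigma_finite_prod leb leb) leb) (m2 := leb) _ m4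
    (fun p => si0 _ _ _ _).
  have E2 y2 := fubini_tonelli2
    (m1 := sigma_finite_prod leb leb) (m2 := leb) _ (m3 y2)
    (fun p => si0 _ _ _ _).
  have E3 x2 y2 := fubini_tonelli2 (m1 := leb) (m2 := leb) _
    (measurable_siegel_slice x2 y2) (fun p => si0 _ _ _ _).
  apply: (etrans E1); apply: eq_integral => y2 _.
  apply: (etrans (E2 y2)); apply: eq_integral => x2 _.
  exact: E3.
transitivity (\int[leb]_y2 \int[leb]_x2 \int[leb]_e \int[leb]_w (sgJ e w x2 y2)%:E).
  by apply: eq_integral => y2 _; apply: eq_integral => x2 _; exact: siegel_inner_integral.
apply: (etrans siegel_swap_integrals); apply: eq_integral => e _.
(* The plane integral leaves [u] innermost; one more exchange makes the angular variable [w]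
   innermost, where it can be integrated in closed form. *)
transitivity (\int[leb]_w \int[leb]_u (siegel_kernel e u w)%:E).
  by apply: eq_integral => w _; exact: siegel_plane_integral.
apply: (@tonelli_lebesgue _ (fun w u => (siegel_kernel e u w)%:E)); last first.
  by move=> *; rewrite lee_fin siegel_kernel_ge0.
apply/measurable_EFinP.
by apply: (measurableT_comp measurable_siegel_kernel (g := fun p : R * R => (e, p.2, p.1))); mfun.
Qed.

End coordinates.

End siegel_integral.

(** * Composition of the two Abel kernels, nonnegative case *)

Section abel_ge0.
Context {R : realType}.
Local Notation leb := (@lebesgue_measure R).
Local Open Scope ereal_scope.

Lemma cvgy_divr_oneDsqr : (x / (1 + x ^+ 2) @[x --> +oo] --> (0 : R))%R.
Proof.
apply: (@squeeze_cvgr _ _ _ _ (cst 0%R) (fun x : R => x^-1)%R).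
- near=> x; have x0 : (0 < x)%R by near: x; exact: nbhs_pinfty_gt.
  apply/andP; split; first by rewrite divr_ge0 ?addr_ge0 ?sqr_ge0// ltW.
  by rewrite ler_pdivrMr ?ltr_pwDl ?sqr_ge0// ler_pdivlMl//; nra.
- exact: cvg_cst.
- by apply/gtr0_cvgV0; [near=> x; near: x; exact: nbhs_pinfty_gt|exact: cvg_id].
Unshelve. all: by end_near. Qed.

(** This is the Beta integral behind the constant [pi / 2] of Abel inversion; an antiderivative is
    [w / (1 + w^2) + atan w]. *)
Lemma integral0y_oneDsqr2 :
  \int[leb]_w ((0 < w)%R%:R * (2 / (1 + w ^+ 2) ^+ 2))%R%:E = (pi / 2)%:E.
Proof.
have D0 (x : R) : (0 < 1 + x ^+ 2)%R by rewrite ltr_pwDl// sqr_ge0.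
have D0' (x : R) : (1 + x ^+ 2 != 0)%R by rewrite gt_eqF.
pose f (x : R) := (2 / (1 + x ^+ 2) ^+ 2)%R.
have cf : continuous f.
  move=> x; apply: cvgM; first exact: cvg_cst.
  apply: cvgV; first by rewrite expf_neq0.
  apply: (@continuous_comp _ _ _ (fun x : R => 1 + x ^+ 2)%R (fun y => y ^+ 2)%R).
    by apply: cvgD; [exact: cvg_cst|exact: exprn_continuous].
  exact: exprn_continuous.
transitivity (\int[leb]_(w in `]0%R, +oo[) (f w)%:E).
  by rewrite integral_gt; apply: eq_integral => w _; rewrite -EFinM.
rewrite integral_itv_obnd_cbnd; last first.
  by apply/measurable_EFinP/measurable_funTS; exact: continuous_measurable_fun.
pose F (x : R) := (x / (1 + x ^+ 2) + atan x)%R.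
have dF (x : R) : is_derive x 1%R F (f x).
  apply: is_derive_eq; rewrite /GRing.scale/= /f.
  by field.
have cF : continuous F.
  by move=> x; apply/differentiable_continuous/derivable1_diffP.
rewrite (@ge0_continuous_FTC2y _ f F 0%R (pi / 2)%R).
- by rewrite /F mul0r atan0 addr0 sube0.
- by move=> x _; rewrite divr_ge0// sqr_ge0.
- by apply: continuous_subspaceT.
- by rewrite -[X in _ --> X]add0r; apply: cvgD; [exact: cvgy_divr_oneDsqr|exact: cvgy_atan].
- by move=> x _; exact: ex_derive.
- by apply: cvg_at_right_filter; exact: cF.
- by move=> x _; rewrite derive1E derive_val.
Qed.

(** With [y = v - u] the double integrand is [g (u + y + x) * sqrt x / sqrt y]. Putting [y = x w^2]
    (a squaring, which cancels [1 / sqrt y], then a scaling by [sqrt x]) gives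
    [2 x g (u + x (1 + w^2))]. After [z = x (1 + w^2)] the variables separate, with weight
    [2 / (1 + w^2)^2] in [w]. *)
Lemma abel_ge0 (g : R -> R) (u : R) :
  measurable_fun setT g -> (forall x, 0 <= g x)%R ->
  \int[leb]_(v in `]u, +oo[)
    (((Num.sqrt (v - u))^-1)%:E *
     \int[leb]_(x in `]0%R, +oo[) (g (v + x) * Num.sqrt x)%R%:E) =
  (pi / 2)%:E * \int[leb]_(z in `]0%R, +oo[) (z * g (u + z))%R%:E.
Proof.
move=> mg g0.
have mgc d (T : measurableType d) (f : T -> R) : measurable_fun setT f ->
    measurable_fun setT (fun p => g (f p)).
  by move=> mf; exact: (measurableT_comp mg).
pose K (y x : R) : R := ((0 < y)%R%:R * (0 < x)%R%:R * (g (u + y + x) * Num.sqrt x / Num.sqrt y))%R.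
have K0 y x : (0 <= K y x)%R.
  apply: mulr_ge0; first by apply: mulr_ge0; exact: ler0n.
  by apply: divr_ge0; [apply: mulr_ge0 => //; exact: sqrtr_ge0|exact: sqrtr_ge0].
have mK : measurable_fun setT (fun p : R * R => (K p.1 p.2)%:E).
  apply/measurable_EFinP; rewrite /K; mfun; apply: mgc; mfun.
transitivity (\int[leb]_y \int[leb]_x (K y x)%:E).
  rewrite integral_gt -(@integral_shift _ (fun y => \int[leb]_x (K y x)%:E) u); last 2 first.
  - by apply: (measurable_integral_lebesgue (f := fun y x => (K y x)%:E)) => // *; rewrite lee_fin.
  - by move=> y; apply: integral_ge0 => x _; rewrite lee_fin.
  apply: eq_integral => v _.
  rewrite integral_gt muleA -EFinM -ge0_integralZl//; last 2 first.
  - by apply: emeasurable_funM; apply/measurable_EFinP; mfun; apply: mgc; mfun.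
  - move=> x _; rewrite -EFinM lee_fin; apply: mulr_ge0; first exact: ler0n.
    by apply: mulr_ge0 => //; exact: sqrtr_ge0.
  apply: eq_integral => x _; rewrite -!EFinM; congr EFin.
  rewrite /K subr_gt0 (addrC u) subrK; ring.
transitivity (\int[leb]_x \int[leb]_y (K y x)%:E).
  by apply: (@tonelli_lebesgue _ (fun y x => (K y x)%:E)) => // *; rewrite lee_fin.
pose L (x w : R) : R := ((0 < x)%R%:R * (0 < w)%R%:R * (2 * x * g (u + x * (1 + w ^+ 2))))%R.
have L0 x w : (0 <= L x w)%R.
  rewrite /L; have [x0|x0] := ltP 0%R x; last by rewrite !mul0r.
  apply: mulr_ge0; first by apply: mulr_ge0; exact: ler0n.
  by apply: mulr_ge0 => //; rewrite mulr_ge0// ltW.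
have mL : measurable_fun setT (fun p : R * R => (L p.1 p.2)%:E).
  by apply/measurable_EFinP; rewrite /L; mfun; apply: mgc; mfun.
transitivity (\int[leb]_x \int[leb]_w (L x w)%:E).
  apply: eq_integral => x _.
  have [x0|x0] := ltP 0%R x; last first.
    have nx0 : (0 < x)%R = false by apply/negbTE; rewrite -leNgt.
    rewrite integral0_eq; last by move=> y _; rewrite /K nx0 mulr0 mul0r.
    by rewrite integral0_eq// => y _; rewrite /L nx0 !mul0r.
  have s0 : (0 < Num.sqrt x)%R by rewrite sqrtr_gt0.
  transitivity (\int[leb]_(y in `]0%R, +oo[) (g (u + y + x) * Num.sqrt x / Num.sqrt y)%R%:E).
    by rewrite integral_gt; apply: eq_integral => y _; rewrite /K x0 mulr1 -EFinM.
  rewrite ge0_integral_sqr; last 2 first.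
  - by apply: measurable_funTS; apply/measurable_EFinP; mfun; apply: mgc; mfun.
  - move=> y y0; rewrite lee_fin; apply: divr_ge0; last exact: sqrtr_ge0.
    by apply: mulr_ge0 => //; exact: sqrtr_ge0.
  transitivity (\int[leb]_y ((0 < y)%R%:R * (g (u + y ^+ 2 + x) * Num.sqrt x * 2))%R%:E).
    rewrite integral_gt; apply: eq_integral => y _; rewrite -!EFinM; congr EFin.
    have [y0|y0] := ltP 0%R y; last by rewrite !mul0r.
    rewrite sqrtr_sqr gtr0_norm//; field.
    by rewrite gt_eqF.
  rewrite (@ge0_integral_affine _ _ (Num.sqrt x) 0%R); last 3 first.
  - by rewrite gt_eqF.
  - by apply/measurable_EFinP; mfun; apply: mgc; mfun.
  - move=> y; rewrite lee_fin; apply: mulr_ge0; first exact: ler0n.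
    by apply: mulr_ge0 => //; apply: mulr_ge0 => //; exact: sqrtr_ge0.
  apply: eq_integral => w _; rewrite -EFinM; congr EFin.
  rewrite /L addr0 pmulr_rgt0// x0 mul1r gtr0_norm//.
  have xE : (Num.sqrt x ^+ 2 = x)%R by rewrite sqr_sqrtr// ltW.
  have -> : (u + (Num.sqrt x * w) ^+ 2 + x = u + x * (1 + w ^+ 2))%R.
    by rewrite exprMn xE; ring.
  have -> : (2 * x = 2 * Num.sqrt x ^+ 2)%R by rewrite xE.
  by ring.
transitivity (\int[leb]_w \int[leb]_x (L x w)%:E).
  by apply: (@tonelli_lebesgue _ (fun x w => (L x w)%:E)) => // *; rewrite lee_fin.
pose I := \int[leb]_(z in `]0%R, +oo[) (z * g (u + z))%R%:E.
transitivity (\int[leb]_w (((0 < w)%R%:R * (2 / (1 + w ^+ 2) ^+ 2))%R%:E * I)).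
  apply: eq_integral => w _.
  have w0 : (0 < 1 + w ^+ 2)%R by rewrite ltr_pwDl// sqr_ge0.
  rewrite /I integral_gt [in RHS](@ge0_integral_affine _ _ (1 + w ^+ 2) 0%R); last 3 first.
  - by rewrite gt_eqF.
  - by apply: emeasurable_funM; apply/measurable_EFinP; mfun; apply: mgc; mfun.
  - move=> z; rewrite -EFinM lee_fin; have [z0|z0] := ltP 0%R z; last by rewrite mul0r.
    by rewrite mul1r mulr_ge0// ltW.
  rewrite -ge0_integralZl//; last 3 first.
  - by do 2?apply: emeasurable_funM => //; apply/measurable_EFinP; mfun; apply: mgc; mfun.
  - move=> z _; rewrite -!EFinM lee_fin addr0 pmulr_rgt0//.
    have [z0|z0] := ltP 0%R z; last by rewrite !mul0r.
    by rewrite mul1r mulr_ge0// mulr_ge0// mulr_ge0// ltW.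
  - rewrite lee_fin; apply: mulr_ge0; first exact: ler0n.
    by rewrite divr_ge0// sqr_ge0.
  apply: eq_integral => x _; rewrite -!EFinM; congr EFin.
  rewrite /L addr0 pmulr_rgt0// (gtr0_norm w0).
  rewrite [((1 + w ^+ 2) * x)%R]mulrC.
  by field; rewrite gt_eqF.
rewrite ge0_integralZr//; last 3 first.
- by apply/measurable_EFinP; mfun.
- by move=> w _; rewrite lee_fin; apply: mulr_ge0; [exact: ler0n|rewrite divr_ge0// sqr_ge0].
- apply: integral_ge0 => z /=; rewrite in_itv/= andbT => z0.
  by rewrite lee_fin mulr_ge0// ltW.
by rewrite integral0y_oneDsqr2.
Qed.

End abel_ge0.

(** * Integrability and bounds for functions of bounded support *)

Section bounded_support.
Context {R : realType}.
Local Notation leb := (@lebesgue_measure R).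
Implicit Types (f h : R -> R) (D : set R).

Lemma integrable_bounded_support D f (C N : R) : measurable D ->
  measurable_fun D f -> (forall x, D x -> `|f x| <= C) ->
  (forall x, D x -> N < `|x| -> f x = 0) -> leb.-integrable D (EFin \o f).
Proof.
move=> mD mf fC fN.
have i1 : leb.-integrable D (fun x => C%:E * (\1_(`[- N, N]%classic) x)%:E)%E.
  apply: integrableZl => //; apply: (integrableS measurableT) => //.
  exact: integrable_indic_itv.
apply: le_integrable i1 => //; first exact/measurable_EFinP.
move=> x Dx; rewrite -EFinM /= lee_fin.
have [Nx|xN] := ltP N `|x|; first by rewrite fN// normr0.
rewrite indicE mem_set ?mulr1; last by rewrite /= in_itv/= -ler_norml.
by rewrite (le_trans (fC _ Dx))// ler_norm.
Qed.

(** The extreme value theorem is applied on [[u, M]] with [u] strictly above [a], because the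
    functions to come contain powers of [x + 1] and may blow up at [a = -1]. *)
Lemma bounded_continuous_support f (a u M : R) :
  (forall x, a < x -> {for x, continuous f}) ->
  (forall x, M <= x -> f x = 0) -> a < u ->
  exists2 C : R, 0 <= C & forall x, u <= x -> `|f x| <= C.
Proof.
move=> cf fM au; have [uM|Mu] := leP u M; last first.
  by exists 0 => // x ux; rewrite fM ?normr0// ltW// (lt_le_trans Mu).
have cnf : {within `[u, M], continuous (fun x => `|f x|)}.
  apply: continuous_in_subspaceT => x /set_mem /=; rewrite in_itv/= => /andP[ux _].
  apply: continuous_comp; last exact: norm_continuous.
  by apply: cf; exact: lt_le_trans ux.
have [c _ cmax] := EVT_max uM cnf.
exists `|f c| => // x ux; have [xM|Mx] := leP x M.
  by apply: cmax; rewrite in_itv/= ux.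
by rewrite fM ?normr0// ltW.
Qed.

End bounded_support.

(** * The Abel transform: regularity and inversion *)

Section abel_transform.
Context {R : realType}.
Local Notation leb := (@lebesgue_measure R).
Implicit Types (f h : R -> R).

(** Up to a constant, the Weyl fractional integral of order 3/2. The form with [h (v + x)] lets
    derivatives in [v] fall on [h] and not on the square root. *)
Definition abelT h (v : R) : R :=
  \int[leb]_(x in `]0, +oo[) (h (v + x) * Num.sqrt x).

Section on_halfline.
Variables (a M : R).

Definition cont_on_halfline h := (forall x, a < x -> {for x, continuous h}) /\
  (forall x, M <= x -> h x = 0).

Let mshift h v : cont_on_halfline h -> a < v ->
  measurable_fun (`]0, +oo[%classic : set R) (fun x => h (v + x) * Num.sqrt x).
Proof.
move=> [ch _] av; apply: measurable_funM; last first.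
  by apply: measurable_funTS; exact: measurable_sqrtr.
apply: open_continuous_measurable_fun; first exact: interval_open.
move=> x /set_mem /=; rewrite in_itv/= andbT => x0.
apply: (@continuous_comp _ _ _ (fun x => v + x) h).
  by apply: cvgD; [exact: cvg_cst|exact: cvg_id].
by apply: ch; rewrite ltr_wpDr// ltW.
Qed.

(** One majorant serves all [x > u]: [h] is bounded on that ray, and [h (x + y)] vanishes once [y]
    exceeds [|M - u|]. It feeds integrability, continuity and differentiation under the integral. *)
Lemma abel_dominated h u : cont_on_halfline h -> a < u ->
  exists2 G : R -> R, (forall y, 0 <= G y) /\
    leb.-integrable (`]0, +oo[%classic : set R) (EFin \o G) &
    forall x y, u < x -> 0 < y -> `|h (x + y) * Num.sqrt y| <= G y.
Proof.
move=> [ch hM] au; have [C C0 hC] := bounded_continuous_support ch hM au.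
pose N : R := `|M - u|.
have N0 : 0 <= N by exact: normr_ge0.
have K0 : 0 <= C * Num.sqrt N by rewrite mulr_ge0// sqrtr_ge0.
exists (fun y => C * Num.sqrt N * \1_(`[- N, N]%classic) y).
  split; first by move=> y; rewrite mulr_ge0.
  apply: (@integrable_bounded_support _ _ _ (C * Num.sqrt N) N) => //.
  - by apply: measurable_funTS; apply: measurable_funM.
  - move=> y _; rewrite indicE.
    by case: (y \in _); rewrite ?mulr1 ?mulr0 ?normr0// ger0_norm.
  - move=> y _ Ny; rewrite indicE memNset ?mulr0//= in_itv/= -ler_norml.
    by apply/negP; rewrite -ltNge.
move=> x y ux y0; have [yN|Ny] := leP y N.
  rewrite indicE mem_set ?mulr1; last first.
    by rewrite /= in_itv/= yN andbT (le_trans _ (ltW y0))// oppr_le0.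
  rewrite normrM ler_pM// ?hC//; first by rewrite ltW// ltr_wpDr// ltW.
  by rewrite ger0_norm ?sqrtr_ge0// ler_sqrt.
rewrite hM ?mul0r ?normr0 ?mulr_ge0 ?sqrtr_ge0//.
have := ler_norm (M - u); rewrite -/N; lra.
Qed.

Lemma abel_integrable h v : cont_on_halfline h -> a < v ->
  leb.-integrable (`]0, +oo[%classic : set R)
    (EFin \o (fun x => h (v + x) * Num.sqrt x)).
Proof.
move=> ch av.
have [G [G0 iG] hG] := abel_dominated ch (midf_lt av).1.
apply: le_integrable iG => //.
  by apply/measurable_EFinP; exact: mshift.
move=> x /=; rewrite in_itv/= andbT => x0; rewrite lee_fin (ger0_norm (G0 x)).
exact: hG (midf_lt av).2 x0.
Qed.

Lemma is_derive_abel h h1 v : cont_on_halfline h1 ->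
  (forall x, a < x -> is_derive x 1 h (h1 x)) -> (forall x, M <= x -> h x = 0) ->
  a < v -> is_derive v 1 (abelT h) (abelT h1 v).
Proof.
move=> ch1 dh hM av.
have ch : cont_on_halfline h.
  split=> // x ax; apply/differentiable_continuous/derivable1_diffP.
  by have := dh x ax; case.
(* The midpoint leaves a neighbourhood []u, v + 1[] of [v] that stays away from the possible
   singularity at [a]. *)
pose u := (a + v) / 2; have [au uv] := midf_lt av.
have [G [G0 iG] hG] := abel_dominated ch1 au.
pose f x y := h (x + y) * Num.sqrt y.
have df x y : a < x -> 0 < y -> is_derive x 1 (f ^~ y) (h1 (x + y) * Num.sqrt y).
  move=> ax y0; have dhxy : is_derive (x + y) 1 h (h1 (x + y)).
    by apply: dh; rewrite ltr_wpDr// ltW.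
  have dsh : is_derive x 1 (fun x => x + y) 1.
    by apply: is_derive_eq; rewrite addr0.
  have := @is_derive1_comp _ h (fun x => x + y) x _ _ dhxy dsh; rewrite mulr1 => dc.
  by rewrite /f; apply: is_derive_eq; rewrite /GRing.scale/= mulr0 add0r mulrC.
have Iv : `]u, v + 1[%classic v by rewrite /= in_itv/= uv ltrDl ltr01.
have intf x : `]u, v + 1[%classic x ->
    leb.-integrable (`]0, +oo[%classic : set R) (EFin \o f x).
  rewrite /= in_itv/= => /andP[ux _]; apply: abel_integrable => //.
  exact: lt_trans ux.
have derf1 x y : `]u, v + 1[%classic x -> `]0, +oo[%classic y -> derivable (f ^~ y) x 1.
  rewrite /= !in_itv/= andbT => /andP[ux _] y0.
  by have := df x y (lt_trans au ux) y0; case.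
have d1E x y : u < x -> 0 < y -> partial1of2 f x y = h1 (x + y) * Num.sqrt y.
  move=> ux y0; rewrite /partial1of2 derive1E.
  by apply: (@derive_val _ _ _ _ _ _ _ (df x y (lt_trans au ux) y0)).
have Gub x y : `]u, v + 1[%classic x -> `]0, +oo[%classic y ->
    `|partial1of2 f x y| <= G y.
  rewrite /= !in_itv/= andbT => /andP[ux _] y0.
  by rewrite d1E//; exact: hG.
have mD : measurable (`]0, +oo[%classic : set (measurableTypeR R)) by [].
apply: DeriveDef.
  exact: (@derivable_under_integral R _ _ leb f _ mD v u (v + 1) Iv intf derf1 G G0 iG Gub).
rewrite -derive1E (@differentiation_under_integral R _ _ leb f _ mD v u (v + 1) Iv intf derf1 G G0 iG Gub).
apply: eq_Rintegral => y /set_mem /=; rewrite in_itv/= andbT => y0.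
exact: d1E.
Qed.

Lemma continuous_abel h v : cont_on_halfline h -> a < v ->
  {for v, continuous (abelT h)}.
Proof.
move=> ch av; pose u := (a + v) / 2; have [au uv] := midf_lt av.
have [G [G0 iG] hG] := abel_dominated ch au.
have mD : measurable (`]0, +oo[%classic : set (measurableTypeR R)) by [].
pose f x y := h (x + y) * Num.sqrt y.
have intf x : `]u, v + 1[%classic x ->
    leb.-integrable (`]0, +oo[%classic : set R) (EFin \o f x).
  rewrite /= in_itv/= => /andP[ux _]; apply: abel_integrable => //.
  exact: lt_trans ux.
apply: (@continuity_under_integral _ _ _ leb f _ mD u (v + 1) intf _ G iG).
- apply: aeW => y /=; rewrite in_itv/= andbT => y0 x /set_mem /=.
  rewrite in_itv/= => /andP[ux _].
  apply: cvgM; last exact: cvg_cst.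
  apply: (@continuous_comp _ _ _ (fun x => x + y) h).
    by apply: cvgD; [exact: cvg_id|exact: cvg_cst].
  by apply: ch.1; rewrite (lt_trans (lt_trans au ux))// ltrDl.
- move=> x /=; rewrite in_itv/= => /andP[ux _]; apply: aeW => y /=.
  by rewrite in_itv/= andbT => y0; exact: hG.
- by rewrite inE/= in_itv/= uv ltrDl ltr01.
Qed.

End on_halfline.

Lemma abel_integrable_ge0 (q : R -> R) (v C M : R) : measurable_fun setT q ->
  (forall x, 0 <= q x <= C) -> (forall x, M <= x -> q x = 0) ->
  leb.-integrable (`]0, +oo[%classic : set R)
    (EFin \o (fun x => q (v + x) * Num.sqrt x)).
Proof.
move=> mq q0C qM.
have q0 x : 0 <= q x by have /andP[] := q0C x.
have qC x : q x <= C by have /andP[] := q0C x.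
have C0 : 0 <= C by exact: le_trans (q0 0) (qC 0).
have Nv := ler_norm (M - v); have N0 := normr_ge0 (M - v).
set N : R := `|M - v| in Nv N0.
apply: (@integrable_bounded_support _ _ _ (C * Num.sqrt N) N) => //.
- by apply: measurable_funTS; mfun; apply: (measurableT_comp mq); mfun.
- move=> x /=; rewrite in_itv/= andbT => x0.
  rewrite ger0_norm ?mulr_ge0 ?sqrtr_ge0//; have [xN|Nx] := leP x N.
    by apply: ler_pM => //; rewrite ?sqrtr_ge0 ?ler_sqrt.
  by rewrite qM ?mul0r ?mulr_ge0 ?sqrtr_ge0//; lra.
- move=> x /=; rewrite in_itv/= andbT => x0; rewrite gtr0_norm// => Nx.
  by rewrite qM ?mul0r//; lra.
Qed.

Lemma moment_integrable_ge0 (q : R -> R) (u C M : R) : measurable_fun setT q ->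
  (forall x, 0 <= q x <= C) -> (forall x, M <= x -> q x = 0) ->
  leb.-integrable (`]0, +oo[%classic : set R) (EFin \o (fun z => z * q (u + z))).
Proof.
move=> mq q0C qM.
have q0 x : 0 <= q x by have /andP[] := q0C x.
have qC x : q x <= C by have /andP[] := q0C x.
have C0 : 0 <= C by exact: le_trans (q0 0) (qC 0).
have Nu := ler_norm (M - u); have N0 := normr_ge0 (M - u).
set N : R := `|M - u| in Nu N0.
apply: (@integrable_bounded_support _ _ _ (N * C) N) => //.
- by apply: measurable_funTS; mfun; apply: (measurableT_comp mq); mfun.
- move=> x /=; rewrite in_itv/= andbT => x0; have [xN|Nx] := leP x N.
    rewrite ger0_norm; last by rewrite mulr_ge0// ltW.
    by apply: ler_pM => //; exact: ltW.
  rewrite qM ?mulr0 ?normr0 ?mulr_ge0//; lra.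
- move=> x /=; rewrite in_itv/= andbT => x0; rewrite gtr0_norm// => Nx.
  by rewrite qM ?mulr0//; lra.
Qed.

(** The identity of extended integrals has a finite right-hand side, so integrability of the
    left-hand integrand comes out of the identity itself; it is recorded because the signed case
    subtracts two such integrals. *)
Lemma abel_inversion_ge0 (q : R -> R) (u C M : R) : measurable_fun setT q ->
  (forall x, 0 <= q x <= C) -> (forall x, M <= x -> q x = 0) ->
  leb.-integrable (`]u, +oo[%classic : set R)
    (EFin \o (fun v => abelT q v / Num.sqrt (v - u))) /\
  \int[leb]_(v in `]u, +oo[) (abelT q v / Num.sqrt (v - u)) =
    pi / 2 * \int[leb]_(z in `]0, +oo[) (z * q (u + z)).
Proof.
move=> mq q0C qM.
have q0 x : 0 <= q x by have /andP[] := q0C x.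
have qC x : q x <= C by have /andP[] := q0C x.
have C0 : 0 <= C by exact: le_trans (q0 0) (qC 0).
have mqc d (T : measurableType d) (f : T -> R) : measurable_fun setT f ->
    measurable_fun setT (fun p => q (f p)).
  by move=> mf; exact: (measurableT_comp mq).
have iq v : leb.-integrable (`]0, +oo[%classic : set R)
    (EFin \o (fun x => q (v + x) * Num.sqrt x)).
  exact: abel_integrable_ge0 mq q0C qM.
have FE v : (\int[leb]_(x in `]0%R, +oo[) (q (v + x) * Num.sqrt x)%R%:E =
    (abelT q v)%:E)%E.
  by rewrite /abelT /Rintegral fineK//; apply: integrable_fin_num => //; exact: iq.
have mA : measurable_fun setT (fun v => (abelT q v)%:E).
  rewrite (_ : (fun v => _) = (fun v =>
     \int[leb]_x ((0 < x)%R%:R * (q (v + x) * Num.sqrt x))%R%:E)%E).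
    apply: (measurable_integral_lebesgue (T := R)
       (f := fun v x => ((0 < x)%R%:R * (q (v + x) * Num.sqrt x))%R%:E)).
      by apply/measurable_EFinP; mfun; apply: mqc; mfun.
    move=> v x; rewrite lee_fin; apply: mulr_ge0; first exact: ler0n.
    by apply: mulr_ge0 => //; exact: sqrtr_ge0.
  apply/funext => v; rewrite -FE integral_gt; apply: eq_integral => x _.
  by rewrite -EFinM.
have iz : leb.-integrable (`]0, +oo[%classic : set R) (EFin \o (fun z => z * q (u + z))).
  exact: moment_integrable_ge0 mq q0C qM.
have E : (\int[leb]_(v in `]u, +oo[) (abelT q v / Num.sqrt (v - u))%R%:E =
    (pi / 2 * \int[leb]_(z in `]0, +oo[) (z * q (u + z)))%R%:E)%E.
  rewrite EFinM [in RHS]/Rintegral fineK; last exact: integrable_fin_num iz.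
  rewrite -abel_ge0//; apply: eq_integral => v _.
  by rewrite FE -EFinM mulrC.
split; last by rewrite {1}/Rintegral E.
apply/integrableP; split.
  apply/measurable_EFinP; apply: measurable_funTS.
  have mA' : measurable_fun setT (abelT q) by exact/measurable_EFinP.
  by mfun.
apply: (@le_lt_trans _ _
    (\int[leb]_(v in `]u, +oo[) (abelT q v / Num.sqrt (v - u))%R%:E)%E); last first.
  by rewrite E ltry.
rewrite le_eqVlt; apply/orP; left; apply/eqP; apply: eq_integral.
move=> v _ /=; rewrite ger0_norm// divr_ge0 ?sqrtr_ge0//.
by apply: Rintegral_ge0 => x _; rewrite mulr_ge0 ?sqrtr_ge0.
Qed.

(** Only values of [h] beyond [u] enter, so [h] is cut off to []u, +oo[], where it is bounded and
    measurable. The positive and negative parts of the cut-off function are inverted separately and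
    subtracted. *)
Lemma abel_inversion (a M : R) h (u : R) : cont_on_halfline a M h -> a < u ->
  \int[leb]_(v in `]u, +oo[) (abelT h v / Num.sqrt (v - u)) =
    pi / 2 * \int[leb]_(z in `]0, +oo[) (z * h (u + z)).
Proof.
move=> [ch hM] au; have [C C0 hC] := bounded_continuous_support ch hM au.
pose h0 : R -> R := h \_ `]u, +oo[%classic.
have mD : measurable (`]u, +oo[%classic : set R) by [].
have mh0 : measurable_fun setT h0.
  apply/(measurable_restrictT _ mD); apply: open_continuous_measurable_fun.
    exact: interval_open.
  by move=> x /set_mem /=; rewrite in_itv/= andbT => ux; apply: ch; exact: lt_trans ux.
have h0E x : u < x -> h0 x = h x.
  by move=> ux; rewrite /h0 patchE mem_set//= in_itv/= ux.
have h0C x : `|h0 x| <= C.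
  rewrite /h0 patchE; case: ifPn => [/set_mem /=|]; last by rewrite normr0.
  by rewrite in_itv/= andbT => /ltW/hC.
have h0M x : M <= x -> h0 x = 0.
  by move=> Mx; rewrite /h0 patchE; case: ifPn => // _; exact: hM.
pose p (x : R) : R := Num.max (h0 x) 0; pose n (x : R) : R := Num.max (- h0 x) 0.
have pn x : h0 x = p x - n x.
  rewrite /p /n /=; have [hx|hx] := leP 0 (h0 x).
    by rewrite max_r ?subr0// oppr_le0.
  by rewrite max_l ?sub0r ?opprK// oppr_ge0 ltW.
have p0C x : 0 <= p x <= C.
  rewrite /p /= le_max lexx orbT/= ge_max C0 andbT.
  by apply: le_trans (h0C x); exact: ler_norm.
have n0C x : 0 <= n x <= C.
  rewrite /n /= le_max lexx orbT/= ge_max C0 andbT.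
  by apply: le_trans (h0C x); rewrite -normrN; exact: ler_norm.
have pM x : M <= x -> p x = 0 by move=> Mx; rewrite /p /= h0M// maxxx.
have nM x : M <= x -> n x = 0 by move=> Mx; rewrite /n /= h0M// oppr0 maxxx.
have mp : measurable_fun setT p by exact: measurable_funrpos.
have mn : measurable_fun setT n by exact: measurable_funrneg.
have [ip Ep] := abel_inversion_ge0 u mp p0C pM.
have [in_ En] := abel_inversion_ge0 u mn n0C nM.
transitivity (\int[leb]_(v in `]u, +oo[)
    (abelT p v / Num.sqrt (v - u) - abelT n v / Num.sqrt (v - u))).
  apply: eq_Rintegral => v /set_mem /=; rewrite in_itv/= andbT => uv.
  rewrite -mulrBl; congr (_ / _); rewrite /abelT -RintegralB//;
    [|exact: abel_integrable_ge0 mp p0C pM|exact: abel_integrable_ge0 mn n0C nM].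
  apply: eq_Rintegral => x /set_mem /=; rewrite in_itv/= andbT => x0.
  by rewrite -mulrBl -pn h0E// ltr_wpDr// ltW.
rewrite RintegralB// Ep En -mulrBr -RintegralB//;
  [|exact: moment_integrable_ge0 mp p0C pM|exact: moment_integrable_ge0 mn n0C nM].
congr (_ * _); apply: eq_Rintegral => z /set_mem /=; rewrite in_itv/= andbT => z0.
by rewrite -mulrBr -pn h0E// ltrDl.
Qed.

(** Integration by parts in one stroke: [z * h1 (u + z) - h (u + z)] is an antiderivative, equal to
    [- h u] at 0 and to 0 once [u + z] reaches [M]. *)
Lemma moment_second_derivative (a M u : R) h h1 h2 : cont_on_halfline a M h2 ->
  (forall x, a < x -> is_derive x 1 h (h1 x)) ->
  (forall x, a < x -> is_derive x 1 h1 (h2 x)) ->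
  (forall x, M <= x -> h x = 0) -> (forall x, M <= x -> h1 x = 0) -> a < u ->
  \int[leb]_(z in `]0, +oo[) (z * h2 (u + z)) = h u.
Proof.
move=> [ch2 h2M] dh dh1 hM h1M au.
pose N : R := `|M - u| + 1.
have N0 : 0 < N by rewrite ltr_wpDl.
have MN : M <= u + N by have := ler_norm (M - u); rewrite /N; lra.
pose G z := z * h1 (u + z) - h (u + z).
have cs (z : R) : 0 <= z -> {for z, continuous (fun z : R => z * h2 (u + z))}.
  move=> z0; apply: cvgM; first exact: cvg_id.
  apply: (@continuous_comp _ _ _ (fun z => u + z) h2).
    by apply: cvgD; [exact: cvg_cst|exact: cvg_id].
  by apply: ch2; rewrite ltr_wpDr.
have dG (z : R) : 0 <= z -> is_derive z 1 G (z * h2 (u + z)).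
  move=> z0; have auz : a < u + z by rewrite ltr_wpDr.
  have dsh : is_derive z 1 (fun z => u + z) 1.
    rewrite -[X in is_derive _ _ _ X]add0r.
    exact: (is_deriveD (is_derive_cst u z 1) (is_derive_id z 1)).
  have := @is_derive1_comp _ h (fun z => u + z) z _ _ (dh _ auz) dsh.
  have := @is_derive1_comp _ h1 (fun z => u + z) z _ _ (dh1 _ auz) dsh.
  rewrite !mulr1 => d1 d0.
  by rewrite /G; apply: is_derive_eq; rewrite /GRing.scale/= mulr1; ring.
transitivity (\int[leb]_(z in `[0, N]) (z * h2 (u + z))).
  rewrite Rintegral_mkcond [RHS]Rintegral_mkcond; apply: eq_Rintegral => z _.
  rewrite !patchE; case: ifPn => [/set_mem/=|nz]; last first.
    (* The domains []0, +oo[] and [[0, N]] also differ at [z = 0], where the factor [z] kills the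
       integrand. *)
    case: ifPn => // /set_mem/=; rewrite in_itv/= => /andP[z0 zN].
    move: nz; rewrite notin_setE/= in_itv/= andbT => /negP; rewrite -leNgt => z0'.
    have -> : (z : R) = 0 by apply/eqP; rewrite eq_le z0' z0.
    by rewrite mul0r.
  rewrite in_itv/= andbT => z0; case: ifPn => // nz.
  rewrite h2M ?mulr0//; move: nz; rewrite notin_setE/= in_itv/= (ltW z0)/= => /negP.
  by rewrite -ltNge => Nz; rewrite (le_trans MN)// lerD2l ltW.
rewrite /Rintegral (@continuous_FTC2 _ _ G)//.
- by rewrite /G hM// h1M// addr0 mulr0 mul0r !sub0r/= oppr0 add0r opprK.
- apply: continuous_in_subspaceT => z /set_mem /=; rewrite in_itv/= => /andP[z0 _].
  exact: cs.
- have cG z : 0 <= z -> {for z, continuous G}.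
    move=> z0; apply/differentiable_continuous/derivable1_diffP.
    by have := dG z z0; case.
  split.
  + by move=> z; rewrite in_itv/= => /andP[/ltW z0 _]; have := dG z z0; case.
  + by apply: cvg_at_right_filter; exact: cG.
  + by apply: cvg_at_left_filter; apply: cG; exact: ltW.
- move=> z; rewrite in_itv/= => /andP[/ltW z0 _]; rewrite derive1E.
  by apply: (@derive_val _ _ _ _ _ _ _ (dG z z0)).
Qed.

End abel_transform.

(** * Fourier inversion for even C^2 functions of compact support *)

Section fourier.
Context {R : realType}.
Local Notation leb := (@lebesgue_measure R).
Implicit Types (f g : R -> R).

Lemma Rintegral_odd f : measurable_fun setT f -> (forall x, f (- x) = - f x) ->
  \int[leb]_x f x = 0.
Proof.
move=> mf fN; rewrite /Rintegral integralE.
rewrite (_ : \int[leb]_x _^\+ x = \int[leb]_x ((EFin \o f)^\- x))%E.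
  (* The parts have equal integrals. If the common value is infinite, the difference is not a real
     number and [fine] sends it to 0. *)
  by case: (\int[leb]_x ((EFin \o f)^\- x))%E => //= r; rewrite subrr.
have mF : measurable_fun setT (EFin \o f) by exact/measurable_EFinP.
rewrite (@ge0_integral_affine _ _ (-1) 0) ?oppr_eq0//.
- apply: eq_integral => x _; rewrite addr0 mulN1r normrN1 mule1.
  by rewrite funeposE funenegE /= fN.
- exact: measurable_funepos.
Qed.

Lemma integrable_scale (D : set R) f (c : R) : measurable D ->
  leb.-integrable D (EFin \o f) -> leb.-integrable D (EFin \o (fun x => c * f x)).
Proof.
move=> mD fi; rewrite (_ : EFin \o _ = fun x => (c%:E * (EFin \o f) x)%E).
  exact: integrableZl.
by apply/funext => x /=; rewrite EFinM.
Qed.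

Lemma integrable_oneDsqrV (C : R) :
  leb.-integrable setT (EFin \o (fun x => C / (1 + x ^+ 2))).
Proof.
have D0 (x : R) : 0 <= (1 + x ^+ 2)^-1 by rewrite invr_ge0 addr_ge0// sqr_ge0.
rewrite (_ : EFin \o _ = fun x => (C%:E * ((1 + x ^+ 2)^-1)%:E)%E); last first.
  by apply/funext => x /=; rewrite EFinM.
apply: integrableZl => //; apply/integrableP; split.
  by apply/measurable_EFinP; mfun.
rewrite (_ : (fun x => _) = (fun x => ((1 + x ^+ 2)^-1)%:E)); last first.
  by apply/funext => x; rewrite /= ger0_norm.
by rewrite integral_oneDsqrT ltry.
Qed.

Lemma bounded_continuous_compact f (M : R) : continuous f ->
  (forall x, M <= `|x| -> f x = 0) ->
  exists2 C : R, 0 <= C & forall x, `|f x| <= C.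
Proof.
move=> cf fM.
(* The bound is taken on the ray from [-|M| - 1], to the left of which [f] vanishes; [-|M| - 2]
   provides the strict gap. *)
have [C C0 fC] := @bounded_continuous_support _ f (- `|M| - 2) (- `|M| - 1) `|M|
  (fun x _ => cf x) (fun x (h : `|M| <= x) => fM x (le_trans (ler_norm M) (le_trans h (ler_norm x)))) ltac:(lra).
exists C => // x; have [h|h] := leP (- `|M| - 1) x; first exact: fC.
rewrite fM ?normr0//; have := ler_norm M; have := ler_norm (- x).
by rewrite normrN; lra.
Qed.

(** The added 1 makes the integrand nonnegative, as the half-line form of the fundamental theorem
    requires. Its share [2 / eps] is the case [y = 0] halved, and [poisson_kernel] subtracts it. *)
Lemma integral_exp_cos (eps y : R) : 0 < eps ->
  (\int[leb]_r (expR (- (eps * `|r|)) * (1 + cos (r * y)))%R%:E =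
   (2 / eps + 2 * eps / (eps ^+ 2 + y ^+ 2))%R%:E)%E.
Proof.
move=> eps0; have D0 : 0 < eps ^+ 2 + y ^+ 2 by rewrite ltr_wpDr ?sqr_ge0// exprn_gt0.
have Dn0 : eps ^+ 2 + y ^+ 2 != 0 by rewrite gt_eqF.
have en0 : eps != 0 by rewrite gt_eqF.
have cge0 (r : R) : 0 <= 1 + cos (r * y) by have := cos_geN1 (r * y); lra.
rewrite ge0_integral_even; last 3 first.
- by apply/measurable_EFinP; mfun.
- by move=> r; rewrite lee_fin mulr_ge0 ?expR_ge0.
- by move=> r; rewrite normrN mulNr cosN.
pose f (r : R) := expR (- (eps * r)) * (1 + cos (r * y)).
(* The first term integrates [e^(-eps r)]. The second is the real part of
   [e^(i r y) / (-eps + i y)], from integrating the exponential with exponent [(-eps + i y) r]. *)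
pose b (r : R) := - eps^-1 + (- eps * cos (r * y) + y * sin (r * y)) / (eps ^+ 2 + y ^+ 2).
pose F (r : R) := expR (- (eps * r)) * b r.
have dF (r : R) : is_derive r 1 F (f r).
  have dc : is_derive r 1 (fun r : R => cos (r * y)) (- sin (r * y) * y).
    apply: is_derive1_comp; apply: is_derive_eq.
    by rewrite /GRing.scale/= mulr0 add0r mulr1.
  have ds : is_derive r 1 (fun r : R => sin (r * y)) (cos (r * y) * y).
    apply: is_derive1_comp; apply: is_derive_eq.
    by rewrite /GRing.scale/= mulr0 add0r mulr1.
  have de : is_derive r 1 (fun r : R => expR (- (eps * r))) (expR (- (eps * r)) * - eps).
    apply: is_derive1_comp; apply: is_derive_eq.
    by rewrite /GRing.scale/= mulr1.
  by rewrite /F /b /f; apply: is_derive_eq; rewrite /GRing.scale/=; field; rewrite ?en0 ?Dn0.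
have cF : continuous F.
  by move=> r; apply/differentiable_continuous/derivable1_diffP; have := dF r; case.
pose K : R := eps^-1 + (eps + `|y|) / (eps ^+ 2 + y ^+ 2).
have bK r : `|b r| <= K.
  rewrite (le_trans (ler_normD _ _))// lerD//.
    by rewrite normrN gtr0_norm// invr_gt0.
  rewrite normrM (@gtr0_norm _ (_^-1)) ?invr_gt0// ler_pM2r ?invr_gt0//.
  rewrite (le_trans (ler_normD _ _))// !normrM normrN (gtr0_norm eps0) lerD//.
    by apply: ler_piMr; [exact: ltW|rewrite ler_norml cos_geN1 cos_le1].
  by apply: ler_piMr => //; rewrite ler_norml sin_geN1 sin_le1.
have e0 : expR (- (eps * r)) @[r --> +oo] --> (0 : R).
  apply: (@cvg_comp _ _ _ (fun r => eps * r) (fun x => expR (- x)) _ +oo); last exact: cvgr_expR.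
  apply/cvgryPge => A; near=> r.
  have Ar : A / eps <= r by near: r; apply: nbhs_pinfty_ge; exact: num_real.
  by rewrite mulrC -ler_pdivrMr.
have F0 : F r @[r --> +oo] --> (0 : R).
  apply: (@squeeze_cvgr _ _ _ _ (fun r => - (expR (- (eps * r)) * K)) (fun r => expR (- (eps * r)) * K)).
  - near=> r; rewrite -ler_norml normrM gtr0_norm ?expR_gt0// ler_pM2l ?expR_gt0//.
  - by rewrite -[X in _ --> X]oppr0 -[X in _ --> - X](mul0r K); apply: cvgN; apply: cvgM => //; exact: cvg_cst.
  - by rewrite -[X in _ --> X](mul0r K); apply: cvgM => //; exact: cvg_cst.
transitivity (2%:E * \int[leb]_(r in `]0%R, +oo[) (f r)%:E)%E.
  congr (_ * _)%E; apply: eq_integral => r /set_mem/=; rewrite in_itv/= andbT => r0.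
  by rewrite gtr0_norm.
have cf : continuous f.
  move=> r.
  have cc : {for r, continuous (fun r : R => cos (r * y))}.
    apply: (@continuous_comp _ _ _ (fun r : R => r * y) cos); last exact: continuous_cos.
    by apply: cvgM; [exact: cvg_id|exact: cvg_cst].
  have ce : {for r, continuous (fun r : R => expR (- (eps * r)))}.
    apply: (@continuous_comp _ _ _ (fun r : R => - (eps * r)) expR); last exact: continuous_expR.
    by apply: cvgN; apply: cvgM; [exact: cvg_cst|exact: cvg_id].
  by apply: cvgM; [exact: ce|apply: cvgD; [exact: cvg_cst|exact: cc]].
rewrite integral_itv_obnd_cbnd; last first.
  by apply/measurable_EFinP/measurable_funTS; exact: continuous_measurable_fun.
rewrite (@ge0_continuous_FTC2y _ f F 0 0)//.
- rewrite -EFinN -EFinD -EFinM; congr EFin.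
  by rewrite /F /b mulr0 oppr0 expR0 mul0r cos0 sin0; field; rewrite ?en0 ?Dn0.
- by move=> r _; rewrite mulr_ge0 ?expR_ge0.
- exact: continuous_subspaceT.
- by apply: cvg_at_right_filter; exact: cF.
- by move=> r _; rewrite derive1E; apply: (@derive_val _ _ _ _ _ _ _ (dF r)).
Unshelve. all: by end_near. Qed.

Lemma integral_exp_norm (eps : R) : 0 < eps ->
  (\int[leb]_r (expR (- (eps * `|r|)))%:E = (2 / eps)%:E)%E.
Proof.
move=> eps0; have := @integral_exp_cos eps 0 eps0.
rewrite (_ : (fun r => _) = (fun r => (2%:E * (expR (- (eps * `|r|)))%:E)%E)); last first.
  by apply/funext => r; rewrite mulr0 cos0 -EFinM mulrC.
rewrite ge0_integralZl//; last by apply/measurable_EFinP; mfun.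
rewrite expr0n addr0 /=.
have -> : 2 / eps + 2 * eps / eps ^+ 2 = 2 * (2 / eps) by field; rewrite gt_eqF.
case: (\int[leb]_x _)%E => [i [E2]| |].
- by congr EFin; apply: (@mulfI _ 2).
- by rewrite mulry gtr0_sg// mul1e.
- by rewrite mulrNy gtr0_sg// mul1e.
Qed.

Lemma integrable_exp_norm (eps : R) : 0 < eps ->
  leb.-integrable setT (EFin \o (fun r => expR (- (eps * `|r|)))).
Proof.
move=> eps0; apply/integrableP; split; first by apply/measurable_EFinP; mfun.
rewrite (_ : (fun r => _) = (fun r => (expR (- (eps * `|r|)))%:E)).
  by rewrite integral_exp_norm// ltry.
by apply/funext => r; rewrite /= gtr0_norm ?expR_gt0.
Qed.

Lemma integrable_exp_cos (eps y : R) : 0 < eps ->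
  leb.-integrable setT (EFin \o (fun r => expR (- (eps * `|r|)) * cos (r * y))).
Proof.
move=> eps0; apply: le_integrable (integrable_exp_norm eps0) => //.
  by apply/measurable_EFinP; mfun.
move=> r _; rewrite /= lee_fin normrM ler_piMr// ler_norml.
by rewrite cos_geN1 cos_le1.
Qed.

Lemma poisson_kernel (eps y : R) : 0 < eps ->
  \int[leb]_r (expR (- (eps * `|r|)) * cos (r * y)) = 2 * eps / (eps ^+ 2 + y ^+ 2).
Proof.
move=> eps0; apply: (@addrI _ (2 / eps)).
have /(congr1 fine) /= <- := integral_exp_cos y eps0.
have /(congr1 fine) /= <- := integral_exp_norm eps0.
rewrite -!/(Rintegral _ _ _) -RintegralD//.
- by apply: eq_Rintegral => r _; rewrite mulrDr mulr1.
- exact: integrable_exp_norm.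
- exact: integrable_exp_cos.
Qed.

Section even_bump.
Variables (g g1 g2 : R -> R) (M : R).
Hypothesis dg : forall x : R, is_derive x 1 g (g1 x).
Hypothesis dg1 : forall x : R, is_derive x 1 g1 (g2 x).
Hypothesis cg2 : continuous g2.
Hypothesis gM : forall x, M <= `|x| -> g x = 0.
Hypothesis g1M : forall x, M <= `|x| -> g1 x = 0.
Hypothesis g2M : forall x, M <= `|x| -> g2 x = 0.
Hypothesis g0 : forall x, 0 <= g x.
Hypothesis gN : forall x, g (- x) = g x.

(** For even [g] the sine part vanishes, so this is the full Fourier transform. *)
Definition cosT (r : R) : R := \int[leb]_x (g x * cos (r * x)).

Lemma bump_continuous : continuous g.
Proof.
by move=> x; apply/differentiable_continuous/derivable1_diffP; have := dg x; case.
Qed.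

Lemma bump_measurable : measurable_fun setT g.
Proof. exact: continuous_measurable_fun bump_continuous. Qed.

Lemma integrable_bumpM f (h : R -> R) : continuous f ->
  (forall x, M <= `|x| -> f x = 0) -> measurable_fun setT h ->
  (forall x, `|h x| <= 1) -> leb.-integrable setT (EFin \o (fun x => f x * h x)).
Proof.
move=> cf fM mh h1; have [C C0 fC] := bounded_continuous_compact cf fM.
apply: (@integrable_bounded_support _ _ _ C M) => //.
- by apply: measurable_funM => //; exact: continuous_measurable_fun.
- by move=> x _; rewrite normrM -[leRHS]mulr1 ler_pM.
- by move=> x _ /ltW Mx; rewrite fM// mul0r.
Qed.

Lemma integrable_bump_cos r : leb.-integrable setT (EFin \o (fun x => g x * cos (r * x))).
Proof.
apply: integrable_bumpM => //; [exact: bump_continuous|by mfun|].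
by move=> x; rewrite ler_norml cos_geN1 cos_le1.
Qed.

Lemma integrable_bump_sin r : leb.-integrable setT (EFin \o (fun x => g x * sin (r * x))).
Proof.
apply: integrable_bumpM => //; [exact: bump_continuous|by mfun|].
by move=> x; rewrite ler_norml sin_geN1 sin_le1.
Qed.

Lemma sinT_eq0 r : \int[leb]_x (g x * sin (r * x)) = 0.
Proof.
apply: Rintegral_odd.
  by have mg := bump_measurable; mfun.
by move=> x; rewrite gN mulrN sinN mulrN.
Qed.

(** Two integrations by parts identify [- r^2 * cosT r] with the cosine transform of [g2]; hence
    [(1 + r^2) * cosT r] is bounded by the sum of the L^1 norms of [g] and [g2]. *)
Lemma cosT_decay : exists2 K : R, 0 <= K & forall r, `|cosT r| <= K / (1 + r ^+ 2).
Proof.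
have cg := bump_continuous.
have ig : leb.-integrable setT (EFin \o (fun x => g x * 1)).
  by apply: integrable_bumpM => // x; rewrite normr1.
have ig2 : leb.-integrable setT (EFin \o (fun x => g2 x * 1)).
  by apply: integrable_bumpM => // x; rewrite normr1.
pose K : R := \int[leb]_x `|g x * 1| + \int[leb]_x `|g2 x * 1|.
exists K; first by rewrite addr_ge0// Rintegral_ge0.
move=> r.
have D0 : 0 < 1 + r ^+ 2 by rewrite ltr_pwDl// sqr_ge0.
rewrite ler_pdivlMr// -[X in _ * X](gtr0_norm D0) -normrM.
have mc : measurable_fun setT (fun x : R => cos (r * x)) by mfun.
have c1 (x : R) : `|cos (r * x)| <= 1 by rewrite ler_norml cos_geN1 cos_le1.
have ic := integrable_bumpM cg gM mc c1.
have ic2 := integrable_bumpM cg2 g2M mc c1.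
have E : \int[leb]_x (g2 x * cos (r * x)) = - (r ^+ 2) * cosT r.
  apply/eqP; rewrite mulNr -addr_eq0 /cosT -RintegralZl// -RintegralD//; last first.
    exact: integrable_scale.
  pose N : R := `|M| + 1.
  have MN : M <= N by have := ler_norm M; rewrite /N; lra.
  have N0 : 0 < N by rewrite ltr_wpDl.
  pose F (x : R) := g2 x * cos (r * x) + r ^+ 2 * (g x * cos (r * x)).
  (* In the derivative the two terms with [g1 * sin] cancel, so [G] carries both integrations by
     parts at once and vanishes at both ends. *)
  pose G (x : R) := g1 x * cos (r * x) + r * g x * sin (r * x).
  have dG (x : R) : is_derive x 1 G (F x).
    have dc : is_derive x 1 (fun x : R => cos (r * x)) (- sin (r * x) * r).
      by apply: is_derive1_comp; apply: is_derive_eq; rewrite /GRing.scale/= mulr1.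
    have ds : is_derive x 1 (fun x : R => sin (r * x)) (cos (r * x) * r).
      by apply: is_derive1_comp; apply: is_derive_eq; rewrite /GRing.scale/= mulr1.
    by rewrite /G /F; apply: is_derive_eq; rewrite /GRing.scale/=; ring.
  have NN x : x \notin `[- N, N]%classic -> M <= `|x|.
    move=> /negP; rewrite inE/= in_itv/= -ler_norml => /negP; rewrite -ltNge => /ltW.
    exact: le_trans.
  transitivity (\int[leb]_(x in `[- N, N]) F x == 0).
    congr (_ == _); rewrite [RHS]Rintegral_mkcond; apply: eq_Rintegral => x _.
    rewrite patchE; case: ifPn => // /NN Mx; rewrite gM// g2M// !mul0r.
    by rewrite mulr0 addr0.
  rewrite /Rintegral (@continuous_FTC2 _ F G (- N) N).
  - have G0 x : M <= `|x| -> G x = 0.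
      by move=> Mx; rewrite /G gM// g1M// mulr0 !mul0r addr0.
    have -> : G N = 0 by apply: G0; rewrite gtr0_norm.
    have -> : G (- N) = 0 by apply: G0; rewrite normrN gtr0_norm.
    by rewrite /= subrr eqxx.
  - by rewrite gtrN.
  - apply: continuous_subspaceT => x.
    have cc : {for x, continuous (fun x : R => cos (r * x))}.
      apply: (@continuous_comp _ _ _ (fun x : R => r * x) cos); last exact: continuous_cos.
      by apply: cvgM; [exact: cvg_cst|exact: cvg_id].
    apply: cvgD; first by apply: cvgM; [exact: cg2|exact: cc].
    by apply: cvgM; [exact: cvg_cst|apply: cvgM; [exact: cg|exact: cc]].
  - have cG : continuous G.
      by move=> x; apply/differentiable_continuous/derivable1_diffP; have := dG x; case.
    split; first by move=> x _; have := dG x; case.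
    + by apply: cvg_at_right_filter; exact: cG.
    + by apply: cvg_at_left_filter; exact: cG.
  - by move=> x _; rewrite derive1E; apply: (@derive_val _ _ _ _ _ _ _ (dG x)).
have -> : cosT r * (1 + r ^+ 2) = cosT r - \int[leb]_x (g2 x * cos (r * x)).
  by rewrite E; ring.
rewrite (le_trans (ler_normB _ _))//.
have B f (cf : continuous f) (fM : forall x, M <= `|x| -> f x = 0) :
    `|\int[leb]_x (f x * cos (r * x))| <= \int[leb]_x `|f x * 1|.
  have if1 := integrable_bumpM cf fM mc c1.
  rewrite (le_trans (le_normr_Rintegral _ if1))//.
  apply: le_Rintegral => //.
  - by apply: integrable_norm.
  - apply: integrable_norm; apply: (integrable_bumpM cf fM) => //.
    by move=> x; rewrite normr1.
  - by move=> x _; rewrite mulr1 normrM -[leRHS]mulr1 ler_pM.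
by apply: lerD; exact: B.
Qed.

(** Tonelli gives measurability of parameter integrals with nonnegative integrand, so [cos] is
    replaced by [1 + cos] and the constant integral of [g] is subtracted. *)
Lemma measurable_cosT : measurable_fun setT cosT.
Proof.
have mg := bump_measurable.
have ig : leb.-integrable setT (EFin \o (fun x => g x * 1)).
  by apply: integrable_bumpM => //; [exact: bump_continuous|move=> x; rewrite normr1].
pose F r := (\int[leb]_x (g x * (1 + cos (r * x)))%:E)%E.
have mF : measurable_fun setT F.
  apply: (measurable_integral_lebesgue (T := R)
     (f := fun r x => (g x * (1 + cos (r * x)))%:E)).
    apply/measurable_EFinP; apply: measurable_funM; last by mfun.
    by apply: (measurableT_comp mg); mfun.
  move=> r x; rewrite lee_fin; apply: mulr_ge0; first exact: g0.
  by have := cos_geN1 (r * x); lra.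
rewrite (_ : cosT = fun r => fine (F r) - \int[leb]_x (g x * 1)).
  apply: measurable_funB => //.
  by apply: (measurableT_comp _ mF); exact: fine_measurable.
apply/funext => r; apply/eqP; rewrite eq_sym subr_eq; apply/eqP.
rewrite /F -/(Rintegral _ _ _) /cosT -RintegralD//; last exact: integrable_bump_cos.
by apply: eq_Rintegral => x _; ring.
Qed.

Lemma integrable_cosT_cos eta :
  leb.-integrable setT (EFin \o (fun r => cosT r * cos (r * eta))).
Proof.
have [K K0 cK] := cosT_decay; have mc := measurable_cosT.
apply: le_integrable (integrable_oneDsqrV K) => //.
  by apply/measurable_EFinP; mfun.
move=> r _; rewrite /= lee_fin [leRHS]ger0_norm; last first.
  by rewrite divr_ge0// addr_ge0// sqr_ge0.
rewrite normrM -[leRHS]mulr1 ler_pM//.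
by rewrite ler_norml cos_geN1 cos_le1.
Qed.

Lemma cosT_mul_cos r eta :
  cosT r * cos (r * eta) = \int[leb]_x (g x * cos (r * (x - eta))).
Proof.
have -> : \int[leb]_x (g x * cos (r * (x - eta))) =
    \int[leb]_x (cos (r * eta) * (g x * cos (r * x)) + sin (r * eta) * (g x * sin (r * x))).
  by apply: eq_Rintegral => x _; rewrite mulrBr cosB; ring.
rewrite RintegralD//; last 2 first.
- by apply: integrable_scale => //; exact: integrable_bump_cos.
- by apply: integrable_scale => //; exact: integrable_bump_sin.
rewrite RintegralZl//; last exact: integrable_bump_cos.
rewrite RintegralZl//; last exact: integrable_bump_sin.
by rewrite sinT_eq0 mulr0 addr0 mulrC.
Qed.

(** The Abel factor makes the integrand in [(r, x)] absolutely integrable, with majorant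
    [g x * e^(-eps |r|)]. Fubini then allows [r] to be integrated first, which produces the Poisson
    kernel. *)
Lemma cosT_poisson (eps eta : R) : 0 < eps ->
  \int[leb]_r (expR (- (eps * `|r|)) * (cosT r * cos (r * eta))) =
  \int[leb]_x (g x * (2 * eps / (eps ^+ 2 + (x - eta) ^+ 2))).
Proof.
move=> eps0.
have mg := bump_measurable.
have ig : leb.-integrable setT (EFin \o (fun x => g x * 1)).
  by apply: integrable_bumpM => //; [exact: bump_continuous|move=> x; rewrite normr1].
pose k (r x : R) : R := expR (- (eps * `|r|)) * (g x * cos (r * (x - eta))).
have mk : measurable_fun setT (fun p : R * R => (k p.1 p.2)%:E).
  by apply/measurable_EFinP; rewrite /k; mfun; apply: (measurableT_comp mg); mfun.
have ikx r : leb.-integrable setT (EFin \o (fun x => g x * cos (r * (x - eta)))).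
  apply: integrable_bumpM => //; [exact: bump_continuous|by mfun|].
  by move=> x; rewrite ler_norml cos_geN1 cos_le1.
have ik : (leb \x leb)%E.-integrable setT (fun p : R * R => (k p.1 p.2)%:E).
  apply/(integrable12ltyP leb leb mk).
  pose G : R := \int[leb]_x (g x * 1).
  apply: (@le_lt_trans _ _ (\int[leb]_r (G * expR (- (eps * `|r|)))%R%:E)%E); last first.
    under eq_integral do rewrite EFinM.
    rewrite ge0_integralZl ?integral_exp_norm ?ltry//.
    - by apply/measurable_EFinP; mfun.
    - by rewrite lee_fin; apply: Rintegral_ge0 => x _; rewrite mulr1.
  have mabs : measurable_fun setT (fun p : R * R => `|(k p.1 p.2)%:E|%E).
    exact: measurableT_comp.
  apply: ge0_le_integral => //.
  - by move=> r _; apply: integral_ge0.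
  - exact: (measurable_integral_lebesgue (T := R) (f := fun r x => `|(k r x)%:E|%E)).
  - by apply/measurable_EFinP; mfun.
  move=> r _.
  apply: (@le_trans _ _ (\int[leb]_x ((expR (- (eps * `|r|)))%:E * (g x * 1)%R%:E))%E).
    apply: ge0_le_integral => //.
    - by apply: (measurableT_comp mabs (g := fun x => (r, x))); mfun.
    - by apply: emeasurable_funM => //; apply/measurable_EFinP; mfun.
    move=> x _; rewrite -EFinM /= lee_fin /k normrM gtr0_norm ?expR_gt0//.
    rewrite ler_pM2l ?expR_gt0// normrM; apply: ler_pM => //.
      by rewrite ger0_norm.
    by rewrite ler_norml cos_geN1 cos_le1.
  rewrite ge0_integralZl//; last 2 first.
  - by apply/measurable_EFinP; mfun.
  - by move=> x _; rewrite lee_fin mulr1.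
  have GE : (\int[leb]_x (g x * 1)%R%:E)%E = G%:E.
    by rewrite /G /Rintegral fineK//; exact: integrable_fin_num ig.
  by rewrite GE -EFinM mulrC.
have Fub := @Fubini _ _ _ _ _ leb leb _ ik.
have L r : (\int[leb]_x (k r x)%:E)%E =
    (expR (- (eps * `|r|)) * (cosT r * cos (r * eta)))%:E.
  rewrite cosT_mul_cos -RintegralZl; [|by []|exact: ikx].
  rewrite /Rintegral fineK//.
  by apply: integrable_fin_num => //; exact: integrable_scale.
have Q x : (\int[leb]_r (k r x)%:E)%E =
    (g x * (2 * eps / (eps ^+ 2 + (x - eta) ^+ 2)))%:E.
  have i1 := integrable_exp_cos (x - eta) eps0.
  rewrite -(poisson_kernel _ eps0) -(RintegralZl _ _ i1)//.
  rewrite /Rintegral fineK.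
    by apply: eq_integral => r _; rewrite /k mulrCA.
  by apply: integrable_fin_num => //; exact: integrable_scale.
rewrite /Rintegral; congr fine.
transitivity (\int[leb]_r \int[leb]_x (k r x)%:E)%E.
  by apply: eq_integral => r _; rewrite L.
transitivity (\int[leb]_x \int[leb]_r (k r x)%:E)%E; first exact: Fub.
by apply: eq_integral => x _; rewrite Q.
Qed.

(** With [x = eps w + eta], [eps] survives only inside [g], so its limit at 0 is a matter of
    continuity of [g] at [eta]. *)
Lemma poisson_rescale (eps eta : R) : 0 < eps ->
  \int[leb]_x (g x * (2 * eps / (eps ^+ 2 + (x - eta) ^+ 2))) =
  \int[leb]_w (g (eps * w + eta) * (2 / (1 + w ^+ 2))).
Proof.
move=> eps0; have mg := bump_measurable; rewrite /Rintegral; congr fine.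
have D0 (x : R) : 0 < eps ^+ 2 + (x - eta) ^+ 2.
  by rewrite ltr_wpDr ?sqr_ge0// exprn_gt0.
rewrite (@ge0_integral_affine _ _ eps eta); last 3 first.
- by rewrite gt_eqF.
- by apply/measurable_EFinP; mfun.
- by move=> x; rewrite lee_fin mulr_ge0// divr_ge0 ?mulr_ge0 ?ltW.
apply: eq_integral => w _; rewrite -EFinM; congr EFin.
have w0 : 0 < 1 + w ^+ 2 by rewrite ltr_pwDl// sqr_ge0.
rewrite addrK gtr0_norm//.
have -> : eps ^+ 2 + (eps * w) ^+ 2 = eps ^+ 2 * (1 + w ^+ 2) by ring.
by field; rewrite !gt_eqF.
Qed.

(** Along [eps = 1 / (n + 1)] both sides of the Poisson identity converge by domination: the left by
    the decay [K / (1 + r^2)], the right by [2 C / (1 + w^2)]. Comparing limits gives [2 g eta]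
    times the mass [pi] of [1 / (1 + w^2)]. *)
Lemma fourier_inversion_cos eta :
  \int[leb]_r (cosT r * cos (r * eta)) = 2 * pi * g eta.
Proof.
have mg := bump_measurable; have cg := bump_continuous; have mc := measurable_cosT.
have [K K0 cK] := cosT_decay; have [C C0 gC] := bounded_continuous_compact cg gM.
pose e n : R := n.+1%:R^-1.
have e0 n : 0 < e n by rewrite invr_gt0.
have ecvg : e n @[n --> \oo] --> (0 : R) by exact: cvg_harmonic.
pose u n : \bar R := (\int[leb]_r (expR (- (e n * `|r|)) * (cosT r * cos (r * eta)))%R%:E)%E.
pose v n : \bar R := (\int[leb]_w (g (e n * w + eta) * (2 / (1 + w ^+ 2)))%R%:E)%E.
have oneD (w : R) : 0 < 1 + w ^+ 2 by rewrite ltr_pwDl// sqr_ge0.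
have ucvg : (u n @[n --> \oo] --> \int[leb]_r (cosT r * cos (r * eta))%R%:E)%E.
  apply: (@dominated_cvg _ _ _ leb _ _
    (fun n r => (expR (- (e n * `|r|)) * (cosT r * cos (r * eta)))%R%:E) _
    (fun r => (K / (1 + r ^+ 2))%R%:E)) => //.
  - by move=> n; apply/measurable_EFinP; mfun.
  - move=> r _; apply: cvg_EFin; first exact: nearW.
    rewrite -[X in _ --> X]mul1r; apply: cvgM; last exact: cvg_cst.
    rewrite -expR0; apply: (@cvg_comp _ _ _ (fun n => - (e n * `|r|)) expR); last exact: continuous_expR.
    by rewrite -oppr0 -(mul0r `|r|); apply: cvgN; apply: cvgM => //; exact: cvg_cst.
  - exact: integrable_oneDsqrV.
  - move=> n r _; rewrite /= lee_fin normrM gtr0_norm ?expR_gt0//.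
    rewrite -[leRHS]mul1r ler_pM ?expR_ge0//.
      by rewrite -[leRHS]expR0 ler_expR oppr_le0 mulr_ge0// ltW.
    rewrite normrM -[leRHS]mulr1 ler_pM//.
    by rewrite ler_norml cos_geN1 cos_le1.
have vcvg : (v n @[n --> \oo] --> \int[leb]_w (g eta * (2 / (1 + w ^+ 2)))%R%:E)%E.
  apply: (@dominated_cvg _ _ _ leb _ _
    (fun n w => (g (e n * w + eta) * (2 / (1 + w ^+ 2)))%R%:E) _
    (fun r => (C * 2 / (1 + r ^+ 2))%R%:E)) => //.
  - by move=> n; apply/measurable_EFinP; mfun; apply: (measurableT_comp mg); mfun.
  - move=> w _; apply: cvg_EFin; first exact: nearW.
    apply: cvgM; last exact: cvg_cst.
    have ewe : e n * w + eta @[n --> \oo] --> eta.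
      rewrite -[X in _ --> X]add0r; apply: cvgD; last exact: cvg_cst.
      by rewrite -(mul0r w); apply: cvgM => //; exact: cvg_cst.
    exact: (@cvg_comp _ _ _ (fun n => e n * w + eta) g _ _ _ ewe (cg eta)).
  - exact: integrable_oneDsqrV.
  - move=> n w _; rewrite /= lee_fin normrM -mulrA ler_pM//.
    by rewrite ger0_norm// divr_ge0// ltW.
have uv : fine \o u = fine \o v.
  by apply/funext => n; rewrite /u /v /= -!/(Rintegral _ _ _) cosT_poisson// poisson_rescale.
have ic := integrable_cosT_cos eta.
have i2 : leb.-integrable setT (EFin \o (fun w => g eta * (2 / (1 + w ^+ 2)))).
  by apply: integrable_scale => //; exact: integrable_oneDsqrV.
have fu : (fine \o u) n @[n --> \oo] --> \int[leb]_r (cosT r * cos (r * eta)).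
  by apply: fine_cvg; rewrite fineK//; exact: integrable_fin_num ic.
have fv : (fine \o v) n @[n --> \oo] --> \int[leb]_w (g eta * (2 / (1 + w ^+ 2))).
  by apply: fine_cvg; rewrite fineK//; exact: integrable_fin_num i2.
rewrite uv in fu; rewrite (cvg_unique _ fu fv)//.
rewrite RintegralZl//; last exact: integrable_oneDsqrV.
rewrite RintegralZl//; last first.
  by have := integrable_oneDsqrV 1; under eq_fun do rewrite mul1r.
by rewrite {1}/Rintegral integral_oneDsqrT /= mulrC.
Qed.

End even_bump.

End fourier.

(** * The range of the angular variable *)

Section angular_integral.
Context {R : realType}.
Local Notation leb := (@lebesgue_measure R).

Lemma Rintegral_eq0 (f : R -> R) : (forall x, f x = 0) -> \int[leb]_x f x = 0.
Proof. by move=> f0; rewrite /Rintegral integral0_eq// => x _; rewrite f0. Qed.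

(** The inequality is [w^2 < (u - v) / (v + 1)]; its bound is the origin of the square root at which
    [F] is evaluated in the profile. *)
Lemma indicator_arc (v u w : R) : -1 < v ->
  ((1 + w ^+ 2) * (v + 1) < u + 1) =
  (v < u) && (`|w| < Num.sqrt ((u - v) / (v + 1))).
Proof.
move=> v1; have v10 : 0 < v + 1 by lra.
have [vu|uv] := ltP v u; last first.
  apply/negbTE; rewrite -leNgt; apply: (@le_trans _ _ (v + 1)); first by lra.
  by rewrite -[leLHS]mul1r ler_pM2r// lerDl sqr_ge0.
have q0 : 0 <= (u - v) / (v + 1) by rewrite divr_ge0 ?ltW// subr_gt0.
rewrite andTb -(@ltr_pXn2r _ 2 _ `|w|) ?nnegrE ?sqrtr_ge0 ?normr_ge0//.
rewrite sqr_sqrtr// real_normK ?num_real//.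
by rewrite ltr_pdivlMr//; apply/idP/idP; lra.
Qed.

Lemma Rintegral_symmetric (F f : R -> R) (x0 : R) : 0 < x0 ->
  continuous f -> (forall x : R, is_derive x 1 F (f x)) -> (forall x, F (- x) = - F x) ->
  \int[leb]_x ((`|x : R| < x0)%R%:R * f x) = 2 * F x0.
Proof.
move=> x00 cf dF FN.
transitivity (\int[leb]_(x in `]- x0, x0[) f x).
  rewrite [RHS]Rintegral_mkcond; apply: eq_Rintegral => x _; rewrite patchE.
  rewrite ltr_norml; case: ifPn => [/set_mem/=|]; first by rewrite in_itv/= => ->; rewrite mul1r.
  by rewrite notin_setE/= in_itv/= => /negP/negbTE ->; rewrite mul0r.
have cF : continuous F.
  by move=> x; apply/differentiable_continuous/derivable1_diffP; have := dF x; case.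
rewrite /Rintegral -(@integral_itv_bndoo _ _ _ _ true false); last first.
  by apply/measurable_EFinP/measurable_funTS; exact: continuous_measurable_fun.
rewrite (@continuous_FTC2 _ f F).
- by rewrite FN /=; ring.
- by rewrite gtrN.
- exact: continuous_subspaceT.
- split; first by move=> x _; have := dF x; case.
  + by apply: cvg_at_right_filter; exact: cF.
  + by apply: cvg_at_left_filter; exact: cF.
- by move=> x _; rewrite derive1E; apply: (@derive_val _ _ _ _ _ _ _ (dF x)).
Qed.

End angular_integral.

(** * The Siegel integral of a signed integrand *)

Section signed_siegel_integral.
Context {R : realType}.
Local Notation leb := (@lebesgue_measure R).
Variables (Phi cw sw F g : R -> R) (C M N rho a b : R) (c : R -> R -> R).
Hypothesis mPhi : measurable_fun setT Phi.
Hypothesis Phi0 : forall x, 0 <= Phi x.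
Hypothesis PhiC : forall x, Phi x <= C.
Hypothesis PhiM : forall x, M <= x -> Phi x = 0.
Hypothesis ccw : continuous cw.
Hypothesis csw : continuous sw.
Hypothesis cw1 : forall w, `|cw w| <= 1.
Hypothesis sw1 : forall w, `|sw w| <= 1.
Hypothesis swN : forall w, sw (- w) = - sw w.
Hypothesis dF : forall w : R, is_derive w 1 F (cw w / (1 + w ^+ 2)).
Hypothesis FN : forall w, F (- w) = - F w.
Hypothesis cg : continuous g.
Hypothesis gN : forall e, N <= `|e| -> g e = 0.
Hypothesis vN : forall e, N <= `|e| -> M <= v_of_eta e.
Hypothesis gE : forall e, g e = \int[leb]_(u in `]v_of_eta e, +oo[)
  (Phi u * (2 * F (Num.sqrt ((u - v_of_eta e) / (v_of_eta e + 1))))).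
Hypothesis mc : measurable_fun setT (fun p : R * R => c p.1 p.2).
Hypothesis rho0 : 0 < rho.

Lemma v_of_eta_ge0 (e : R) : 0 <= v_of_eta e.
Proof.
rewrite /v_of_eta divr_ge0// expRN.
have e0 := expR_gt0 e; rewrite (_ : _ - 2 = (expR e - 1) ^+ 2 / expR e).
  by rewrite divr_ge0 ?sqr_ge0// ltW.
by field; rewrite gt_eqF.
Qed.

Definition arc_ind (e u w : R) : R := ((1 + w ^+ 2) * (v_of_eta e + 1) < u + 1)%R%:R.

Lemma arc_eq0 (e u w : R) : u <= v_of_eta e -> arc_ind e u w = 0.
Proof.
move=> ue; rewrite /arc_ind indicator_arc; last by have := v_of_eta_ge0 e; lra.
by rewrite ltNge ue.
Qed.

Lemma arc_01 (e u w : R) : 0 <= arc_ind e u w <= 1.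
Proof. by rewrite /arc_ind ler0n lern1 leq_b1. Qed.

Lemma measurable_arc d (T : measurableType d) (f1 f2 f3 : T -> R) :
  measurable_fun setT f1 -> measurable_fun setT f2 -> measurable_fun setT f3 ->
  measurable_fun setT (fun p => arc_ind (f1 p) (f2 p) (f3 p)).
Proof. by move=> m1 m2 m3; rewrite /arc_ind /v_of_eta; mfun. Qed.

Lemma oneDsqr_gt0 (w : R) : 0 < 1 + w ^+ 2.
Proof. by rewrite ltr_pwDl// sqr_ge0. Qed.

Lemma integrable_arc e u (h : R -> R) : measurable_fun setT h -> (forall w, `|h w| <= 1) ->
  leb.-integrable setT (EFin \o (fun w => arc_ind e u w * (h w / (1 + w ^+ 2)))).
Proof.
move=> mh h1; apply: le_integrable (integrable_oneDsqrV 1) => //.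
  apply/measurable_EFinP; have ma := measurable_arc (measurable_cst e) (measurable_cst u) (@measurable_id _ R setT).
  by apply: measurable_funM => //; mfun.
move=> w _; rewrite /= lee_fin [leRHS]ger0_norm ?divr_ge0 ?(ltW (oneDsqr_gt0 w))//.
have /andP[a0 a1] := arc_01 e u w.
rewrite normrM ger0_norm// normrM (@gtr0_norm _ (_^-1)) ?invr_gt0 ?oneDsqr_gt0//.
by rewrite mulrA ler_wpM2r ?invr_ge0 ?(ltW (oneDsqr_gt0 w))// mulr_ile1.
Qed.

(** Length of the arc swept by the angle [arctan w]; it is at most [pi] and bounds every angular
    integral of a phase. *)
Definition arc_length (e u : R) : R := \int[leb]_w (arc_ind e u w * (1 / (1 + w ^+ 2))).

Lemma arc_length_ge0 e u : 0 <= arc_length e u.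
Proof.
apply: Rintegral_ge0 => w _; have /andP[a0 _] := arc_01 e u w.
by rewrite mulr_ge0// divr_ge0// ltW// oneDsqr_gt0.
Qed.

Lemma integral_arc_length e u :
  (\int[leb]_w (arc_ind e u w * (1 / (1 + w ^+ 2)))%R%:E)%E = (arc_length e u)%:E.
Proof.
rewrite /arc_length /Rintegral fineK//; apply: integrable_fin_num => //.
by apply: (@integrable_arc e u (fun=> 1)) => // w; rewrite normr1.
Qed.

Lemma arc_length_le_pi e u : arc_length e u <= pi.
Proof.
rewrite -lee_fin -integral_arc_length -integral_oneDsqrT.
have ma := measurable_arc (measurable_cst e) (measurable_cst u) (@measurable_id _ R setT).
apply: ge0_le_integral => //.
- move=> w _; rewrite lee_fin; have /andP[a0 _] := arc_01 e u w.
  by rewrite mulr_ge0// divr_ge0// ltW// oneDsqr_gt0.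
- by apply/measurable_EFinP; apply: measurable_funM => //; mfun.
- by apply/measurable_EFinP; mfun.
move=> w _; rewrite lee_fin div1r; have /andP[_ a1] := arc_01 e u w.
by rewrite ler_piMl// invr_ge0 ltW// oneDsqr_gt0.
Qed.

Lemma measurable_arc_length : measurable_fun setT (fun p : R * R => arc_length p.1 p.2).
Proof.
apply/measurable_EFinP.
rewrite (_ : EFin \o _ = fun p : R * R =>
   (\int[leb]_w (arc_ind p.1 p.2 w * (1 / (1 + w ^+ 2)))%R%:E)%E); last first.
  by apply/funext => p; rewrite integral_arc_length.
apply: (@measurable_integral_lebesgue _ _ _
  (fun (p : R * R) w => (arc_ind p.1 p.2 w * (1 / (1 + w ^+ 2)))%R%:E)).
  by apply/measurable_EFinP; apply: measurable_funM; [apply: measurable_arc|]; mfun.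
move=> p w; rewrite lee_fin; have /andP[a0 _] := arc_01 p.1 p.2 w.
by rewrite mulr_ge0// divr_ge0// ltW// oneDsqr_gt0.
Qed.

Lemma arc_length_eq0 e u : u <= v_of_eta e -> arc_length e u = 0.
Proof.
by move=> ue; apply: Rintegral_eq0 => w; rewrite arc_eq0// mul0r.
Qed.

Definition arc_cos (e u : R) : R :=
  (v_of_eta e < u)%R%:R * (2 * F (Num.sqrt ((u - v_of_eta e) / (v_of_eta e + 1)))).

Lemma Rintegral_arc_cos e u :
  \int[leb]_w (arc_ind e u w * (cw w / (1 + w ^+ 2))) = arc_cos e u.
Proof.
have v0 := v_of_eta_ge0 e; rewrite /arc_cos.
have [eu|ue] := ltP (v_of_eta e) u; last first.
  by rewrite mul0r; apply: Rintegral_eq0 => w; rewrite arc_eq0// mul0r.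
rewrite mul1r -(@Rintegral_symmetric _ F (fun w => cw w / (1 + w ^+ 2))) //.
- by apply: eq_Rintegral => w _; rewrite /arc_ind indicator_arc ?eu//; lra.
- by rewrite sqrtr_gt0 divr_gt0 ?subr_gt0//; lra.
- move=> w; apply: cvgM; first exact: ccw.
  apply: cvgV; first by rewrite gt_eqF// oneDsqr_gt0.
  by apply: cvgD; [exact: cvg_cst|exact: exprn_continuous].
Qed.

Lemma Rintegral_arc_sin e u :
  \int[leb]_w (arc_ind e u w * (sw w / (1 + w ^+ 2))) = 0.
Proof.
apply: Rintegral_odd.
  have ms : measurable_fun setT sw by exact: continuous_measurable_fun.
  have ma := measurable_arc (measurable_cst e) (measurable_cst u) (@measurable_id _ R setT).
  by apply: measurable_funM => //; mfun.
by move=> w; rewrite /arc_ind sqrrN swN mulNr mulrN.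
Qed.

Lemma norm_arc_cos e u : `|arc_cos e u| <= arc_length e u.
Proof.
have mcw : measurable_fun setT cw by exact: continuous_measurable_fun.
have i1 := integrable_arc e u mcw cw1.
rewrite -Rintegral_arc_cos (le_trans (le_normr_Rintegral _ i1))//.
apply: le_Rintegral => //.
- exact: integrable_norm.
- by apply: (@integrable_arc e u (fun=> 1)) => // w; rewrite normr1.
move=> w _; have /andP[a0 _] := arc_01 e u w.
rewrite normrM ger0_norm// normrM (@gtr0_norm _ (_^-1)) ?invr_gt0 ?oneDsqr_gt0//.
by rewrite ler_wpM2l// ler_pM2r ?invr_gt0 ?oneDsqr_gt0.
Qed.

Lemma integrable_Phi_arc e (h : R -> R) : measurable_fun setT h ->
  (forall u, `|h u| <= arc_length e u) ->
  leb.-integrable setT (EFin \o (fun u => Phi u * h u)).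
Proof.
move=> mh hl; have v0 := v_of_eta_ge0 e.
apply: (@integrable_bounded_support _ _ _ (C * pi) M) => //.
- by mfun.
- move=> u _; rewrite normrM ger0_norm// ler_pM//.
  exact: le_trans (hl u) (arc_length_le_pi e u).
- move=> u _ Mu; have [u0|u0] := leP 0 u.
    by rewrite PhiM ?mul0r// -(ger0_norm u0) ltW.
  (* [PhiM] controls [Phi] only on the right. On the left the arc is empty, since
     [u < 0 <= v_of_eta e]. *)
  have /eqP : `|h u| = 0.
    apply/eqP; rewrite eq_le normr_ge0 andbT -(@arc_length_eq0 e u)//.
    exact: le_trans (ltW u0) v0.
  by rewrite normr_eq0 => /eqP ->; rewrite mulr0.
Qed.

(** The contribution of the constant 1 added to the amplitude. *)
Definition arc_mass (e : R) : R := \int[leb]_u (Phi u * arc_length e u).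

Lemma integrable_Phi_arc_length e :
  leb.-integrable setT (EFin \o (fun u => Phi u * arc_length e u)).
Proof.
apply: (@integrable_Phi_arc e).
  by apply: (measurableT_comp measurable_arc_length (g := fun u => (e, u))); mfun.
by move=> u; rewrite ger0_norm// arc_length_ge0.
Qed.

Lemma integrable_Phi_arc_cos e :
  leb.-integrable setT (EFin \o (fun u => Phi u * arc_cos e u)).
Proof.
apply: (@integrable_Phi_arc e); last exact: norm_arc_cos.
have mF : measurable_fun setT F.
  apply: continuous_measurable_fun => x.
  by apply/differentiable_continuous/derivable1_diffP; have := dF x; case.
rewrite /arc_cos; apply: measurable_funM; first by mfun.
by apply: measurable_funM; [mfun|apply: (measurableT_comp mF); mfun].
Qed.

Lemma Rintegral_Phi_arc_cos e : \int[leb]_u (Phi u * arc_cos e u) = g e.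
Proof.
rewrite gE [RHS]Rintegral_mkcond; apply: eq_Rintegral => u _; rewrite patchE /arc_cos.
case: ifPn => [/set_mem/=|]; first by rewrite in_itv/= andbT => ->; rewrite mul1r.
rewrite notin_setE/= in_itv/= andbT => /negP/negbTE ->.
by rewrite mul0r mulr0.
Qed.

Lemma integral_arc_mass e :
  (\int[leb]_u (Phi u * arc_length e u)%R%:E)%E = (arc_mass e)%:E.
Proof.
rewrite /arc_mass /Rintegral fineK//.
by apply: integrable_fin_num => //; exact: integrable_Phi_arc_length.
Qed.

(** Arcs are empty for [u <= 0], so the integral of [pi * Phi] over [u > 0] is a uniform bound. For
    [|e| >= N] one has [v_of_eta e >= M], and then either [Phi] or the arc vanishes. *)
Lemma integrable_arc_mass : leb.-integrable setT (EFin \o arc_mass).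
Proof.
have i0 : leb.-integrable setT (EFin \o (fun u => (0 < u)%R%:R * (Phi u * pi))).
  apply: (@integrable_bounded_support _ _ _ (C * pi) M) => //.
  - by mfun.
  - move=> u _; rewrite normrM normr_nat; have [_|_] := ltP 0 u.
      rewrite mul1r ger0_norm ?mulr_ge0 ?pi_ge0// ler_wpM2r ?pi_ge0//.
    by rewrite mul0r mulr_ge0 ?pi_ge0// (le_trans (Phi0 0)).
  - move=> u _ Mu; have [u0|u0] := ltP 0 u; last by rewrite mul0r.
    by rewrite PhiM ?mul0r ?mulr0// -(gtr0_norm u0) ltW.
apply: (@integrable_bounded_support _ _ _ (\int[leb]_u ((0 < u)%R%:R * (Phi u * pi))) N) => //.
- apply/measurable_EFinP.
  rewrite (_ : EFin \o _ = fun e =>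
     (\int[leb]_u (Phi u * arc_length e u)%R%:E)%E); last first.
    by apply/funext => e; rewrite integral_arc_mass.
  apply: (measurable_integral_lebesgue (T := R)
    (f := fun e u => (Phi u * arc_length e u)%R%:E)).
    apply/measurable_EFinP; apply: measurable_funM; last exact: measurable_arc_length.
    by apply: (measurableT_comp mPhi); mfun.
  by move=> e u; rewrite lee_fin mulr_ge0// arc_length_ge0.
- move=> e _; rewrite ger0_norm; last first.
    by apply: Rintegral_ge0 => u _; rewrite mulr_ge0// arc_length_ge0.
  apply: le_Rintegral => //; first exact: integrable_Phi_arc_length.
  move=> u _; have [u0|u0] := ltP 0 u.
    by rewrite mul1r ler_wpM2l// arc_length_le_pi.
  by rewrite mul0r arc_length_eq0 ?mulr0// (le_trans u0)// v_of_eta_ge0.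
- move=> e _ /ltW Ne; apply: Rintegral_eq0 => u; have [Mu|uM] := leP M u; first by rewrite PhiM// mul0r.
  by rewrite arc_length_eq0 ?mulr0// (le_trans (ltW uM))// vN.
Qed.

Section amplitude.
Variables A B : R -> R.
Hypothesis mA : measurable_fun setT A.
Hypothesis mB : measurable_fun setT B.
Hypothesis A1 : forall t, `|A t| <= 1.
Hypothesis AB1 : forall t w, `|A t * cw w + B t * sw w| <= 1.

(** Common form of the real and imaginary parts of [(cw w + i sw w) e^(i r ln t)], with [(A, B)]
    equal to [(cos, - sin)] and [(sin, cos)] of [r ln t] respectively. *)
Definition amplitude t w := A t * cw w + B t * sw w.

Lemma integrable_amplitude_bump :
  leb.-integrable setT (EFin \o (fun e => g e * A (rho * expR e))).
Proof.
apply: (@integrable_bumpM _ N g) => //.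
by apply: (measurableT_comp mA); mfun.
Qed.

Lemma measurable_amplitude :
  measurable_fun setT (fun p : R * R => amplitude p.1 p.2).
Proof.
have mcw : measurable_fun setT cw by exact: continuous_measurable_fun.
have msw : measurable_fun setT sw by exact: continuous_measurable_fun.
rewrite /amplitude; apply: measurable_funD; apply: measurable_funM;
  [apply: (measurableT_comp mA)|apply: (measurableT_comp mcw)
  |apply: (measurableT_comp mB)|apply: (measurableT_comp msw)]; mfun.
Qed.

(* the shift by [1] makes the integrand nonnegative, as Tonelli's theorem requires;
   its contribution [arc_mass] is finite and is subtracted in the end *)
Let kp (t w : R) : R := 1 + amplitude t w.

Let kp0 t w : 0 <= kp t w.
Proof. by have := AB1 t w; rewrite /kp /amplitude ler_norml; lra. Qed.

Let mkp : measurable_fun setT (fun p : R * R => kp p.1 p.2).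
Proof. by have := measurable_amplitude; rewrite /kp => m; mfun. Qed.

(** The arc is symmetric in [w] and [sw] is odd, so [B] disappears; the 1 gives [arc_length] and the
    even part gives [arc_cos]. *)
Lemma angular_integral_amplitude e u :
  (\int[leb]_w (siegel_kernel Phi kp rho e u w)%:E)%E =
  (2 * pi * rho * (Phi u * arc_length e u + A (rho * expR e) * (Phi u * arc_cos e u)))%:E.
Proof.
have mcw : measurable_fun setT cw by exact: continuous_measurable_fun.
have msw : measurable_fun setT sw by exact: continuous_measurable_fun.
set t := rho * expR e.
have i1 : leb.-integrable setT (EFin \o (fun w => arc_ind e u w * (1 / (1 + w ^+ 2)))).
  by apply: (@integrable_arc e u (fun=> 1)) => // w; rewrite normr1.
have ic := integrable_arc e u mcw cw1.
have is_ := integrable_arc e u msw sw1.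
have iA := integrable_scale (A t) measurableT ic.
have iB := integrable_scale (B t) measurableT is_.
have E w : siegel_kernel Phi kp rho e u w = 2 * pi * rho * Phi u *
   ((arc_ind e u w * (1 / (1 + w ^+ 2)) + A t * (arc_ind e u w * (cw w / (1 + w ^+ 2)))) +
     B t * (arc_ind e u w * (sw w / (1 + w ^+ 2)))).
  by rewrite /siegel_kernel -/(arc_ind e u w) /kp /amplitude -/t; ring.
have i12 : leb.-integrable setT (EFin \o (fun w =>
    arc_ind e u w * (1 / (1 + w ^+ 2)) + A t * (arc_ind e u w * (cw w / (1 + w ^+ 2))))).
  exact: (integrableD measurableT i1 iA).
have i123 : leb.-integrable setT (EFin \o (fun w =>
    (arc_ind e u w * (1 / (1 + w ^+ 2)) + A t * (arc_ind e u w * (cw w / (1 + w ^+ 2)))) +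
     B t * (arc_ind e u w * (sw w / (1 + w ^+ 2))))).
  exact: (integrableD measurableT i12 iB).
have i := integrable_scale (2 * pi * rho * Phi u) measurableT i123.
transitivity (\int[leb]_w (2 * pi * rho * Phi u *
   ((arc_ind e u w * (1 / (1 + w ^+ 2)) + A t * (arc_ind e u w * (cw w / (1 + w ^+ 2)))) +
     B t * (arc_ind e u w * (sw w / (1 + w ^+ 2))))))%:E.
  rewrite /Rintegral fineK; last exact: integrable_fin_num i.
  by apply: eq_integral => w _; rewrite E.
congr EFin; rewrite RintegralZl// RintegralD// RintegralD// RintegralZl// RintegralZl//.
by rewrite Rintegral_arc_cos Rintegral_arc_sin -/(arc_length e u); ring.
Qed.

Lemma radial_integral_amplitude e :
  (\int[leb]_u \int[leb]_w (siegel_kernel Phi kp rho e u w)%:E)%E =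
  (2 * pi * rho * (arc_mass e + g e * A (rho * expR e)))%:E.
Proof.
set t := rho * expR e.
have i1 := integrable_Phi_arc_length e.
have i2 := integrable_scale (A t) measurableT (integrable_Phi_arc_cos e).
have i12 : leb.-integrable setT (EFin \o (fun u =>
   Phi u * arc_length e u + A t * (Phi u * arc_cos e u))).
  exact: (integrableD measurableT i1 i2).
have i := integrable_scale (2 * pi * rho) measurableT i12.
transitivity (\int[leb]_u (2 * pi * rho *
    (Phi u * arc_length e u + A t * (Phi u * arc_cos e u))))%:E.
  rewrite /Rintegral fineK; last exact: integrable_fin_num i.
  by apply: eq_integral => u _; exact: angular_integral_amplitude.
congr EFin; rewrite RintegralZl// RintegralD// RintegralZl//; last exact: integrable_Phi_arc_cos.
by rewrite Rintegral_Phi_arc_cos /arc_mass [A t * _]mulrC.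
Qed.

Lemma siegel_integral_shifted_amplitude :
  (\int[(leb \x leb) \x leb \x leb]_p
     (siegel_integrand Phi kp c rho a b p.1.1.1 p.1.1.2 p.1.2 p.2)%:E)%E =
  (2 * pi * rho * (\int[leb]_e arc_mass e + \int[leb]_e (g e * A (rho * expR e))))%:E.
Proof.
rewrite siegel_integral_ge0//.
have i1 := integrable_arc_mass; have i2 := integrable_amplitude_bump.
have i12 : leb.-integrable setT (EFin \o (fun e => arc_mass e + g e * A (rho * expR e))).
  exact: (integrableD measurableT i1 i2).
have i := integrable_scale (2 * pi * rho) measurableT i12.
transitivity (\int[leb]_e (2 * pi * rho * (arc_mass e + g e * A (rho * expR e))))%:E.
  rewrite /Rintegral fineK; last exact: integrable_fin_num i.
  by apply: eq_integral => u _; exact: radial_integral_amplitude.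
by congr EFin; rewrite RintegralZl// RintegralD.
Qed.

Lemma integrable_shifted_amplitude :
  ((leb \x leb) \x leb \x leb)%E.-integrable setT (EFin \o (fun p : R * R * R * R =>
     siegel_integrand Phi kp c rho a b p.1.1.1 p.1.1.2 p.1.2 p.2)).
Proof.
apply/integrableP; split.
  by apply/measurable_EFinP; exact: measurable_siegel_integrand.
rewrite (_ : (fun p => _) = fun p : R * R * R * R =>
   (siegel_integrand Phi kp c rho a b p.1.1.1 p.1.1.2 p.1.2 p.2)%:E).
  by rewrite siegel_integral_shifted_amplitude ltry.
by apply/funext => p; rewrite /= ger0_norm// siegel_integrand_ge0.
Qed.

End amplitude.

Lemma siegel_integral_amplitude (A B : R -> R) :
  measurable_fun setT A -> measurable_fun setT B -> (forall t, `|A t| <= 1) ->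
  (forall t w, `|A t * cw w + B t * sw w| <= 1) ->
  \int[((leb \x leb) \x leb \x leb)%E]_p
     (siegel_integrand Phi (amplitude A B) c rho a b p.1.1.1 p.1.1.2 p.1.2 p.2) =
  2 * pi * rho * \int[leb]_e (g e * A (rho * expR e)).
Proof.
move=> mA mB A1 AB1.
(* With zero coefficients the shifted integral is exactly the [arc_mass] term, so a difference of
   two shifted integrals recovers the signed one. *)
pose Z : R -> R := fun=> 0.
have Z1 t : `|Z t| <= 1 by rewrite normr0.
have ZZ1 t w : `|Z t * cw w + Z t * sw w| <= 1 by rewrite !mul0r addr0 normr0.
have mZ : measurable_fun setT Z by exact: measurable_cst.
have i1 := integrable_shifted_amplitude mA mB A1 AB1.
have i2 := integrable_shifted_amplitude mZ mZ Z1 ZZ1.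
transitivity (\int[((leb \x leb) \x leb \x leb)%E]_p
   (siegel_integrand Phi (fun t w => 1 + amplitude A B t w) c rho a b p.1.1.1 p.1.1.2 p.1.2 p.2 -
    siegel_integrand Phi (fun t w => 1 + amplitude Z Z t w) c rho a b p.1.1.1 p.1.1.2 p.1.2 p.2)).
  apply: eq_Rintegral => p _; rewrite /siegel_integrand -mulrBr; congr (_ * _).
  by rewrite /sgH -mulrBr; congr (_ * _); rewrite /amplitude /Z; ring.
rewrite RintegralB//.
have E1 := siegel_integral_shifted_amplitude mA mB A1 AB1.
have E2 := siegel_integral_shifted_amplitude mZ mZ Z1 ZZ1.
rewrite {1 2}/Rintegral E1 E2 /=.
have -> : \int[leb]_e (g e * Z (rho * expR e)) = 0.
  by apply: Rintegral_eq0 => e; rewrite mulr0.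
by ring.
Qed.

End signed_siegel_integral.

(** * The profiles as Abel transforms, and their inversion *)

Section abel_profile.
Context {R : realType}.
Local Notation leb := (@lebesgue_measure R).

Lemma is_derive_powR_shift (p x : R) : -1 < x ->
  is_derive x 1 (fun y => (y + 1) `^ p) (p * (x + 1) `^ (p - 1)).
Proof.
move=> x1; have x10 : 0 < x + 1 by lra.
have dsh : is_derive x 1 (fun y : R => y + 1) 1.
  by apply: is_derive_eq; rewrite addr0.
have := @is_derive1_comp _ (fun y : R => y `^ p) (fun y => y + 1) x _ _ (is_derive1_powR p x10) dsh.
by rewrite mulr1.
Qed.

Lemma is_derive_continuous (f : R -> R) (x df : R) : is_derive x 1 f df ->
  {for x, continuous f}.
Proof. by case=> d _; apply/differentiable_continuous/derivable1_diffP. Qed.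

(** [P1] and [Q0] are identified with Abel transforms only to the right of -1; a derivative sees no
    more than a neighbourhood of the point. *)
Lemma near_gt_is_derive (f h : R -> R) (a x df : R) : a < x ->
  (forall y, a < y -> f y = h y) -> is_derive x 1 h df -> is_derive x 1 f df.
Proof.
move=> ax fh; apply: near_eq_is_derive; near=> y; apply/esym/fh.
by near: y; exact: lt_nbhsr.
Unshelve. all: by end_near. Qed.

Lemma near_gt_derive1 (f h : R -> R) (a x df : R) : a < x ->
  (forall y, a < y -> f y = h y) -> is_derive x 1 h df -> f^`() x = df.
Proof.
move=> ax fh dh; rewrite derive1E.
by apply: (@derive_val _ _ _ _ _ _ _ (near_gt_is_derive ax fh dh)).
Qed.

Lemma derive1_eq0_ray (f : R -> R) (a x : R) : a < x ->
  (forall y, a < y -> f y = 0) -> f^`() x = 0.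
Proof. by move=> ax f0; apply: (near_gt_derive1 ax f0 (is_derive_cst 0 x 1)). Qed.

Lemma compact_support_bounded (Phi : R -> R) : compact (closure [set x | Phi x != 0]) ->
  exists2 M : R, 0 <= M & forall x, M < `|x| -> Phi x = 0.
Proof.
move=> /compact_bounded [M0 [M0r bM]]; exists (`|M0| + 1); first exact: addr_ge0.
move=> x Mx; apply/eqP/negPn/negP => Px.
have : `|x| <= `|M0| + 1.
  apply: bM; last by apply: subset_closure.
  by rewrite (le_lt_trans (ler_norm _))// ltrDl.
by rewrite leNgt Mx.
Qed.

Lemma C2c_support (Phi : R -> R) : C2c Phi ->
  exists2 M, 0 <= M & (forall x, M <= `|x| -> Phi x = 0) /\
    (forall x, M <= x -> [/\ Phi x = 0, Phi^`() x = 0 & Phi^`()^`() x = 0]).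
Proof.
move=> [_ [_ [_ /compact_support_bounded [M M0 PhiN]]]].
have PhiM x : M < x -> Phi x = 0.
  by move=> Mx; apply: PhiN; exact: lt_le_trans Mx (ler_norm x).
have Phi1M x : M < x -> Phi^`() x = 0 by move=> Mx; exact: derive1_eq0_ray Mx PhiM.
have Phi2M x : M < x -> Phi^`()^`() x = 0 by move=> Mx; exact: derive1_eq0_ray Mx Phi1M.
(* The derivatives are known to vanish strictly beyond [M]; enlarging the bound makes the inequality
   non-strict. *)
exists (M + 1); first exact: addr_ge0.
split=> x Mx; first by apply: PhiN; rewrite (lt_le_trans _ Mx)// ltrDl.
have Mx' : M < x by lra.
by split; [exact: PhiM|exact: Phi1M|exact: Phi2M].
Qed.

Lemma Rintegral_ray (v : R) (f : R -> R) : measurable_fun setT f ->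
  (forall u, v < u -> 0 <= f u) ->
  \int[leb]_(u in `]v, +oo[) f u = \int[leb]_(x in `]0, +oo[) f (v + x).
Proof.
move=> mf f0; rewrite /Rintegral !integral_gt; congr fine.
pose Q w := ((0 < w)%R%:R * f (v + w))%:E.
have mQ : measurable_fun setT Q.
  by apply/measurable_EFinP; mfun; apply: (measurableT_comp mf); mfun.
have Q0 w : (0 <= Q w)%E.
  rewrite lee_fin; have [w0|w0] := ltP 0 w; last by rewrite mul0r.
  by rewrite mul1r f0// ltrDl.
transitivity (\int[leb]_u Q (u - v)%R)%E.
  by apply: eq_integral => u _; rewrite /Q -EFinM subr_gt0 addrC subrK.
by rewrite (@integral_shift _ Q).
Qed.

Lemma is_derive_expRN (e : R) : is_derive e 1 (fun x : R => expR (- x)) (- expR (- e)).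
Proof.
have := @is_derive1_comp _ expR -%R e _ _ (is_derive_expR (- e)) (is_deriveNid e 1).
by rewrite mulrN1.
Qed.

Section profile.
Variables (Phi Phi1 Phi2 : R -> R) (M p : R).
Hypothesis dPhi : forall x : R, is_derive x 1 Phi (Phi1 x).
Hypothesis dPhi1 : forall x : R, is_derive x 1 Phi1 (Phi2 x).
Hypothesis cPhi2 : continuous Phi2.
Hypothesis PhiM : forall x, M <= x -> Phi x = 0.
Hypothesis Phi1M : forall x, M <= x -> Phi1 x = 0.
Hypothesis Phi2M : forall x, M <= x -> Phi2 x = 0.
Hypothesis Phi0 : forall x, 0 <= Phi x.

Definition psi (x : R) : R := Phi x * (x + 1) `^ p.
Definition psi1 (x : R) : R :=
  Phi1 x * (x + 1) `^ p + Phi x * (p * (x + 1) `^ (p - 1)).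
Definition psi2 (x : R) : R := Phi2 x * (x + 1) `^ p +
  2 * Phi1 x * (p * (x + 1) `^ (p - 1)) +
  Phi x * (p * ((p - 1) * (x + 1) `^ (p - 1 - 1))).

Lemma is_derive_psi (x : R) : -1 < x -> is_derive x 1 psi (psi1 x).
Proof.
move=> x1; have d0 := dPhi x; have dq := is_derive_powR_shift p x1.
by rewrite /psi /psi1; apply: is_derive_eq; rewrite /GRing.scale/=; ring.
Qed.

Lemma is_derive_psi1 (x : R) : -1 < x -> is_derive x 1 psi1 (psi2 x).
Proof.
move=> x1; have d0 := dPhi x; have d1 := dPhi1 x.
have dq := is_derive_powR_shift p x1; have dq1 := is_derive_powR_shift (p - 1) x1.
by rewrite /psi1 /psi2; apply: is_derive_eq; rewrite /GRing.scale/=; ring.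
Qed.

Lemma cont_psi : cont_on_halfline (-1) M psi.
Proof.
split=> x; last by move=> Mx; rewrite /psi PhiM// mul0r.
by move=> x1; exact: is_derive_continuous (is_derive_psi x1).
Qed.

Lemma psi1M x : M <= x -> psi1 x = 0.
Proof. by move=> Mx; rewrite /psi1 PhiM// Phi1M// !mul0r addr0. Qed.

Lemma cont_psi1 : cont_on_halfline (-1) M psi1.
Proof.
split=> x; last exact: psi1M.
by move=> x1; exact: is_derive_continuous (is_derive_psi1 x1).
Qed.

Lemma cont_psi2 : cont_on_halfline (-1) M psi2.
Proof.
split=> x; last by move=> Mx; rewrite /psi2 PhiM// Phi1M// Phi2M// mulr0 !mul0r !addr0.
move=> x1.
have cq := is_derive_continuous (is_derive_powR_shift p x1).
have cq1 := is_derive_continuous (is_derive_powR_shift (p - 1) x1).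
have cq2 := is_derive_continuous (is_derive_powR_shift (p - 1 - 1) x1).
have c0 := is_derive_continuous (dPhi x); have c1 := is_derive_continuous (dPhi1 x).
rewrite /psi2; apply: cvgD; first apply: cvgD.
- by apply: cvgM; [exact: cPhi2|exact: cq].
- apply: cvgM; first by apply: cvgM; [exact: cvg_cst|exact: c1].
  by apply: cvgM; [exact: cvg_cst|exact: cq1].
- apply: cvgM; first exact: c0.
  by apply: cvgM; [exact: cvg_cst|apply: cvgM; [exact: cvg_cst|exact: cq2]].
Qed.

Lemma abelT_eq0 (h : R -> R) v : (forall x, M <= x -> h x = 0) -> M <= v -> abelT h v = 0.
Proof.
move=> hM Mv; rewrite /abelT /Rintegral integral0_eq// => x /=.
rewrite in_itv/= andbT => x0; rewrite hM ?mul0r//; apply: le_trans Mv _.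
by rewrite lerDl ltW.
Qed.

Lemma abelT_psi_ge0 v : 0 <= abelT psi v.
Proof.
by apply: Rintegral_ge0 => x _; rewrite mulr_ge0 ?sqrtr_ge0// mulr_ge0// powR_ge0.
Qed.

Lemma is_derive_abel_psi (v : R) : -1 < v -> is_derive v 1 (abelT psi) (abelT psi1 v).
Proof.
by apply: is_derive_abel; [exact: cont_psi1|exact: is_derive_psi|exact: cont_psi.2].
Qed.

Lemma is_derive_abel_psi1 (v : R) : -1 < v -> is_derive v 1 (abelT psi1) (abelT psi2 v).
Proof.
by apply: is_derive_abel; [exact: cont_psi2|exact: is_derive_psi1|exact: psi1M].
Qed.

(** The second derivative of [T] is the Abel transform of [2 * psi2], and inversion returns
    [pi / 2 * (2 * psi u)]; hence the constant [pi^-1]. *)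
Lemma profile_inversion (T : R -> R) (u : R) : (forall v, -1 < v -> T v = 2 * abelT psi v) ->
  -1 < u ->
  psi u = pi^-1 * \int[leb]_(v in `]u, +oo[) (derive1 (derive1 T) v / Num.sqrt (v - u)).
Proof.
move=> TE u1.
have d1 v : -1 < v -> derive1 T v = 2 * abelT psi1 v.
  move=> v1; apply: (near_gt_derive1 v1 TE); have da := is_derive_abel_psi v1.
  by apply: is_derive_eq; rewrite /GRing.scale/= ?mulr0 ?addr0.
have d2 v : -1 < v -> derive1 (derive1 T) v = 2 * abelT psi2 v.
  move=> v1; apply: (near_gt_derive1 v1 d1); have da := is_derive_abel_psi1 v1.
  by apply: is_derive_eq; rewrite /GRing.scale/= ?mulr0 ?addr0.
have c2 : cont_on_halfline (-1) M (fun x => 2 * psi2 x).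
  split=> x; last by move=> Mx; rewrite cont_psi2.2// mulr0.
  by move=> x1; apply: cvgM; [exact: cvg_cst|exact: cont_psi2.1].
transitivity (pi^-1 * \int[leb]_(v in `]u, +oo[)
   (abelT (fun x => 2 * psi2 x) v / Num.sqrt (v - u))).
  have e0 (x : R) : -1 < x -> is_derive x 1 (fun x => 2 * psi x) (2 * psi1 x).
    move=> x1; have dp := is_derive_psi x1.
    by apply: is_derive_eq; rewrite /GRing.scale/= ?mulr0 ?addr0.
  have e1 (x : R) : -1 < x -> is_derive x 1 (fun x => 2 * psi1 x) (2 * psi2 x).
    move=> x1; have dp := is_derive_psi1 x1.
    by apply: is_derive_eq; rewrite /GRing.scale/= ?mulr0 ?addr0.
  have z0 x : M <= x -> 2 * psi x = 0 by move=> Mx; rewrite cont_psi.2// mulr0.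
  have z1 x : M <= x -> 2 * psi1 x = 0 by move=> Mx; rewrite psi1M// mulr0.
  rewrite (abel_inversion c2 u1) (moment_second_derivative c2 e0 e1 z0 z1 u1).
  have pi0 : (pi : R) != 0 by rewrite gt_eqF// pi_gt0.
  by rewrite [pi / 2 * _]mulrA divfK// mulKf.
congr (_ * _); apply: eq_Rintegral => v /set_mem/=; rewrite in_itv/= andbT => uv.
have v1 : -1 < v by exact: lt_trans uv.
rewrite d2//; congr (_ / _); rewrite /abelT -RintegralZl//.
  by apply: eq_Rintegral => x _; rewrite mulrA.
exact: (abel_integrable cont_psi2 v1).
Qed.

Lemma P1_abel v : p = -1 -> -1 < v -> P1 Phi v = Num.sqrt (v + 1) * (2 * abelT psi v).
Proof.
move=> p1 v1; have v10 : 0 < v + 1 by lra.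
have mPhi : measurable_fun setT Phi.
  by apply: continuous_measurable_fun => x; exact: is_derive_continuous (dPhi x).
rewrite /P1 Rintegral_ray; last 2 first.
- by mfun.
- move=> u vu; rewrite mulr_ge0 ?sqrtr_ge0// divr_ge0 ?mulr_ge0//; lra.
rewrite mulrA /abelT -RintegralZl//; last exact: (abel_integrable cont_psi v1).
apply: eq_Rintegral => x /set_mem/=; rewrite in_itv/= andbT => x0.
rewrite [v + x - v]addrC addKr /psi p1 powR_inv1; last by lra.
by rewrite sqrtrM ?(ltW v10)//; ring.
Qed.

Lemma Q0_abel v : p = - 2^-1 -> -1 < v -> Q0 Phi v = 2 * abelT psi v.
Proof.
move=> p1 v1; have v10 : 0 < v + 1 by lra.
have mPhi : measurable_fun setT Phi.
  by apply: continuous_measurable_fun => x; exact: is_derive_continuous (dPhi x).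
rewrite /Q0 Rintegral_ray; last 2 first.
- by mfun.
- by move=> u vu; rewrite mulr_ge0 ?sqrtr_ge0.
congr (_ * _); apply: eq_Rintegral => x /set_mem/=; rewrite in_itv/= andbT => x0.
have X0 : 0 <= v + x + 1 by lra.
rewrite [v + x - v]addrC addKr /psi p1 powRN powR12_sqrt//.
by rewrite sqrtrM ?(ltW x0)// sqrtrV//; ring.
Qed.

Section even_profile.
Variables (k k1 k2 : R -> R).
Hypothesis dk : forall x : R, is_derive x 1 k (k1 x).
Hypothesis dk1 : forall x : R, is_derive x 1 k1 (k2 x).
Hypothesis ck2 : continuous k2.

Definition dv_of_eta (e : R) : R := (expR e - expR (- e)) / 4.
Definition ddv_of_eta (e : R) : R := (expR e + expR (- e)) / 4.

Lemma is_derive_v_of_eta (e : R) : is_derive e 1 (@v_of_eta R) (dv_of_eta e).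
Proof.
have d := is_derive_expRN e; rewrite /v_of_eta /dv_of_eta.
by apply: is_derive_eq; rewrite /GRing.scale/=; ring.
Qed.

Lemma is_derive_dv_of_eta (e : R) : is_derive e 1 dv_of_eta (ddv_of_eta e).
Proof.
have d := is_derive_expRN e; rewrite /dv_of_eta /ddv_of_eta.
by apply: is_derive_eq; rewrite /GRing.scale/=; ring.
Qed.

Lemma v_of_eta_gtN1 (e : R) : -1 < v_of_eta e.
Proof. by have := v_of_eta_ge0 e; lra. Qed.

Lemma v_of_etaN (e : R) : v_of_eta (- e) = v_of_eta e.
Proof. by rewrite /v_of_eta opprK [expR (- e) + _]addrC. Qed.

(** A linear bound from [expR x >= 1 + x] is enough to push [v_of_eta e] beyond the support of
    [Phi]. *)
Lemma v_of_eta_ge (e : R) : (`|e| - 1) / 4 <= v_of_eta e.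
Proof.
wlog e0 : e / 0 <= e => [h|].
  have [e0|/ltW e0] := leP 0 e; first exact: h.
  by rewrite -normrN -v_of_etaN h// oppr_ge0.
rewrite ger0_norm// /v_of_eta ler_pM2r//.
by have := expR_ge1Dx e; have := expR_ge0 (- e); lra.
Qed.

(** Treats both profiles at once: [k] is [sqrt (v + 1)] as a function of [eta] for [P1], and the
    constant 1 for [Q0]. *)
Definition prof (e : R) : R := k e * (2 * abelT psi (v_of_eta e)).
Definition prof1 (e : R) : R := k1 e * (2 * abelT psi (v_of_eta e)) +
  k e * (2 * (abelT psi1 (v_of_eta e) * dv_of_eta e)).
Definition prof2 (e : R) : R := k2 e * (2 * abelT psi (v_of_eta e)) +
  2 * k1 e * (2 * (abelT psi1 (v_of_eta e) * dv_of_eta e)) +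
  k e * (2 * (abelT psi2 (v_of_eta e) * dv_of_eta e ^+ 2 +
              abelT psi1 (v_of_eta e) * ddv_of_eta e)).

Let dS (e : R) : is_derive e 1 (fun e => abelT psi (v_of_eta e))
  (abelT psi1 (v_of_eta e) * dv_of_eta e).
Proof.
exact: (is_derive1_comp (is_derive_abel_psi (v_of_eta_gtN1 e)) (is_derive_v_of_eta e)).
Qed.

Let dS1 (e : R) : is_derive e 1 (fun e => abelT psi1 (v_of_eta e))
  (abelT psi2 (v_of_eta e) * dv_of_eta e).
Proof.
exact: (is_derive1_comp (is_derive_abel_psi1 (v_of_eta_gtN1 e)) (is_derive_v_of_eta e)).
Qed.

Lemma is_derive_prof (e : R) : is_derive e 1 prof (prof1 e).
Proof.
have d1 := dk e; have d2 := dS e; rewrite /prof /prof1.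
by apply: is_derive_eq; rewrite /GRing.scale/=; ring.
Qed.

Lemma is_derive_prof1 (e : R) : is_derive e 1 prof1 (prof2 e).
Proof.
have d1 := dk e; have d1' := dk1 e; have d2 := dS e; have d3 := dS1 e.
have d4 := is_derive_dv_of_eta e; rewrite /prof1 /prof2.
by apply: is_derive_eq; rewrite /GRing.scale/=; ring.
Qed.

Lemma continuous_prof2 : continuous prof2.
Proof.
move=> e.
have c0 := is_derive_continuous (dk e); have c1 := is_derive_continuous (dk1 e).
have c2 := ck2 (x := e).
have s0 := is_derive_continuous (dS e); have s1 := is_derive_continuous (dS1 e).
have cv := is_derive_continuous (is_derive_v_of_eta e).
have cdv := is_derive_continuous (is_derive_dv_of_eta e).
have cddv : {for e, continuous ddv_of_eta}.
  apply: cvgM; last exact: cvg_cst.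
  by apply: cvgD; [exact: continuous_expR|exact: is_derive_continuous (is_derive_expRN e)].
have s2 : {for e, continuous (fun e => abelT psi2 (v_of_eta e))}.
  apply: (@continuous_comp _ _ _ (@v_of_eta R) (abelT psi2)); first exact: cv.
  exact: continuous_abel cont_psi2 (v_of_eta_gtN1 e).
have cst2 : {for e, continuous (fun=> 2 : R)} by exact: cvg_cst.
rewrite /prof2; apply: cvgD; first apply: cvgD.
- by apply: cvgM; [exact: c2|apply: cvgM; [exact: cst2|exact: s0]].
- apply: cvgM; first by apply: cvgM; [exact: cst2|exact: c1].
  by apply: cvgM; [exact: cst2|apply: cvgM; [exact: s1|exact: cdv]].
- apply: cvgM; first exact: c0.
  apply: cvgM; first exact: cst2.
  apply: cvgD; last by apply: cvgM; [exact: s1|exact: cddv].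
  apply: cvgM; first exact: s2.
  by rewrite expr2; apply: cvgM; exact: cdv.
Qed.

(** Chosen so that [(N - 1) / 4 = M] in the linear lower bound for [v_of_eta]. *)
Let N : R := 4 * M + 1.

Lemma v_of_eta_ge_support e : N <= `|e| -> M <= v_of_eta e.
Proof. by move=> Ne; apply: le_trans (v_of_eta_ge e); rewrite /N in Ne; lra. Qed.

Lemma prof_eq0 e : N <= `|e| -> [/\ prof e = 0, prof1 e = 0 & prof2 e = 0].
Proof.
move=> /v_of_eta_ge_support Mv; rewrite /prof /prof1 /prof2.
have -> := abelT_eq0 cont_psi.2 Mv; have -> := abelT_eq0 cont_psi1.2 Mv.
have -> := abelT_eq0 cont_psi2.2 Mv.
by split; ring.
Qed.

End even_profile.
End profile.
End abel_profile.

Local Open Scope complex_scope.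

(** * The phases for k = 1/2 and k = 1 *)

Section angular_functions.
Context {R : realType}.

Lemma is_derive_inv (f : R -> R) (x df : R) : is_derive x 1 f df -> f x != 0 ->
  is_derive x 1 (fun y => (f y)^-1) (- df / f x ^+ 2).
Proof.
move=> [dfx <-] fx0; apply: DeriveDef; first exact: derivableV.
by rewrite deriveV// /GRing.scale/= mulNr mulNr mulrC.
Qed.

Lemma is_derive_oneDsqr (w : R) : is_derive w 1 (fun w : R => 1 + w ^+ 2) (2 * w).
Proof.
rewrite (_ : (fun w : R => 1 + w ^+ 2) = (fun w : R => 1 + w * w)); last first.
  by apply/funext => x; rewrite expr2.
by apply: is_derive_eq; rewrite /GRing.scale/=; ring.
Qed.

Lemma is_derive_sqrt_oneDsqr (w : R) :
  is_derive w 1 (fun w : R => Num.sqrt (1 + w ^+ 2)) (w / Num.sqrt (1 + w ^+ 2)).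
Proof.
have w0 := oneDsqr_gt0 w; have ds := is_derive1_sqrt w0.
have := @is_derive1_comp _ Num.sqrt (fun w => 1 + w ^+ 2) w _ _ ds (is_derive_oneDsqr w).
have s0 : 0 < Num.sqrt (1 + w ^+ 2) by rewrite sqrtr_gt0.
rewrite (_ : _ * (2 * w) = w / Num.sqrt (1 + w ^+ 2))//.
by field; rewrite gt_eqF.
Qed.

(** With [theta = arctan w], [cos1] and [sin1] are the cosine and sine of [theta], and [cos2] and
    [sin2] those of [2 theta]. *)
Definition cos1 (w : R) : R := (Num.sqrt (1 + w ^+ 2))^-1.
Definition sin1 (w : R) : R := w / Num.sqrt (1 + w ^+ 2).
Definition cos2 (w : R) : R := (1 - w ^+ 2) / (1 + w ^+ 2).
Definition sin2 (w : R) : R := 2 * w / (1 + w ^+ 2).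

Lemma sqr_cos1_sin1 w : cos1 w ^+ 2 + sin1 w ^+ 2 = 1.
Proof.
have w0 := oneDsqr_gt0 w.
rewrite /cos1 /sin1 exprMn exprVn sqr_sqrtr ?ltW//.
by field; rewrite gt_eqF.
Qed.

Lemma sqr_cos2_sin2 w : cos2 w ^+ 2 + sin2 w ^+ 2 = 1.
Proof. by rewrite /cos2 /sin2; field; rewrite gt_eqF// oneDsqr_gt0. Qed.

Lemma cos2E w : cos2 w = cos1 w ^+ 2 - sin1 w ^+ 2.
Proof.
have w0 := oneDsqr_gt0 w.
rewrite /cos1 /sin1 exprMn exprVn sqr_sqrtr ?ltW// /cos2.
by field; rewrite gt_eqF.
Qed.

Lemma sin2E w : sin2 w = 2 * (cos1 w * sin1 w).
Proof.
have w0 := oneDsqr_gt0 w.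
have s0 : 0 < Num.sqrt (1 + w ^+ 2) by rewrite sqrtr_gt0.
rewrite /cos1 /sin1 /sin2 -{1}(sqr_sqrtr (ltW w0)).
by field; rewrite gt_eqF.
Qed.

Lemma continuous_oneDsqr_inv : continuous (fun w : R => (1 + w ^+ 2)^-1).
Proof.
move=> w; have w0 : 1 + w ^+ 2 != 0 by rewrite gt_eqF// oneDsqr_gt0.
exact: is_derive_continuous (is_derive_inv (is_derive_oneDsqr w) w0).
Qed.

Lemma is_derive_cos1 (w : R) : is_derive w 1 cos1 (- (w / Num.sqrt (1 + w ^+ 2)) / (1 + w ^+ 2)).
Proof.
have w0 := oneDsqr_gt0 w.
have s0 : Num.sqrt (1 + w ^+ 2) != 0 by rewrite gt_eqF// sqrtr_gt0.
have := is_derive_inv (is_derive_sqrt_oneDsqr w) s0.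
by rewrite sqr_sqrtr// ltW.
Qed.

Lemma continuous_cos1 : continuous cos1.
Proof. by move=> w; exact: is_derive_continuous (is_derive_cos1 w). Qed.

Lemma continuous_sin1 : continuous sin1.
Proof. by move=> w; apply: cvgM; [exact: cvg_id|exact: continuous_cos1]. Qed.

Lemma continuous_cos2 : continuous cos2.
Proof.
move=> w; apply: cvgM; last exact: continuous_oneDsqr_inv.
by apply: cvgB; [exact: cvg_cst|exact: exprn_continuous].
Qed.

Lemma continuous_sin2 : continuous sin2.
Proof.
move=> w; apply: cvgM; last exact: continuous_oneDsqr_inv.
by apply: cvgM; [exact: cvg_cst|exact: cvg_id].
Qed.

Lemma is_derive_sin1 (w : R) : is_derive w 1 sin1 (cos1 w / (1 + w ^+ 2)).
Proof.
have w0 := oneDsqr_gt0 w; have d := is_derive_cos1 w; rewrite /sin1.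
have s0 : Num.sqrt (1 + w ^+ 2) != 0 by rewrite gt_eqF// sqrtr_gt0.
rewrite (_ : (fun w => _) = (fun w : R => w * cos1 w))//.
apply: is_derive_eq; rewrite /GRing.scale/= /cos1.
by field; rewrite s0 gt_eqF.
Qed.

(** In terms of [theta = arctan w], the derivative of [sin (2 theta) / 2] is [cos (2 theta)], and
    [d theta = dw / (1 + w^2)]. *)
Lemma is_derive_half_sin2 (w : R) :
  is_derive w 1 (fun w => w / (1 + w ^+ 2)) (cos2 w / (1 + w ^+ 2)).
Proof.
have w0 : 1 + w ^+ 2 != 0 by rewrite gt_eqF// oneDsqr_gt0.
have d := is_derive_inv (is_derive_oneDsqr w) w0.
by apply: is_derive_eq; rewrite /GRing.scale/= /cos2; field.
Qed.

(** A point of the right half-plane has argument [arctan (y / x)]; positivity of [A] is what makes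
    the phase a function of [w] alone. *)
Lemma unit_phase (x y : R) : 0 < x ->
  (x +i* y) / `|x +i* y| = cos1 (y / x) +i* sin1 (y / x).
Proof.
move=> x0; set w := y / x; have w0 := oneDsqr_gt0 w.
have yE : y = x * w by rewrite /w; field; rewrite gt_eqF.
have s0 : 0 < Num.sqrt (1 + w ^+ 2) by rewrite sqrtr_gt0.
rewrite normc_def /= yE.
have -> : x ^+ 2 + (x * w) ^+ 2 = x ^+ 2 * (1 + w ^+ 2) by ring.
rewrite sqrtrM ?sqr_ge0// sqrtr_sqr gtr0_norm// -fmorphV.
apply/eqP; rewrite eq_complex /= /cos1 /sin1; apply/andP; split; apply/eqP;
  by field; rewrite !gt_eqF.
Qed.

Lemma unit_phase_sqr (x y : R) : 0 < x ->
  ((x +i* y) / `|x +i* y|) ^+ 2 = cos2 (y / x) +i* sin2 (y / x).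
Proof.
move=> x0; rewrite unit_phase// expr2 cos2E sin2E.
by apply/eqP; rewrite eq_complex /=; apply/andP; split; apply/eqP; ring.
Qed.

End angular_functions.

(** * Real coordinates on S_2 *)

Section coordinates.
Context {R : realType}.
Implicit Types (a b x y : R).

Lemma Siegel2P x1 y1 x2 y2 :
  Siegel2 (x1 +i* y1, x2 +i* y2) <-> 0 < 2 * x1 - (x2 ^+ 2 + y2 ^+ 2).
Proof.
rewrite /Siegel2 /= ltcE /=.
have -> : y1 + - y1 - (x2 * - y2 + y2 * x2) = 0 by ring.
have -> : x1 + x1 - (x2 * x2 - y2 * - y2) = 2 * x1 - (x2 ^+ 2 + y2 ^+ 2) by ring.
by rewrite eqxx.
Qed.

Lemma rhoRE x1 y1 x2 y2 :
  rhoR (x1 +i* y1, x2 +i* y2) = 2 * x1 - (x2 ^+ 2 + y2 ^+ 2).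
Proof. by rewrite /rhoR /rhoZW /=; ring. Qed.

(** The real part is polarization: [a1] and [x1] are expressed by [rho(Z)], [rho(W)] and the squares
    of [|z2|], [|w2|], which combine with the cross term into [|w2 - z2|^2]. *)
Lemma rhoZWE a1 b1 a2 b2 x1 y1 x2 y2 :
  rhoZW (a1 +i* b1, a2 +i* b2) (x1 +i* y1, x2 +i* y2) =
  sgA (2 * a1 - (a2 ^+ 2 + b2 ^+ 2)) a2 b2 (2 * x1 - (x2 ^+ 2 + y2 ^+ 2)) x2 y2 +i*
  (y1 - (b1 + (a2 * y2 - b2 * x2))).
Proof.
apply/eqP; rewrite /rhoZW /sgA eq_complex /=; apply/andP; split; apply/eqP; last by ring.
by field.
Qed.

Lemma uZWE a1 b1 a2 b2 x1 y1 x2 y2 :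
  let t := 2 * x1 - (x2 ^+ 2 + y2 ^+ 2) in
  let rho := 2 * a1 - (a2 ^+ 2 + b2 ^+ 2) in
  uZW (a1 +i* b1, a2 +i* b2) (x1 +i* y1, x2 +i* y2) =
  (sgA rho a2 b2 t x2 y2 ^+ 2 + (y1 - (b1 + (a2 * y2 - b2 * x2))) ^+ 2) / (rho * t) - 1.
Proof.
move=> t rho; rewrite /uZW !rhoRE rhoZWE -/t -/rho normc_def -rmorphXn /=.
by rewrite sqr_sqrtr// addr_ge0// sqr_ge0.
Qed.

Lemma cpowR_1i (t r : R) : 0 < t ->
  cpowR t (1 +i* r) = (t * cos (r * ln t)) +i* (t * sin (r * ln t)).
Proof. by move=> t0; rewrite /cpowR /= mul1r lnK. Qed.

End coordinates.

(** * Eigenvalue and Fourier pair for a general phase *)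

Section spherical_transform.
Context {R : realType}.
Local Notation leb := (@lebesgue_measure R).
Variables (Phi cw sw F g g1 g2 : R -> R) (C M N : R) (m : nat).
Hypothesis mPhi : measurable_fun setT Phi.
Hypothesis Phi0 : forall x, 0 <= Phi x.
Hypothesis PhiC : forall x, Phi x <= C.
Hypothesis PhiM : forall x, M <= x -> Phi x = 0.
Hypothesis ccw : continuous cw.
Hypothesis csw : continuous sw.
Hypothesis cs1 : forall w, cw w ^+ 2 + sw w ^+ 2 = 1.
Hypothesis swN : forall w, sw (- w) = - sw w.
Hypothesis dF : forall w : R, is_derive w 1 F (cw w / (1 + w ^+ 2)).
Hypothesis FN : forall w, F (- w) = - F w.
Hypothesis phase : forall x y : R, 0 < x ->
  ((x +i* y) / `|x +i* y|) ^+ m = cw (y / x) +i* sw (y / x).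
Hypothesis vN : forall e : R, N <= `|e| -> M <= v_of_eta e.
Hypothesis dg : forall x : R, is_derive x 1 g (g1 x).
Hypothesis dg1 : forall x : R, is_derive x 1 g1 (g2 x).
Hypothesis cg2 : continuous g2.
Hypothesis gN0 : forall x, N <= `|x| -> [/\ g x = 0, g1 x = 0 & g2 x = 0].
Hypothesis g0 : forall x, 0 <= g x.
Hypothesis gN : forall x, g (- x) = g x.
Hypothesis gE : forall e, g e = \int[leb]_(u in `]v_of_eta e, +oo[)
  (Phi u * (2 * F (Num.sqrt ((u - v_of_eta e) / (v_of_eta e + 1))))).

Lemma gM0 x : N <= `|x| -> g x = 0. Proof. by case/gN0. Qed.

(** Cauchy-Schwarz through Lagrange's identity; it supplies the bound by 1 on the amplitudes. *)
Lemma norm_phase_le1 (A B x y : R) : A ^+ 2 + B ^+ 2 = 1 -> x ^+ 2 + y ^+ 2 = 1 ->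
  `|A * x + B * y| <= 1.
Proof.
move=> AB xy; rewrite -(@ler_pXn2r _ 2) ?nnegrE// expr1n real_normK ?num_real//.
have -> : (A * x + B * y) ^+ 2 =
    (A ^+ 2 + B ^+ 2) * (x ^+ 2 + y ^+ 2) - (A * y - B * x) ^+ 2 by ring.
by rewrite AB xy mulr1 lerBlDr lerDl sqr_ge0.
Qed.

Lemma norm_le1_of_sqr (x y : R) : x ^+ 2 + y ^+ 2 = 1 -> `|x| <= 1.
Proof.
move=> xy; rewrite -(@ler_pXn2r _ 2) ?nnegrE// expr1n real_normK ?num_real// -xy.
by rewrite lerDl sqr_ge0.
Qed.

(** Used with [L = ln rho(Z)]: since [g] is even, translating the argument only multiplies by
    [cos (r * L)], which is how [rho(Z)^(ir)] splits off. *)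
Lemma cosT_addl (r L : R) : \int[leb]_e (g e * cos (r * (L + e))) = cos (r * L) * cosT g r.
Proof.
have ic := integrable_bump_cos dg gM0 r; have is_ := integrable_bump_sin dg gM0 r.
transitivity (\int[leb]_e (cos (r * L) * (g e * cos (r * e)) -
    sin (r * L) * (g e * sin (r * e)))).
  by apply: eq_Rintegral => e _; rewrite mulrDr cosD; ring.
rewrite RintegralB//; [|exact: integrable_scale|exact: integrable_scale].
by rewrite RintegralZl// RintegralZl// (sinT_eq0 dg gN) mulr0 subr0.
Qed.

Lemma sinT_addl (r L : R) : \int[leb]_e (g e * sin (r * (L + e))) = sin (r * L) * cosT g r.
Proof.
have ic := integrable_bump_cos dg gM0 r; have is_ := integrable_bump_sin dg gM0 r.
transitivity (\int[leb]_e (sin (r * L) * (g e * cos (r * e)) +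
    cos (r * L) * (g e * sin (r * e)))).
  by apply: eq_Rintegral => e _; rewrite mulrDr sinD; ring.
rewrite RintegralD//; [|exact: integrable_scale|exact: integrable_scale].
by rewrite RintegralZl// RintegralZl// (sinT_eq0 dg gN) mulr0 addr0.
Qed.

Section eigenvalue.
Variables (r a1 b1 a2 b2 : R).
Let rho := 2 * a1 - (a2 ^+ 2 + b2 ^+ 2).
Hypothesis rho0 : 0 < rho.
Let c (x2 y2 : R) := b1 + (a2 * y2 - b2 * x2).
Let ct (t : R) := cos (r * ln t).
Let st (t : R) := sin (r * ln t).
Let Nst (t : R) := - st t.

Lemma kernel_integrand x1 y1 x2 y2 :
  let t := 2 * x1 - (x2 ^+ 2 + y2 ^+ 2) in 0 < t ->
  (4 * t ^- 3)%:C * (Kker m Phi (a1 +i* b1, a2 +i* b2) (x1 +i* y1, x2 +i* y2) *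
     cpowR t (1 +i* r)) =
  siegel_integrand Phi (amplitude cw sw ct Nst) c rho a2 b2 x1 y1 x2 y2 +i*
  siegel_integrand Phi (amplitude cw sw st ct) c rho a2 b2 x1 y1 x2 y2.
Proof.
move=> t t0; rewrite /Kker uZWE rhoZWE -/t -/rho phase; last exact: sgA_gt0.
rewrite cpowR_1i// /siegel_integrand -/t t0 /sgH /amplitude -/(c x2 y2).
apply/eqP; rewrite eq_complex /= /ct /Nst /st; apply/andP; split; apply/eqP;
  by field; rewrite gt_eqF.
Qed.

Lemma int_dm_kernel :
  int_dm (fun W => Kker m Phi (a1 +i* b1, a2 +i* b2) W * cpowR (rhoR W) (1 +i* r)) =
  (2 * pi * rho * \int[leb]_e (g e * ct (rho * expR e))) +i*
  (2 * pi * rho * \int[leb]_e (g e * st (rho * expR e))).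
Proof.
have mct : measurable_fun setT ct by rewrite /ct; mfun.
have mst : measurable_fun setT st by rewrite /st; mfun.
have mNst : measurable_fun setT Nst by rewrite /Nst; mfun.
have mc : measurable_fun setT (fun p : R * R => c p.1 p.2) by rewrite /c; mfun.
have ct1 t : `|ct t| <= 1 by rewrite ler_norml cos_geN1 cos_le1.
have st1 t : `|st t| <= 1 by rewrite ler_norml sin_geN1 sin_le1.
have cw1 w : `|cw w| <= 1 by exact: norm_le1_of_sqr (cs1 w).
have sw1 w : `|sw w| <= 1 by apply: (@norm_le1_of_sqr _ (cw w)); rewrite addrC.
have cN1 t w : `|ct t * cw w + Nst t * sw w| <= 1.
  by apply: norm_phase_le1 => //; rewrite /Nst sqrrN /ct /st cos2Dsin2.
have sc1 t w : `|st t * cw w + ct t * sw w| <= 1.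
  by apply: norm_phase_le1 => //; rewrite addrC /ct /st cos2Dsin2.
have cg := bump_continuous dg.
(* [S] is used twice, with coefficients [(ct, Nst)] for the real part and [(st, ct)] for the
   imaginary part. *)
have S := siegel_integral_amplitude a2 b2 mPhi Phi0 PhiC PhiM ccw csw cw1 sw1 swN dF FN
  cg gM0 vN gE mc rho0.
rewrite -(S ct Nst)// -(S st ct)// /int_dm /cintegral.
have E (p : R * R * R * R) : Siegel2 (ofR4 p) <->
    0 < 2 * p.1.1.1 - (p.1.2 ^+ 2 + p.2 ^+ 2).
  exact: Siegel2P.
have K (p : R * R * R * R) : 0 < 2 * p.1.1.1 - (p.1.2 ^+ 2 + p.2 ^+ 2) ->
  (4 * (rhoR (ofR4 p)) ^- 3)%:C * (Kker m Phi (a1 +i* b1, a2 +i* b2) (ofR4 p) *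
     cpowR (rhoR (ofR4 p)) (1 +i* r)) =
  siegel_integrand Phi (amplitude cw sw ct Nst) c rho a2 b2 p.1.1.1 p.1.1.2 p.1.2 p.2 +i*
  siegel_integrand Phi (amplitude cw sw st ct) c rho a2 b2 p.1.1.1 p.1.1.2 p.1.2 p.2.
  by move=> t0; rewrite -kernel_integrand// rhoRE.
apply/eqP; rewrite eq_complex /=; apply/andP; split; apply/eqP;
  rewrite Rintegral_mkcond; apply: eq_Rintegral => p _; rewrite patchE.
- case: ifPn => [/set_mem/= /E t0|]; first by rewrite K.
  rewrite notin_setE/= => /E/negP/negbTE t0.
  by rewrite /siegel_integrand t0 mul0r.
- case: ifPn => [/set_mem/= /E t0|]; first by rewrite K.
  rewrite notin_setE/= => /E/negP/negbTE t0.
  by rewrite /siegel_integrand t0 mul0r.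
Qed.

End eigenvalue.

Lemma siegel_eigenvalue (r : R) (Z : R[i] * R[i]) : Siegel2 Z ->
  int_dm (fun W => Kker m Phi Z W * cpowR (rhoR W) (1 +i* r)) =
  (2 * pi * cosT g r)%:C * cpowR (rhoR Z) (1 +i* r).
Proof.
case: Z => [[a1 b1] [a2 b2]] /Siegel2P rho0; rewrite int_dm_kernel// rhoRE.
set rho := 2 * a1 - _ in rho0 *; rewrite cpowR_1i//.
have lnE e : ln (rho * expR e) = ln rho + e by rewrite lnM ?posrE ?expR_gt0// expRK.
under eq_Rintegral do rewrite lnE.
under [X in _ +i* (_ * X)]eq_Rintegral do rewrite lnE.
rewrite cosT_addl sinT_addl.
by apply/eqP; rewrite eq_complex /=; apply/andP; split; apply/eqP; ring.
Qed.

Lemma spherical_transform_pair (G : R -> R) : (forall e, G (v_of_eta e) = g e) ->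
  exists h : R -> R[i],
    (forall (r : R) (Z : R[i] * R[i]), Siegel2 Z ->
       int_dm (fun W => Kker m Phi Z W * cpowR (rhoR W) (1 +i* r))
       = h r * cpowR (rhoR Z) (1 +i* r)) /\
    (forall r : R, h r = (2 * pi)%:C *
       cintR (fun eta => (G (v_of_eta eta))%:C * expi (r * eta))) /\
    (forall eta : R, (G (v_of_eta eta))%:C = (1 / (4 * pi ^+ 2))%:C *
       cintR (fun r => h r * expi (- (r * eta)))).
Proof.
move=> GE; exists (fun r => (2 * pi * cosT g r)%:C); split; first exact: siegel_eigenvalue.
have g1M x : N <= `|x| -> g1 x = 0 by case/gN0.
have g2M x : N <= `|x| -> g2 x = 0 by case/gN0.
split=> [r|eta].
  have -> : cintR (fun eta => (G (v_of_eta eta))%:C * expi (r * eta)) = (cosT g r)%:C.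
    apply/eqP; rewrite /cintR /cintegral eq_complex /=; apply/andP; split; apply/eqP.
      by apply: eq_Rintegral => e _; rewrite GE; ring.
    rewrite -[RHS](sinT_eq0 dg gN r).
    by apply: eq_Rintegral => e _; rewrite GE; ring.
  by rewrite rmorphM.
have ic := integrable_cosT_cos dg dg1 cg2 gM0 g1M g2M g0 eta.
have -> : cintR (fun r => (2 * pi * cosT g r)%:C * expi (- (r * eta))) =
    (2 * pi * (2 * pi * g eta))%:C.
  rewrite -(fourier_inversion_cos dg dg1 cg2 gM0 g1M g2M g0 gN).
  apply/eqP; rewrite /cintR /cintegral eq_complex /=; apply/andP; split; apply/eqP.
    by rewrite -RintegralZl//; apply: eq_Rintegral => r _; rewrite cosN; ring.
  (* The imaginary part is [cosT g r * sin (- (r * eta))] up to a constant; [cosT g] is even in [r],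
     so the product is odd. *)
  apply: Rintegral_odd.
    have mc := measurable_cosT dg gM0 g0.
    by mfun.
  move=> r; rewrite mulNr opprK !mul0r !addr0 sinN.
  rewrite (_ : cosT g (- r) = cosT g r); first by ring.
  by apply: eq_Rintegral => x _; rewrite mulNr cosN.
have pi0 : (pi : R) != 0 by rewrite gt_eqF// pi_gt0.
rewrite -rmorphM GE; congr (_%:C).
rewrite (_ : 2 * pi * (2 * pi * g eta) = 4 * pi ^+ 2 * g eta); last by ring.
by rewrite div1r mulKf// mulf_neq0// expf_neq0.
Qed.

End spherical_transform.

(** * Half-angle functions of [eta] and the weights of [P1] and [Q0] *)

Section profile_weights.
Context {R : realType}.
Local Notation leb := (@lebesgue_measure R).

Definition cosh_half (e : R) : R := (expR (e / 2) + expR (- (e / 2))) / 2.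
(** The denominator 4 makes this the derivative of [cosh_half], that is [sinh (e / 2) / 2]. *)
Definition sinh_half (e : R) : R := (expR (e / 2) - expR (- (e / 2))) / 4.

(** [v + 1 = cosh^2 (eta / 2)]; the factor [sqrt (v + 1)] of [P1] is thereby visibly smooth and even
    in [eta]. *)
Lemma sqrt_v_of_eta (e : R) : Num.sqrt (v_of_eta e + 1) = cosh_half e.
Proof.
have c0 : 0 <= cosh_half e by rewrite divr_ge0// addr_ge0// expR_ge0.
rewrite -(ger0_norm c0) -sqrtr_sqr; congr (Num.sqrt _).
have eE : expR e = expR (e / 2) ^+ 2 by rewrite -expRM_natl; congr expR; field.
rewrite /v_of_eta /cosh_half !expRN eE.
by field; rewrite gt_eqF// expR_gt0.
Qed.

Lemma is_derive_expR_half (e : R) :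
  is_derive e 1 (fun x : R => expR (x / 2)) (expR (e / 2) / 2).
Proof.
apply: is_derive1_comp; apply: is_derive_eq.
by rewrite !scaler0 add0r /GRing.scale/= mulr1.
Qed.

Lemma is_derive_expRN_half (e : R) :
  is_derive e 1 (fun x : R => expR (- (x / 2))) (- expR (- (e / 2)) / 2).
Proof.
rewrite mulNr -mulrN; apply: is_derive1_comp; apply: is_derive_eq.
by rewrite !scaler0 add0r /GRing.scale/= mulr1.
Qed.

Lemma is_derive_cosh_half (e : R) : is_derive e 1 cosh_half (sinh_half e).
Proof.
have d1 := is_derive_expR_half e; have d2 := is_derive_expRN_half e.
by rewrite /cosh_half /sinh_half; apply: is_derive_eq; rewrite /GRing.scale/=; field.
Qed.

Lemma is_derive_sinh_half (e : R) : is_derive e 1 sinh_half (cosh_half e / 4).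
Proof.
have d1 := is_derive_expR_half e; have d2 := is_derive_expRN_half e.
by rewrite /cosh_half /sinh_half; apply: is_derive_eq; rewrite /GRing.scale/=; field.
Qed.

(** At the endpoint [q] of the arc [1 + q^2 = (u + 1) / (v + 1)], which turns [2 F(q)] for
    [F = sin (2 theta) / 2] into the weight of [P1]. *)
Lemma double_angular_P1 (v u : R) : -1 < v -> v < u ->
  2 * (Num.sqrt ((u - v) / (v + 1)) / (1 + Num.sqrt ((u - v) / (v + 1)) ^+ 2)) =
  2 / (u + 1) * Num.sqrt ((v + 1) * (u - v)).
Proof.
move=> v1 vu; have v0 : 0 < v + 1 by lra.
have u0 : 0 < u + 1 by lra.
have q0 : 0 <= (u - v) / (v + 1) by rewrite divr_ge0 ?ltW// subr_gt0.
rewrite sqr_sqrtr//.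
have -> : (v + 1) * (u - v) = (v + 1) ^+ 2 * ((u - v) / (v + 1)).
  by field; rewrite gt_eqF.
rewrite [in RHS]sqrtrM ?sqr_ge0// sqrtr_sqr gtr0_norm//.
have -> : 1 + (u - v) / (v + 1) = (u + 1) / (v + 1) by field; rewrite gt_eqF.
by field; rewrite !gt_eqF.
Qed.

Lemma angular_Q0 (v u : R) : -1 < v -> v < u ->
  sin1 (Num.sqrt ((u - v) / (v + 1))) = Num.sqrt ((u - v) / (u + 1)).
Proof.
move=> v1 vu; have v0 : 0 < v + 1 by lra.
have u0 : 0 < u + 1 by lra.
have q0 : 0 <= (u - v) / (v + 1) by rewrite divr_ge0 ?ltW// subr_gt0.
rewrite /sin1 sqr_sqrtr// -sqrtrV; last by rewrite addr_ge0.
rewrite -sqrtrM//; congr (Num.sqrt _).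
have -> : 1 + (u - v) / (v + 1) = (u + 1) / (v + 1) by field; rewrite gt_eqF.
by field; rewrite !gt_eqF.
Qed.

End profile_weights.

(** * The transform pairs and inversion formulas for [P1] and [Q0] *)

Section transform_pairs.
Context {R : realType}.
Local Notation leb := (@lebesgue_measure R).
Variables (Phi : R -> R).
Hypothesis PhiC2 : C2c Phi.
Hypothesis Phi0 : forall x, 0 <= Phi x.

Let dPhi (x : R) : is_derive x 1 Phi (Phi^`() x).
Proof. by rewrite derive1E; apply: derivableP; exact: PhiC2.1. Qed.

Let dPhi1 (x : R) : is_derive x 1 Phi^`() (Phi^`()^`() x).
Proof. by rewrite (derive1E Phi^`()); apply: derivableP; exact: PhiC2.2.1. Qed.

Let cPhi2 : continuous Phi^`()^`().
Proof. exact: PhiC2.2.2.1. Qed.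

Let cPhi : continuous Phi.
Proof. by move=> x; exact: is_derive_continuous (dPhi x). Qed.

Let mPhi : measurable_fun setT Phi.
Proof. exact: continuous_measurable_fun. Qed.

Lemma P1_transform_pair :
  exists h : R -> R[i],
    (forall (r : R) (Z : R[i] * R[i]), Siegel2 Z ->
       int_dm (fun W => Kker 2 Phi Z W * cpowR (rhoR W) (1 +i* r))
       = h r * cpowR (rhoR Z) (1 +i* r)) /\
    (forall r : R, h r = (2 * pi)%:C *
       cintR (fun eta => (P1 Phi (v_of_eta eta))%:C * expi (r * eta))) /\
    (forall eta : R, (P1 Phi (v_of_eta eta))%:C = (1 / (4 * pi ^+ 2))%:C *
       cintR (fun r => h r * expi (- (r * eta)))).
Proof.
have [M M0 [PhiB PhiM3]] := C2c_support PhiC2.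
have [C C0 PhiC] := bounded_continuous_compact cPhi PhiB.
have PhiM x : M <= x -> Phi x = 0 by case/PhiM3.
have Phi1M x : M <= x -> Phi^`() x = 0 by case/PhiM3.
have Phi2M x : M <= x -> Phi^`()^`() x = 0 by case/PhiM3.
have PE e : P1 Phi (v_of_eta e) = prof Phi (-1) cosh_half e.
  by rewrite (P1_abel dPhi PhiM Phi0 erefl (v_of_eta_gtN1 e)) sqrt_v_of_eta.
have ck2 : continuous (fun e : R => cosh_half e / 4).
  move=> e; apply: cvgM; last exact: cvg_cst.
  exact: is_derive_continuous (is_derive_cosh_half e).
apply: (@spherical_transform_pair _ Phi cos2 sin2 (fun w => w / (1 + w ^+ 2))
  (prof Phi (-1) cosh_half) (prof1 Phi Phi^`() (-1) cosh_half sinh_half)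
  (prof2 Phi Phi^`() Phi^`()^`() (-1) cosh_half sinh_half (fun e => cosh_half e / 4))
  C M (4 * M + 1) 2%N).
- exact: mPhi.
- exact: Phi0.
- by move=> x; apply: le_trans (PhiC x); exact: ler_norm.
- exact: PhiM.
- exact: continuous_cos2.
- exact: continuous_sin2.
- exact: sqr_cos2_sin2.
- by move=> w; rewrite /sin2 sqrrN mulrN mulNr.
- exact: is_derive_half_sin2.
- by move=> w; rewrite sqrrN mulNr.
- exact: unit_phase_sqr.
- exact: v_of_eta_ge_support.
- by move=> x; apply: (is_derive_prof (M := M)) => //; exact: is_derive_cosh_half.
- by move=> x; apply: (is_derive_prof1 (M := M)) => //; [exact: is_derive_cosh_half|exact: is_derive_sinh_half].
- by apply: (continuous_prof2 (M := M)) => //; [exact: is_derive_cosh_half|exact: is_derive_sinh_half].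
- by move=> x; exact: prof_eq0.
- move=> x; apply: mulr_ge0; first by rewrite divr_ge0// addr_ge0// expR_ge0.
  by rewrite mulr_ge0// abelT_psi_ge0.
- by move=> x; rewrite /prof v_of_etaN /cosh_half mulNr opprK [expR (- _) + _]addrC.
- move=> e; rewrite -PE /P1; apply: eq_Rintegral => u /set_mem/=.
  rewrite in_itv/= andbT => vu; rewrite double_angular_P1//; first by ring.
  exact: v_of_eta_gtN1.
- exact: PE.
Qed.

Lemma Q0_transform_pair :
  exists h : R -> R[i],
    (forall (r : R) (Z : R[i] * R[i]), Siegel2 Z ->
       int_dm (fun W => Kker 1 Phi Z W * cpowR (rhoR W) (1 +i* r))
       = h r * cpowR (rhoR Z) (1 +i* r)) /\
    (forall r : R, h r = (2 * pi)%:C *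
       cintR (fun eta => (Q0 Phi (v_of_eta eta))%:C * expi (r * eta))) /\
    (forall eta : R, (Q0 Phi (v_of_eta eta))%:C = (1 / (4 * pi ^+ 2))%:C *
       cintR (fun r => h r * expi (- (r * eta)))).
Proof.
have [M M0 [PhiB PhiM3]] := C2c_support PhiC2.
have [C C0 PhiC] := bounded_continuous_compact cPhi PhiB.
have PhiM x : M <= x -> Phi x = 0 by case/PhiM3.
have Phi1M x : M <= x -> Phi^`() x = 0 by case/PhiM3.
have Phi2M x : M <= x -> Phi^`()^`() x = 0 by case/PhiM3.
pose k : R -> R := fun=> 1; pose z : R -> R := fun=> 0.
have dk (x : R) : is_derive x 1 k (z x) by exact: is_derive_cst.
have dz (x : R) : is_derive x 1 z (z x) by exact: is_derive_cst.
have cz : continuous z by move=> x; exact: cvg_cst.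
have QE e : Q0 Phi (v_of_eta e) = prof Phi (- 2^-1) k e.
  by rewrite (Q0_abel dPhi Phi0 erefl (v_of_eta_gtN1 e)) /prof mul1r.
apply: (@spherical_transform_pair _ Phi cos1 sin1 sin1
  (prof Phi (- 2^-1) k) (prof1 Phi Phi^`() (- 2^-1) k z)
  (prof2 Phi Phi^`() Phi^`()^`() (- 2^-1) k z z) C M (4 * M + 1) 1%N).
- exact: mPhi.
- exact: Phi0.
- by move=> x; apply: le_trans (PhiC x); exact: ler_norm.
- exact: PhiM.
- exact: continuous_cos1.
- exact: continuous_sin1.
- exact: sqr_cos1_sin1.
- by move=> w; rewrite /sin1 sqrrN mulNr.
- exact: is_derive_sin1.
- by move=> w; rewrite /sin1 sqrrN mulNr.
- by move=> x y x0; rewrite expr1 unit_phase.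
- exact: v_of_eta_ge_support.
- by move=> x; exact: (is_derive_prof (M := M)).
- by move=> x; exact: (is_derive_prof1 (M := M)).
- exact: (continuous_prof2 (M := M)).
- by move=> x; exact: prof_eq0.
- by move=> x; rewrite mulr_ge0// mulr_ge0// abelT_psi_ge0.
- by move=> x; rewrite /prof v_of_etaN.
(* In [Q0] the factor 2 stands outside the integral. Moving it inside calls for integrability, which
   holds because the weight [sqrt ((u - v) / (u + 1))] is at most 1. *)
- move=> e; have v0 := v_of_eta_ge0 e; rewrite -QE /Q0 -RintegralZl//.
    apply: eq_Rintegral => u /set_mem/=; rewrite in_itv/= andbT => vu.
    by rewrite angular_Q0//; [ring|exact: v_of_eta_gtN1].
  apply: (@integrable_bounded_support _ _ _ C M) => //.
  + by apply: measurable_funTS; mfun.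
  + move=> u /=; rewrite in_itv/= andbT => vu; have u0 : 0 < u by exact: le_lt_trans vu.
    have u10 : 0 < u + 1 by lra.
    rewrite normrM -[leRHS]mulr1 ler_pM// ger0_norm ?sqrtr_ge0//.
    by rewrite -[leRHS]sqrtr1 ler_sqrt// ler_pdivrMr// mul1r; lra.
  + move=> u /=; rewrite in_itv/= andbT => vu; have u0 : 0 < u by exact: le_lt_trans vu.
    by rewrite gtr0_norm// => /ltW Mu; rewrite PhiM// mul0r.
- exact: QE.
Qed.

Lemma P1_inversion (u : R) : -1 < u ->
  Phi u = (u + 1) / pi * \int[leb]_(v in `]u, +oo[)
    (derive1 (derive1 (fun w => P1 Phi w / Num.sqrt (w + 1))) v / Num.sqrt (v - u)).
Proof.
move=> u1; have u10 : 0 < u + 1 by lra.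
have [M M0 [_ PhiM3]] := C2c_support PhiC2.
have PhiM x : M <= x -> Phi x = 0 by case/PhiM3.
have Phi1M x : M <= x -> Phi^`() x = 0 by case/PhiM3.
have Phi2M x : M <= x -> Phi^`()^`() x = 0 by case/PhiM3.
have TE v : -1 < v -> P1 Phi v / Num.sqrt (v + 1) = 2 * abelT (psi Phi (-1)) v.
  move=> v1; rewrite (P1_abel dPhi PhiM Phi0 erefl v1) mulrC mulKf//.
  by rewrite gt_eqF// sqrtr_gt0; lra.
rewrite -mulrA -(profile_inversion dPhi dPhi1 cPhi2 PhiM Phi1M Phi2M TE u1) /psi.
by rewrite powR_inv1 ?ltW// mulrCA divff ?mulr1// gt_eqF.
Qed.

Lemma Q0_inversion (u : R) : -1 < u ->
  Phi u = 1 / pi * Num.sqrt (u + 1) * \int[leb]_(v in `]u, +oo[)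
    (derive1 (derive1 (Q0 Phi)) v / Num.sqrt (v - u)).
Proof.
move=> u1; have u10 : 0 < u + 1 by lra.
have [M M0 [_ PhiM3]] := C2c_support PhiC2.
have PhiM x : M <= x -> Phi x = 0 by case/PhiM3.
have Phi1M x : M <= x -> Phi^`() x = 0 by case/PhiM3.
have Phi2M x : M <= x -> Phi^`()^`() x = 0 by case/PhiM3.
have TE v : -1 < v -> Q0 Phi v = 2 * abelT (psi Phi (- 2^-1)) v.
  by move=> v1; exact: (Q0_abel dPhi Phi0 erefl v1).
rewrite div1r [pi^-1 * _]mulrC -mulrA.
rewrite -(profile_inversion dPhi dPhi1 cPhi2 PhiM Phi1M Phi2M TE u1) /psi.
rewrite powRN powR12_sqrt ?ltW// mulrCA divff ?mulr1// gt_eqF// sqrtr_gt0.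
exact: u10.
Qed.

End transform_pairs.

Theorem theorem2p6 (R : realType) (Phi : R -> R) :
  C2c Phi -> (forall x, 0 <= Phi x) ->
  (* (a) k = 1, i.e. 2k = 2 *)
  ((exists h1 : R -> R[i],
      (forall (r : R) (Z : R[i] * R[i]), Siegel2 Z ->
         int_dm (fun W => Kker 2 Phi Z W * cpowR (rhoR W) (1 +i* r))
         = h1 r * cpowR (rhoR Z) (1 +i* r)) /\
      (forall r : R, h1 r = (2 * pi)%:C *
         cintR (fun eta => (P1 Phi (v_of_eta eta))%:C * expi (r * eta))) /\
      (forall eta : R, (P1 Phi (v_of_eta eta))%:C = (1 / (4 * pi ^+ 2))%:C *
         cintR (fun r => h1 r * expi (- (r * eta))))) /\
   (forall u : R, -1 < u ->
      Phi u = (u + 1) / pi *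
        Rintegral (@lebesgue_measure R) `]u, +oo[
          (fun v => derive1 (derive1 (fun w => P1 Phi w / Num.sqrt (w + 1))) v
                    / Num.sqrt (v - u)))) /\
  (* (b) k = 1/2, i.e. 2k = 1 *)
  ((exists h2 : R -> R[i],
      (forall (r : R) (Z : R[i] * R[i]), Siegel2 Z ->
         int_dm (fun W => Kker 1 Phi Z W * cpowR (rhoR W) (1 +i* r))
         = h2 r * cpowR (rhoR Z) (1 +i* r)) /\
      (forall r : R, h2 r = (2 * pi)%:C *
         cintR (fun eta => (Q0 Phi (v_of_eta eta))%:C * expi (r * eta))) /\
      (forall eta : R, (Q0 Phi (v_of_eta eta))%:C = (1 / (4 * pi ^+ 2))%:C *
         cintR (fun r => h2 r * expi (- (r * eta))))) /\
   (forall u : R, -1 < u ->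
      Phi u = 1 / pi * Num.sqrt (u + 1) *
        Rintegral (@lebesgue_measure R) `]u, +oo[
          (fun v => derive1 (derive1 (Q0 Phi)) v / Num.sqrt (v - u)))).
Proof.
move=> PhiC2 Phi0; split; (split; [|move=> u u1]).
- exact: P1_transform_pair.
- exact: P1_inversion.
- exact: Q0_transform_pair.
- exact: Q0_inversion.
Qed.
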